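(* Let $n\ge 2$ and let $K$ be a convex body in $\mathbb{R}^n$. (i) If $K$ is a local maximizer for the isotropy constant $L_K$ (among all convex bodies in $\mathbb{R}^n$), then there is no point $X_0\in\partial K$ at which $K$ has positive generalized Gauss curvature. (ii) If $K$ is centrally symmetric and is a local maximizer for $L_K$ among centrally symmetric convex bodies in $\mathbb{R}^n$, then there is no point $X_0\in\partial K$ at which $K$ has positive generalized Gauss curvature.
   Context: $\mathbb{R}^n$ carries its canonical scalar product $\langle\cdot,\cdot\rangle$ and Euclidean norm $|\cdot|$; $|B|$ denotes the volume (Lebesgue measure) of a Borel set $B\subset\mathbb{R}^n$. A convex body is a compact convex set with non-empty interior; it is centrally symmetric if $K=-K$. Isotropy constant. For every convex body $K\subset\mathbb{R}^n$ there is a volume preserving affine map $A:\mathbb{R}^n\to\mathbb{R}^n$, unique up to orthogonal transformations, such that for some constant $M_K>0$ depending on $K$ one has, for every $y\in\mathbb{R}^n$, $\int_{AK}\langle x,y\rangle\,dx=0$ and $\int_{AK}\langle x,y\rangle^2\,dx=M_K^2|y|^2$. The isotropy constant is $L_K=M_K/|K|^{\frac{n+2}{2n}}$. Local maximizers. $K$ is a local maximizer for $L_K$ if for some $\varepsilon>0$ one has $L_{K'}\le L_K$ for all convex bodies $K'$ in $\mathbb{R}^n$ with $d(K',K)<\varepsilon$; ''among centrally symmetric convex bodies'' means that only centrally symmetric $K'$ are considered. Here $d$ may be taken to be either the Hausdorff distance or the (logarithmic) Banach–Mazur distance $\log\inf\{\lambda\ge1: K-x\subset T(K'-y)\subset\lambda(K-x)$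 for some $x,y\in\mathbb{R}^n$ and some invertible linear $T\}$. Positive generalized Gauss curvature. $K$ has positive generalized (Gauss) curvature at $X_0\in\partial K$ if there exist a (unit) inner normal $N$ of $K$ at $X_0$ (i.e. $\langle X-X_0,N\rangle\ge0$ for all $X\in K$) and a positive definite quadratic form $q$ on $N^\perp=\{x\in\mathbb{R}^n:\langle x,N\rangle=0\}$ such that for every $\varepsilon>0$ there exists $a>0$ such that whenever $Y\in N^\perp$ and $y\in\mathbb{R}$ satisfy $X_0+Y+yN\in\partial K\cap B(X_0,a)$, one has $(1-\varepsilon)q(Y)\le y\le(1+\varepsilon)q(Y)$. Here $B(X_0,a)$ is the Euclidean ball of center $X_0$ and radius $a$. *)

(* Defs.v *)
From HB Require Import structures.
From mathcomp Require Import all_boot all_order all_algebra.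
From mathcomp Require Import lra.
From mathcomp Require Import all_classical all_reals all_analysis.
From mathcomp Require Import measurable_realfun.

Set Implicit Arguments.
Unset Strict Implicit.
Unset Printing Implicit Defensive.

Import Order.TTheory GRing.Theory Num.Theory.
Import numFieldNormedType.Exports.

Local Open Scope classical_set_scope.
Local Open Scope ring_scope.

(* The type 'rV[R]_n stands for R^n. Its library topology comes from the sup
   norm, hence is the Euclidean one. It is given below the sigma-algebra generated
   by the coordinates; by [measurable_rVE] this is the Borel sigma-algebra. *)
Definition rV_display : measure_display.
Proof. exact: default_measure_display. Qed.

Section measurable_rV.
Context {R : realType} {n : nat}.

Let coord (i : 'I_n) (v : 'rV[R]_n) : measurableTypeR R := v ord0 i.

Let rV_set0 : g_sigma_preimage coord set0.
Proof. exact: sigma_algebra0. Qed.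

Let rV_setC A : g_sigma_preimage coord A -> g_sigma_preimage coord (~` A).
Proof. exact: sigma_algebraC. Qed.

Let rV_bigcup (F : _^nat) : (forall i, g_sigma_preimage coord (F i)) ->
  g_sigma_preimage coord (\bigcup_i (F i)).
Proof. exact: sigma_algebra_bigcup. Qed.

HB.instance Definition _ := @isMeasurable.Build rV_display
  'rV[R]_n (g_sigma_preimage coord) rV_set0 rV_setC rV_bigcup.

Lemma measurable_rV_coord (i : 'I_n) :
  measurable_fun [set: 'rV[R]_n] (fun v => v ord0 i : measurableTypeR R).
Proof.
move=> _ Y mY; rewrite setTI; apply: sub_sigma_algebra => /=.
rewrite -bigcup_seq/=; exists i => /=; first by rewrite mem_index_enum.
by exists Y => //; rewrite setTI.
Qed.

Lemma measurable_fun_rVP d (T : measurableType d) (f : T -> 'rV[R]_n) :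
  (forall i, measurable_fun [set: T] (fun x => f x ord0 i : measurableTypeR R)) ->
  measurable_fun [set: T] f.
Proof.
move=> mf.
suff H : g_sigma_preimage coord `<=` [set B | measurable (f @^-1` B)].
  by move=> _ A mA; rewrite setTI; exact: H.
apply: smallest_sub.
  split; rewrite /=.
  - by rewrite preimage_set0.
  - by move=> A mA; rewrite setTD preimage_setC; exact: measurableC.
  - by move=> F mF; rewrite preimage_bigcup; exact: bigcupT_measurable.
rewrite -bigcup_seq => B [i /= _ [C mC <-]].
by rewrite setTI /= -[X in measurable X]setTI; exact: mf.
Qed.

End measurable_rV.


Section pushforward_product.
Local Open Scope ereal_scope.
Context d1 d2 d3 (T1 : measurableType d1) (T2 : measurableType d2)
  (T3 : measurableType d3) (R : realType).
Variables (m1 : {sigma_finite_measure set T1 -> \bar R})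
  (m2 : {sigma_finite_measure set T2 -> \bar R}).
Variables (f : T1 * T2 -> T3) (g : T3 -> T1 * T2).
Hypotheses (mf : measurable_fun setT f) (mg : measurable_fun setT g).
Hypothesis fK : cancel f g.

Lemma pushforward_product_sigma_finite :
  {mu : {sigma_finite_measure set T3 -> \bar R} |
    mu = pushforward (m1 \x m2) f :> (set T3 -> \bar R)}.
Proof.
pose pi : {measure set (T1 * T2)%type -> \bar R} := m1 \x m2.
set nu := pushforward _ _.
have nuE A : nu A = pi (f @^-1` A) by [].
have mc A : measurable A -> measurable (f @^-1` A).
  by move=> mA; rewrite -[X in measurable X]setTI; exact: mf.
have nu0 : nu set0 = 0 by rewrite nuE preimage_set0 measure0.
have nu_ge0 A : 0 <= nu A by exact: integral_ge0.
have nu_sadd : semi_sigma_additive nu.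
  move=> F mF tF mUF; rewrite nuE preimage_bigcup.
  apply: (@measure_semi_sigma_additive _ _ _ pi).
  - by move=> k; exact: mc.
  - apply/trivIsetP => i j _ _ ij; rewrite -preimage_setI.
    by move/trivIsetP : tF => /(_ _ _ _ _ ij) ->//; rewrite preimage_set0.
  - by rewrite -preimage_bigcup; exact: mc.
have nu_sf : sigma_finite setT nu.
  have /sigma_finiteP[F [TF ndF Foo]] := sigma_finiteT m1.
  have /sigma_finiteP[G [TG ndG Goo]] := sigma_finiteT m2.
  exists (fun k => g @^-1` (F k `*` G k)).
    rewrite -preimage_bigcup (_ : \bigcup_k _ = setT) ?preimage_setT//.
    apply/seteqP; split => // -[x y] _.
    have [k _ Fkx] : (\bigcup_k F k) x by rewrite -TF.
    have [l _ Gly] : (\bigcup_k G k) y by rewrite -TG.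
    exists (maxn k l) => //; split => /=.
    - by move: x Fkx; exact/subsetPset/ndF/leq_maxl.
    - by move: y Gly; exact/subsetPset/ndG/leq_maxr.
  move=> k; have [mFk Fkoo] := Foo k; have [mGk Gkoo] := Goo k; split.
    by rewrite -[X in measurable X]setTI; apply: mg => //; exact: measurableX.
  rewrite nuE -comp_preimage (_ : _ \o _ = id).
    rewrite preimage_id [pi _]product_measure1E//.
    by rewrite lte_mul_pinfty// ge0_fin_numE.
  by apply/funext => p /=; rewrite fK.
clearbody nu.
pose mx := isMeasure.Build _ _ _ nu nu0 nu_ge0 nu_sadd.
pose nuM : {measure set _ -> \bar R} := HB.pack nu mx.
pose mx2 := Measure_isSigmaFinite.Build _ _ _ nuM nu_sf.
pose nuS : {sigma_finite_measure set _ -> \bar R} := HB.pack nu mx mx2.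
by exists nuS.
Qed.

End pushforward_product.

Section lebesgue_rV.
Context {R : realType}.
Local Open Scope ereal_scope.

Definition rV_cons n (p : measurableTypeR R * 'rV[R]_n) : 'rV[R]_n.+1 :=
  row_mx (p.1%:M : 'M[R]_1) p.2.

Lemma rV_cons0 n p : @rV_cons n p ord0 ord0 = p.1.
Proof.
rewrite /rV_cons; have -> : ord0 = lshift n (ord0 : 'I_1) by exact/val_inj.
by rewrite (row_mxEl (p.1%:M : 'M[R]_1)) mxE eqxx.
Qed.

Lemma rV_consS n p (j : 'I_n) : @rV_cons n p ord0 (lift ord0 j) = p.2 ord0 j.
Proof.
rewrite /rV_cons; have -> : lift ord0 j = rshift 1 j by exact/val_inj.
by rewrite (row_mxEr (p.1%:M : 'M[R]_1)).
Qed.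

Lemma measurable_rV_cons n : measurable_fun setT (@rV_cons n).
Proof.
apply: measurable_fun_rVP => i; have [j ->|->] := unliftP ord0 i.
  under eq_fun do rewrite rV_consS.
  exact: measurableT_comp (measurable_rV_coord j) measurable_snd.
under eq_fun do rewrite rV_cons0.
exact: measurable_fst.
Qed.

Definition rV_uncons n (v : 'rV[R]_n.+1) : measurableTypeR R * 'rV[R]_n :=
  (v ord0 ord0, \row_j v ord0 (lift ord0 j)).

Lemma rV_consK n : cancel (@rV_cons n) (@rV_uncons n).
Proof.
move=> [a v]; rewrite /rV_uncons rV_cons0; congr pair.
by apply/rowP => j; rewrite mxE rV_consS.
Qed.

Lemma measurable_rV_uncons n : measurable_fun setT (@rV_uncons n).
Proof.
apply/measurable_fun_pairP; split; first exact: measurable_rV_coord.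
apply: measurable_fun_rVP => j; rewrite /comp /=.
under eq_fun do rewrite mxE.
exact: measurable_rV_coord.
Qed.

(* By [lebesgue_rV_prod], a product of Borel sets has the product of the
   one-dimensional measures as its measure. *)
Fixpoint lebesgue_rV n : set 'rV[R]_n -> \bar R :=
  match n with
  | 0 => \d_(0%R : 'rV[R]_0)
  | m.+1 => pushforward (@lebesgue_measure R \x @lebesgue_rV m) (@rV_cons m)
  end.

Lemma lebesgue_rV_sigma_finite_measure n :
  {mu : {sigma_finite_measure set 'rV[R]_n -> \bar R} |
    mu = @lebesgue_rV n :> (set 'rV[R]_n -> \bar R)}.
Proof.
elim: n => [|n [mu IH]]; first by exists \d_(0%R : 'rV[R]_0).
by rewrite /= -IH; exact: pushforward_product_sigma_finite
  (@measurable_rV_cons n) (@measurable_rV_uncons n) (@rV_consK n).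
Qed.

Section instances.
Variable n : nat.

Let lebesgue_rV0 : @lebesgue_rV n set0 = 0.
Proof. by have [mu <-] := lebesgue_rV_sigma_finite_measure n; exact: measure0. Qed.

Let lebesgue_rV_ge0 A : 0 <= @lebesgue_rV n A.
Proof. by have [mu <-] := lebesgue_rV_sigma_finite_measure n; exact: measure_ge0. Qed.

Let lebesgue_rV_sigma_additive : semi_sigma_additive (@lebesgue_rV n).
Proof.
have [mu <-] := lebesgue_rV_sigma_finite_measure n.
exact: measure_semi_sigma_additive.
Qed.

HB.instance Definition _ := isMeasure.Build _ _ _ (@lebesgue_rV n)
  lebesgue_rV0 lebesgue_rV_ge0 lebesgue_rV_sigma_additive.

Let lebesgue_rV_sigma_finite : sigma_finite setT (@lebesgue_rV n).
Proof.
by have [mu <-] := lebesgue_rV_sigma_finite_measure n; exact: sigma_finiteT.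
Qed.

HB.instance Definition _ := Measure_isSigmaFinite.Build _ _ _ (@lebesgue_rV n)
  lebesgue_rV_sigma_finite.

End instances.

Lemma measurable_rV_prod n (A : 'I_n -> set (measurableTypeR R)) :
  (forall i, measurable (A i)) ->
  measurable [set v : 'rV[R]_n | forall i, A i (v ord0 i)].
Proof.
move=> mA.
rewrite (_ : mkset _ =
    \bigcap_(i in [set: 'I_n]) (fun v : 'rV[R]_n => v ord0 i) @^-1` A i).
  apply: fin_bigcap_measurable => // i _.
  by rewrite -[X in measurable X]setTI; exact: measurable_rV_coord.
by apply/seteqP; split => v /= h i; [move=> _; exact: h|exact: (h i)].
Qed.

Lemma lebesgue_rV_prod n (A : 'I_n -> set (measurableTypeR R)) :
  (forall i, measurable (A i)) ->
  @lebesgue_rV n [set v | forall i, A i (v ord0 i)] =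
    \prod_(i < n) lebesgue_measure (A i).
Proof.
elim: n A => [|n IH] A mA.
  rewrite big_ord0 /= diracE (_ : _ \in _ = true)//.
  by apply/mem_set => -[].
rewrite big_ord_recl -(IH (fun j => A (lift ord0 j)))//.
pose leb : {sigma_finite_measure set (measurableTypeR R) -> \bar R} :=
  lebesgue_measure.
rewrite -[RHS](@product_measure1E _ _ _ _ _ leb (@lebesgue_rV n))//.
  rewrite /= /pushforward; congr (_ _).
  apply/seteqP; split => -[a v] /=.
    move=> h; split; first by have := h ord0; rewrite rV_cons0.
    by move=> j; have := h (lift ord0 j); rewrite rV_consS.
  move=> [ha hv] i; have [j ->|->] := unliftP ord0 i; first by rewrite rV_consS.
  by rewrite rV_cons0.
by apply: (measurable_rV_prod (A := fun j => A (lift ord0 j))) => j; exact: mA.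
Qed.

End lebesgue_rV.
Arguments lebesgue_rV {R n}.

Lemma measurable_rVE (R : realType) n :
  @measurable _ 'rV[R]_n = <<s @open 'rV[R]_n >>.
Proof.
apply/seteqP; split.
  apply: smallest_sub; first exact: smallest_sigma_algebra.
  rewrite -bigcup_seq => _ [i /= _ [C mC <-]]; rewrite setTI.
  have {}mC : (@RGenOpens.G R).-sigma.-measurable C.
    by rewrite -RGenOpens.measurableE.
  move: C mC; apply: smallest_sub.
    split.
    - by rewrite /= preimage_set0; exact: sigma_algebra0.
    - by move=> A mA; rewrite /= setTD preimage_setC; exact: sigma_algebraC.
    - by move=> F mF; rewrite /= preimage_bigcup; exact: sigma_algebra_bigcup.
  move=> _ [a [b ->]]; apply: sub_sigma_algebra.
  apply: open_comp; last exact: interval_open.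
  by move=> x _; exact: coord_continuous.
apply: smallest_sub; first exact: sigma_algebra_measurable.
move=> U oU.
pose B (p : 'rV[rat]_n * nat) : set 'rV[R]_n :=
  [set v | forall i, v ord0 i \in
    `](ratr (p.1 ord0 i) - p.2.+1%:R^-1), (ratr (p.1 ord0 i) + p.2.+1%:R^-1)[].
have mB p : measurable (B p).
  by apply: (measurable_rV_prod (A := fun i => [set` `](ratr (p.1 ord0 i) - p.2.+1%:R^-1), (ratr (p.1 ord0 i) + p.2.+1%:R^-1)[])) => i; exact: measurable_itv.
rewrite (_ : U = \bigcup_(p in [set: 'rV[rat]_n * nat])
    (if `[< B p `<=` U >] then B p else set0)).
  apply: countable_bigcupT_measurable => // p.
  by case: ifP => _; [exact: mB|exact: measurable0].
have aux (a b c d h : R) : a - d < c -> c < a -> c - d < b -> b < c + d ->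
    d < h -> - (h + h) < a - b < h + h.
  by move=> *; apply/andP; split; lra.
apply/seteqP; split => [v Uv|v [p _]]; last by case: asboolP => // h; exact: h.
have /nbhs_ballP[e /= e0 veU] := open_nbhs_nbhs (conj oU Uv).
have e20 : 0 < e / 2 by rewrite divr_gt0.
have [k _ /(_ k (leqnn k)) ke] := near_infty_natSinv_lt (PosNum e20).
have k0 : 0 < k.+1%:R^-1 :> R by rewrite invr_gt0.
have qP i : {q : rat | ratr q \in `](v ord0 i - k.+1%:R^-1), v ord0 i[}.
  by apply/cid; apply: rat_in_itvoo; rewrite ltrBlDr ltrDl.
pose q : 'rV[rat]_n := \row_i sval (qP i).
exists (q, k) => //; case: asboolP => [_ i|].
  rewrite /= mxE; case: (qP i) => r /=; rewrite !in_itv/= => /andP[r1 r2].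
  by rewrite ltrBlDr (lt_trans r2) ?ltrDl//= -ltrBlDr.
case=> w Bw; apply: veU; split => // j i; have -> : j = ord0 by rewrite (ord1 j); exact/val_inj.
have := Bw i; rewrite /= mxE; case: (qP i) => r /=.
rewrite !in_itv/= => /andP[r1 r2] /andP[w1 w2].
move: ke => /= ke; rewrite /ball /= ltr_norml (splitr e).
exact: aux r1 r2 w1 w2 ke.
Qed.

Section convex_bodies.
Context {R : realType} {n : nat}.
Implicit Types (K L B : set 'rV[R]_n) (x y N X : 'rV[R]_n).

Definition dotv x y : R := \sum_(i < n) x ord0 i * y ord0 i.

Definition enorm x : R := Num.sqrt (dotv x x).

Definition eball x (r : R) : set 'rV[R]_n := [set y | enorm (y - x) <= r].

Definition volume B : R := fine (lebesgue_rV B).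

Definition convex_body K := [/\ compact K, convex_set K & K° !=set0].

Definition centrally_symmetric K := K = [set - x | x in K].

Definition affine_map (T : 'M[R]_n) (b x : 'rV[R]_n) : 'rV[R]_n := x *m T + b.

Definition volume_preserving (f : 'rV[R]_n -> 'rV[R]_n) :=
  forall B, measurable B -> lebesgue_rV (f @` B) = lebesgue_rV B.

Definition isotropic_with K (M : R) :=
  forall y,
    (\int[lebesgue_rV]_(x in K) (dotv x y)%:E = 0)%E /\
    (\int[lebesgue_rV]_(x in K) (dotv x y ^+ 2)%:E =
      (M ^+ 2 * enorm y ^+ 2)%:E)%E.

(* M_K. The number M below exists and is unique when K is a convex body; [get]
   selects it, and is a junk value for other sets. *)
Definition isotropic_moment K : R :=
  get [set M : R | 0 < M /\ exists (T : 'M[R]_n) (b : 'rV[R]_n),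
    volume_preserving (affine_map T b) /\
    isotropic_with (affine_map T b @` K) M].

Definition isotropy_constant K : R :=
  isotropic_moment K / volume K `^ ((n + 2)%:R / (2 * n)%:R).

Definition hausdorff_dist K L : R :=
  inf [set r : R | [/\ 0 <= r,
    forall x, K x -> exists2 y, L y & eball y r x &
    forall y, L y -> exists2 x, K x & eball x r y]].

(* Logarithmic version; the invertible linear map is z |-> z *m T. *)
Definition banach_mazur_dist K' K : R :=
  ln (inf [set l : R | 1 <= l /\
    exists (x y : 'rV[R]_n) (T : 'M[R]_n), [/\ T \in unitmx,
      [set z - x | z in K] `<=` [set (z - y) *m T | z in K'] &
      [set (z - y) *m T | z in K'] `<=` [set l *: (z - x) | z in K]]]).

Definition local_maximizer_in (C : set (set 'rV[R]_n))
    (d : set 'rV[R]_n -> set 'rV[R]_n -> R) K :=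
  exists2 e : R, 0 < e &
    forall K', C K' -> d K' K < e ->
      isotropy_constant K' <= isotropy_constant K.

Definition boundary K : set 'rV[R]_n := closure K `\` K°.

Definition inner_normal K X N :=
  enorm N = 1 /\ forall X', K X' -> 0 <= dotv (X' - X) N.

Definition orthv N : set 'rV[R]_n := [set x | dotv x N = 0].

Definition quad_form (Q : 'M[R]_n) x : R := dotv (x *m Q) x.

(* Every quadratic form on the hyperplane [orthv N] is the restriction of
   [quad_form Q] for some symmetric Q; only its values on [orthv N] are used. *)
Definition positive_generalized_curvature K X0 :=
  exists (N : 'rV[R]_n) (Q : 'M[R]_n),
    [/\ inner_normal K X0 N, Q^T = Q,
        forall Y, orthv N Y -> Y != 0 -> 0 < quad_form Q Y &
        forall e : R, 0 < e -> exists2 a : R, 0 < a &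
          forall (Y : 'rV[R]_n) (y : R), orthv N Y ->
            (boundary K `&` eball X0 a) (X0 + Y + y *: N) ->
            (1 - e) * quad_form Q Y <= y <= (1 + e) * quad_form Q Y].

End convex_bodies.

(* Main.v *)
(* Up to a constant, [L_K ^ (2 n) = \det (\int_K (x - c)^T (x - c) dx) / |K| ^ (n + 2)]
   with [c] the centroid of [K].  Writing [A] for the covariance matrix, the
   first variation of the logarithm of this ratio when a small set [D] is added
   to [K] is [\int_D f] with [f x = <A^-1 (x - c), x - c> - (n + 2) / |K|], up
   to an error of order [|D| ^ 2]; when [D] is removed it is [- \int_D f].

   At a point [X] of positive curvature, with inner normal [N] and form [q], the
   boundary is approximated by the paraboloid of the points
   [X + s Y + s ^ 2 (q Y) N], with [Y] orthogonal to [N].  Near such a point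
   with [Y = u] one can remove a cap of [K], or add a tip to [K], whose scaled
   coordinates [(Y, y)] satisfy [q (Y - u) <= 10] and [|y - q Y| <= 10] and
   whose volume is of order [s ^ (n + 1)], so that [|D| ^ 2] is negligible
   against [s ^ 2 |D|] as [n >= 2].  For a local maximizer, the leading term in
   [s] of [f] can therefore be neither negative on the cap nor positive on the
   tip.  Its terms of order 0 and 1 must vanish: [f X = 0], and the gradient of
   [f] at [X] is [g N], where [g < 0] because [c] lies on the inner side of the
   hyperplane tangent at [X].
   The term of order 2 is [p Y + g y] with [p Y = <A^-1 Y, Y>]; as [u] can be
   chosen far away, it has to vanish on the paraboloid, that is [p = - g q].
   It is then [g (y - q Y) < 0] on the caps, a contradiction.  In the symmetric
   case, caps and tips come in opposite pairs, and [f] is even. *)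

From HB Require Import structures.
Require Import Defs.
From mathcomp Require Import all_boot all_order all_algebra.
From mathcomp Require Import fingroup perm ring lra.
From mathcomp Require Import all_classical all_reals all_analysis.
From mathcomp Require Import measurable_realfun.

Set Implicit Arguments.
Unset Strict Implicit.
Unset Printing Implicit Defensive.

Import Order.TTheory GRing.Theory Num.Theory.
Import numFieldNormedType.Exports.

Local Open Scope classical_set_scope.
Local Open Scope ring_scope.

(** * Affine changes of variables *)

Section affine_lebesgue.
Context {R : realType}.
Local Notation leb := (@lebesgue_measure R).

(** The curvature hypothesis locates the boundary only up to factors [1 - e] and [1 + e]. On a cap
    the density may therefore be positive, of relative size [e]. So [e] is fixed first, small enough
    for a slab inside the cap, where the density is clearly negative and whose volume is a fixed
    fraction of that of the cap, to outweigh this part; only then is [s] taken small. On a tip the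
    density is bounded below throughout, and it is enough that the tip has positive volume. The
    bound 10 is 8 + 1 + 1: in [tip_location], 8 bounds the quadratic distance to the tip, and the
    two units come from the slack [e] and from the depth 1 of the tip below the paraboloid. The
    change of variables formula is proved for triangular matrices only. A Cholesky factor of the
    covariance already brings a body into isotropic position by such a matrix; the uniqueness of
    [M_K], which involves arbitrary volume preserving maps, reduces to comparing the volumes of two
    Euclidean balls. *)

Lemma measurable_affine1 (t b : R) :
  measurable_fun setT (fun x : measurableTypeR R => t * x + b : measurableTypeR R).
Proof.
by apply: measurable_funD => //; exact: measurable_funM.
Qed.

(** The pushforward scaled by [|t|] agrees with Lebesgue measure on the intervals []a, c]], which
    determine it. A negative [t] reverses the interval, hence the two cases. *)
Lemma lebesgue_measure_affine (t b : R) (A : set (measurableTypeR R)) :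
  t != 0 -> measurable A ->
  leb ((fun x => t * x + b) @^-1` A) = (`|t|^-1%:E * leb A)%E.
Proof.
move=> t0 mA.
pose phi := fun x : measurableTypeR R => t * x + b : measurableTypeR R.
have mphi : measurable_fun setT phi by exact: measurable_affine1.
pose nu : {measure set (measurableTypeR R) -> \bar R} :=
  measure_function_pushforward__canonical__measure_function_Measure leb mphi.
have tP : 0 <= `|t| by [].
have e : leb A = mscale (NngNum tP) nu A.
  apply: lebesgue_measure_unique => // _ [[a c] _ <-] /=.
  rewrite lebesgue_measure_itv /= /mscale /= /pushforward.
  have [tp|tn|/eqP] := ltgtP 0 t; last by rewrite eq_sym (negbTE t0).
  - rewrite (_ : phi @^-1` _ = [set` `](a - b) / t, (c - b) / t]]); last first.
      apply/seteqP; split => x /=; rewrite !in_itv /= /phi ltr_pdivrMr// ler_pdivlMr//;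
      by rewrite ltrBlDr lerBrDr mulrC.
    rewrite lebesgue_measure_itv /= !lte_fin ltr_pM2r ?invr_gt0// ltrD2r.
    case: ifP => _; last by rewrite mule0.
    rewrite -!EFinB -EFinM gtr0_norm// ; congr EFin; field; lra.
  - rewrite (_ : phi @^-1` _ = [set` `[(c - b) / t, (a - b) / t[]); last first.
      apply/seteqP; split => x /=; rewrite !in_itv /= /phi ler_ndivrMr// ltr_ndivlMr//;
      by rewrite ltrBlDr lerBrDr mulrC andbC.
    rewrite lebesgue_measure_itv /= !lte_fin ltr_nM2r ?invr_lt0// ltrD2r.
    case: ifP => _; last by rewrite mule0.
    rewrite -!EFinB -EFinM ltr0_norm// ; congr EFin; field; lra.
rewrite e /mscale muleA /= -EFinM mulVf ?mul1e ?normr_eq0//.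
Qed.

Lemma integral_affine1 (t b : R) (G : measurableTypeR R -> \bar R) : t != 0 ->
  measurable_fun setT G -> (forall x, 0 <= G x)%E ->
  (\int[leb]_x G (t * x + b)%R = `|t|^-1%:E * \int[leb]_x G x)%E.
Proof.
move=> t0 mG G0.
have mphi := measurable_affine1 t b.
transitivity (\int[pushforward leb (fun x : measurableTypeR R => (t * x + b)%R : measurableTypeR R)]_x G x)%E.
  by rewrite ge0_integral_pushforward.
have tP : 0 <= `|t|^-1 by rewrite invr_ge0.
rewrite -(@ge0_integral_mscale _ _ _ leb _ _ (NngNum tP))//.
apply: (@eq_measure_integral _ _ _ setT (mscale (NngNum tP) leb)
  (measure_function_pushforward__canonical__measure_function_Measure leb mphi)) => A mA _.
exact: lebesgue_measure_affine.
Qed.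

End affine_lebesgue.

Section triangular.
Context {R : realType}.
Local Open Scope ereal_scope.

Lemma affine_map_coord n (T : 'M[R]_n) (b x : 'rV[R]_n) i :
  affine_map T b x ord0 i = (\sum_j x ord0 j * T j i + b ord0 i)%R.
Proof. by rewrite /affine_map mxE mxE. Qed.

Lemma measurable_affine_map n (T : 'M[R]_n) (b : 'rV[R]_n) :
  measurable_fun setT (affine_map T b).
Proof.
apply: measurable_fun_rVP => i.
under eq_fun do rewrite affine_map_coord.
apply: measurable_funD => //.
apply: measurable_sum => j; apply: measurable_funM => //.
exact: measurable_rV_coord.
Qed.

Lemma measurable_affine_preimage n (T : 'M[R]_n) (b : 'rV[R]_n) A :
  measurable A -> measurable (affine_map T b @^-1` A).
Proof.
by move=> mA; rewrite -[X in measurable X]setTI; exact: measurable_affine_map.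
Qed.

Lemma affine_map_cons n (T : 'M[R]_n.+1) (b : 'rV[R]_n.+1) (a : R) (v : 'rV[R]_n) :
  (forall i j : 'I_n.+1, (j < i)%N -> T i j = 0)%R ->
  affine_map T b (rV_cons (a : measurableTypeR R, v)) =
  rV_cons ((T ord0 ord0 * a + b ord0 ord0)%R : measurableTypeR R,
    affine_map (\matrix_(i, j) T (lift ord0 i) (lift ord0 j))
      (\row_j (a * T ord0 (lift ord0 j) + b ord0 (lift ord0 j))%R) v).
Proof.
move=> Tu; apply/rowP => i; rewrite affine_map_coord big_ord_recl rV_cons0.
have [j ->|->] := unliftP ord0 i; last first.
  rewrite rV_cons0 big1 ?addr0 1?mulrC// => j _.
  by rewrite Tu ?mulr0.
rewrite rV_consS affine_map_coord !mxE -addrA addrCA; congr (_ + _)%R.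
by apply: eq_bigr => k _; rewrite rV_consS mxE.
Qed.

(** Points are rows, so for an upper triangular [T] the first coordinate of the image depends only
    on the first coordinate [x] of the argument, and the others form a triangular affine map whose
    translation depends on [x]. Fubini and the one-dimensional formula then give the induction. *)
Lemma lebesgue_rV_upper n (T : 'M[R]_n) (b : 'rV[R]_n) A :
  (forall i j : 'I_n, (j < i)%N -> T i j = 0)%R -> \det T != 0%R -> measurable A ->
  lebesgue_rV (affine_map T b @^-1` A) = `|\det T|^-1%:E * lebesgue_rV A.
Proof.
elim: n T b A => [|n IH] T b A Tu T0 mA.
  rewrite det_mx00 normr1 invr1 mul1e; congr lebesgue_rV.
  by apply/seteqP; split => x; rewrite /= (_ : affine_map T b x = x)//; apply/rowP => -[].
pose T' : 'M[R]_n := \matrix_(i, j) T (lift ord0 i) (lift ord0 j).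
have detT : \det T = (T ord0 ord0 * \det T')%R.
  rewrite (expand_det_col _ ord0) big_ord_recl big1 ?addr0; last first.
    by move=> i _; rewrite Tu ?mul0r.
  rewrite /cofactor /= expr0 mul1r; congr (_ * \det _)%R.
  by apply/matrixP => i j; rewrite !mxE.
move: T0; rewrite detT mulf_eq0 negb_or => /andP[t0 T'0].
have T'u (i j : 'I_n) : (j < i)%N -> T' i j = 0%R.
  by move=> ji; rewrite mxE Tu// !lift0.
pose G x := lebesgue_rV (xsection (@rV_cons R n @^-1` A) x).
have mA' : measurable (@rV_cons R n @^-1` A).
  by rewrite -[X in measurable X]setTI; exact: measurable_rV_cons.
have mG : measurable_fun setT G by exact: measurable_fun_xsection.
rewrite /= /pushforward /product_measure1.
transitivity (\int[@lebesgue_measure R]_x (`|\det T'|^-1%:E * G (T ord0 ord0 * x + b ord0 ord0)%R)).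
  apply: eq_integral => x _ /=.
  rewrite /G -(IH _ (\row_j (x * T ord0 (lift ord0 j) + b ord0 (lift ord0 j))%R))//; last first.
    exact: measurable_xsection.
  congr lebesgue_rV; apply/seteqP; split => v;
  by rewrite /xsection /= !inE /= affine_map_cons.
rewrite ge0_integralZl//; last first.
  exact: (measurableT_comp mG (measurable_affine1 _ _)).
rewrite (@integral_affine1 _ _ _ G)// muleA -EFinM normrM invfM mulrC.
by [].
Qed.

End triangular.

(** * Topology and measurability of row vectors *)

Section lebesgue_rV_topology.
Context {R : realType} {n : nat}.
Implicit Types (K D : set 'rV[R]_n) (x : 'rV[R]_n).

Lemma rV_norm_le (x : 'rV[R]_n) (r : R) : 0 <= r ->
  (`|x| <= r) = [forall i, `|x ord0 i| <= r].
Proof.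
move=> r0; rewrite [`|x|]/Num.norm /= mx_normrE; apply/bigmax_leP/forallP => /=.
  by move=> [_ H] i; have := H (ord0, i) isT.
by move=> H; split => // -[a i] _ /=; rewrite (ord1 a).
Qed.

Lemma rV_norm_leP (x : 'rV[R]_n) (r : R) : 0 <= r ->
  reflect (forall i, `|x ord0 i| <= r) (`|x| <= r).
Proof. by move=> r0; rewrite rV_norm_le//; exact: forallP. Qed.

Lemma coord_le_norm (x : 'rV[R]_n) i : `|x ord0 i| <= `|x|.
Proof. by move: i; apply/rV_norm_leP. Qed.

Lemma measurable_rV_open (U : set 'rV[R]_n) : open U -> measurable U.
Proof. by move=> oU; rewrite measurable_rVE; exact: sub_sigma_algebra. Qed.

Lemma measurable_rV_closed (U : set 'rV[R]_n) : closed U -> measurable U.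
Proof.
move=> /closed_openC oU; rewrite -[U]setCK; apply: measurableC.
exact: measurable_rV_open.
Qed.

Lemma measurable_rV_compact K : compact K -> measurable K.
Proof. by move=> /compact_closed => /(_ (@norm_hausdorff _ _)); exact: measurable_rV_closed. Qed.

Lemma continuous_measurable_rV (g : 'rV[R]_n -> R) : continuous g ->
  measurable_fun setT (g : 'rV[R]_n -> measurableTypeR R).
Proof.
move=> cg.
apply: (@measurability _ _ 'rV[R]_n (measurableTypeR R) setT g (@RGenOpens.G R)).
  exact: RGenOpens.measurableE.
move=> _ [_ [a [b ->] <-]]; rewrite setTI; apply: measurable_rV_open.
apply: open_comp; last exact: interval_open.
by move=> ? _; exact: cg.
Qed.

Lemma lebesgue_rV_box (z : 'rV[R]_n) (r : 'I_n -> R) : (forall i, 0 <= r i) ->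
  lebesgue_rV [set v : 'rV[R]_n | forall i, `|v ord0 i - z ord0 i| <= r i] =
  (\prod_i (2 * r i))%:E.
Proof.
move=> r0.
rewrite (_ : mkset _ = [set v : 'rV[R]_n | forall i,
   [set` `[z ord0 i - r i, z ord0 i + r i]] (v ord0 i)]); last first.
  apply/seteqP; split => v /= H i; have := H i; rewrite /= in_itv /= ler_distl//.
rewrite (@lebesgue_rV_prod _ _ (fun i => [set` `[z ord0 i - r i, z ord0 i + r i]]))//.
rewrite -prodEFin; apply: eq_bigr => i _.
rewrite lebesgue_measure_itv /= lte_fin.
case: ltP => [_|]; first by rewrite -EFinB; congr EFin; lra.
move=> h; have -> : r i = 0 by have := r0 i; lra.
by rewrite mulr0.
Qed.

Lemma measurable_rV_box (z : 'rV[R]_n) (r : 'I_n -> R) :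
  measurable [set v : 'rV[R]_n | forall i, `|v ord0 i - z ord0 i| <= r i].
Proof.
rewrite (_ : mkset _ = [set v : 'rV[R]_n | forall i,
   [set` `[z ord0 i - r i, z ord0 i + r i]] (v ord0 i)]); last first.
  apply/seteqP; split => v /= H i; have := H i; rewrite /= in_itv /= ler_distl//.
by apply: (@measurable_rV_prod _ _ (fun i => [set` `[z ord0 i - r i, z ord0 i + r i]])).
Qed.

Lemma lebesgue_rV_bounded D (M : R) : measurable D -> (forall x, D x -> `|x| <= M) ->
  (lebesgue_rV D < +oo)%E.
Proof.
move=> mD DM.
have M0 : 0 <= Num.max 0 M by rewrite le_max lexx.
apply: (@le_lt_trans _ _ (lebesgue_rV [set v : 'rV[R]_n |
   forall i, `|v ord0 i - (0 : 'rV[R]_n) ord0 i| <= Num.max 0 M])).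
  apply: le_measure; rewrite ?inE//; first exact: measurable_rV_box.
  move=> x /DM xM i; rewrite mxE subr0 (le_trans (coord_le_norm _ _))//.
  by rewrite le_max xM orbT.
by rewrite lebesgue_rV_box// ltry.
Qed.

Lemma lebesgue_rV_open_gt0 D : measurable D -> D° !=set0 -> (0 < lebesgue_rV D)%E.
Proof.
move=> mD [x Dx].
have /nbhs_ballP[e /= e0 xeD] : nbhs x D by exact: Dx.
pose B := [set v : 'rV[R]_n | forall i, `|v ord0 i - x ord0 i| <= e / 2].
apply: (@lt_le_trans _ _ (lebesgue_rV B)).
  rewrite /B (lebesgue_rV_box _ (r := fun=> e / 2)); last by move=> _; lra.
  by rewrite lte_fin prodr_gt0// => i _; lra.
apply: le_measure; rewrite ?inE//; first exact: measurable_rV_box.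
move=> v Bv; apply: xeD; rewrite -ball_normE /= distrC.
apply: (@le_lt_trans _ _ (e / 2)); last by lra.
apply/rV_norm_leP; first lra.
by move=> i; have := Bv i; rewrite !mxE.
Qed.

(** Continuous functions are integrable on these sets. Compact sets would not do: caps and tips are
    differences of compact sets. *)
Definition bounded_measurable D := measurable D /\ exists M : R, forall x, D x -> `|x| <= M.

Lemma bounded_measurable_compact K : compact K -> bounded_measurable K.
Proof.
move=> cK; split; first exact: measurable_rV_compact.
have [M [_ HM]] := compact_bounded cK; exists (M + 1) => x Kx.
by apply: HM => //; rewrite ltrDl.
Qed.

Lemma bounded_measurable_fin_num D : bounded_measurable D -> (lebesgue_rV D < +oo)%E.
Proof. by move=> [mD [M]]; exact: lebesgue_rV_bounded. Qed.

Lemma bounded_measurableS D D' : measurable D' -> D' `<=` D ->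
  bounded_measurable D -> bounded_measurable D'.
Proof. by move=> mD' D'D [_ [M DM]]; split => //; exists M => x /D'D; exact: DM. Qed.

Lemma bounded_measurableD D D' : bounded_measurable D -> measurable D' ->
  bounded_measurable (D `\` D').
Proof.
move=> bD mD'; apply: (bounded_measurableS _ _ bD); last exact: subDsetl.
by have [mD _] := bD; exact: measurableD.
Qed.

Lemma integrable_continuous_rV D (g : 'rV[R]_n -> R) : continuous g -> bounded_measurable D ->
  (@lebesgue_rV R n).-integrable D (EFin \o g).
Proof.
move=> cg bD; have [mD [M DM]] := bD.
apply: measurable_bounded_integrable => //.
- exact: bounded_measurable_fin_num.
- apply: measurable_funTS; exact: continuous_measurable_rV.
have cB : compact [set x : 'rV[R]_n | `|x| <= M].
  apply: bounded_closed_compact.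
    exists M; split; first exact: num_real.
    by move=> N /= MN x /= xM; apply: (le_trans xM); exact: ltW.
  rewrite (_ : mkset _ = (@Num.norm _ 'rV[R]_n) @^-1` [set r | r <= M])//.
  apply: closed_comp; last exact: closed_le.
  by move=> ? _; exact: norm_continuous.
have cgB : compact (g @` [set x : 'rV[R]_n | `|x| <= M]).
  by apply: continuous_compact => //; exact: continuous_subspaceT.
have [N [Nr HN]] := compact_bounded cgB; exists N; split => // N' NN' x Dx.
by apply: HN NN' _ _; exists x => //; exact: DM.
Qed.

End lebesgue_rV_topology.

(** * Euclidean norm *)

Section dotv_theory.
Context {R : realType} {n : nat}.
Implicit Types (x y z N : 'rV[R]_n).

Lemma dotvE x y : dotv x y = (x *m y^T) ord0 ord0.
Proof. by rewrite mxE; apply: eq_bigr => i _; rewrite mxE. Qed.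

Lemma dotvC x y : dotv x y = dotv y x.
Proof. by apply: eq_bigr => i _; rewrite mulrC. Qed.

Lemma dotvDl x y z : dotv (x + y) z = dotv x z + dotv y z.
Proof. by rewrite -big_split; apply: eq_bigr => i _; rewrite mxE mulrDl. Qed.

Lemma dotvDr x y z : dotv z (x + y) = dotv z x + dotv z y.
Proof. by rewrite ![dotv z _]dotvC dotvDl. Qed.

Lemma dotvZl (a : R) x y : dotv (a *: x) y = a * dotv x y.
Proof. by rewrite /dotv mulr_sumr; apply: eq_bigr => i _; rewrite mxE mulrA. Qed.

Lemma dotvZr (a : R) x y : dotv x (a *: y) = a * dotv x y.
Proof. by rewrite dotvC dotvZl dotvC. Qed.

Lemma dotvNl x y : dotv (- x) y = - dotv x y.
Proof. by rewrite -scaleN1r dotvZl mulN1r. Qed.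

Lemma dotvNr x y : dotv x (- y) = - dotv x y.
Proof. by rewrite dotvC dotvNl dotvC. Qed.

Lemma dotvBl x y z : dotv (x - y) z = dotv x z - dotv y z.
Proof. by rewrite dotvDl dotvNl. Qed.

Lemma dotvBr x y z : dotv z (x - y) = dotv z x - dotv z y.
Proof. by rewrite dotvDr dotvNr. Qed.

Lemma dotv0l x : dotv 0 x = 0.
Proof. by rewrite -[0](scale0r 0) dotvZl mul0r. Qed.

Lemma dotv_ge0 x : 0 <= dotv x x.
Proof. by apply: sumr_ge0 => i _; rewrite -expr2 sqr_ge0. Qed.

Lemma dotv_eq0 x : dotv x x = 0 -> x = 0.
Proof.
move/eqP; rewrite psumr_eq0 => [|i _]; last by rewrite -expr2 sqr_ge0.
move/allP => H; apply/rowP => i; rewrite mxE.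
by have := H i (mem_index_enum _); rewrite /= mulf_eq0 orbb => /eqP.
Qed.

Lemma dotv_gt0 x : x != 0 -> 0 < dotv x x.
Proof. by move=> x0; rewrite lt_neqAle dotv_ge0 andbT eq_sym; apply: contraNneq x0 => /dotv_eq0/eqP. Qed.

Lemma enorm_ge0 x : 0 <= enorm x.
Proof. exact: sqrtr_ge0. Qed.

Lemma enorm_sqr x : enorm x ^+ 2 = dotv x x.
Proof. by rewrite sqr_sqrtr// dotv_ge0. Qed.

Lemma normr_dotv_le x y : `|dotv x y| <= n%:R * `|x| * `|y|.
Proof.
rewrite (le_trans (ler_norm_sum _ _ _))// -mulrA mulr_natl.
have -> : `|x| * `|y| *+ n = \sum_(i < n) `|x| * `|y| by rewrite sumr_const card_ord.
apply: ler_sum => i _.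
by rewrite normrM ler_pM//; exact: coord_le_norm.
Qed.

Lemma dotv_le_norm2 x : dotv x x <= n%:R * `|x| ^+ 2.
Proof. by rewrite (le_trans (ler_norm _))// (le_trans (normr_dotv_le _ _))// expr2 mulrA. Qed.

Lemma norm2_le_dotv x : `|x| ^+ 2 <= dotv x x.
Proof.
rewrite -(sqr_sqrtr (dotv_ge0 x)) ler_sqr ?nnegrE ?sqrtr_ge0//.
apply/rV_norm_leP => [|i]; first exact: sqrtr_ge0.
rewrite -sqrtr_sqr ler_wsqrtr// /dotv (bigD1 i)//= -expr2 lerDl.
by apply: sumr_ge0 => j _; rewrite -expr2 sqr_ge0.
Qed.

Lemma enorm_le_norm x : enorm x <= n%:R * `|x|.
Proof.
rewrite -ler_sqr ?nnegrE ?enorm_ge0 ?mulr_ge0// enorm_sqr.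
rewrite (le_trans (dotv_le_norm2 _))// exprMn ler_wpM2r ?sqr_ge0//.
by rewrite -natrX ler_nat expnS expn1; case: (n) => // m; rewrite leq_pmulr.
Qed.

Lemma continuous_dotv N : continuous (dotv ^~ N).
Proof.
apply: (@continuous_big R 'I_n +%R 0 xpredT _ 'rV[R]_n _ (fun i x => x ord0 i * N ord0 i)).
  exact: add_continuous.
move=> i _ x; apply: (@continuousM _ _ (fun x => x ord0 i) (fun=> N ord0 i)).
  exact: coord_continuous.
exact: cst_continuous.
Qed.

Lemma continuous_dotvB (z : 'rV[R]_n) N : continuous (fun x => dotv (x - z) N).
Proof.
rewrite (_ : (fun x => _) = (fun x => dotv x N - dotv z N)); last first.
  by apply/funext => x; rewrite dotvBl.
move=> x; apply: (@continuousB _ _ _ (dotv ^~ N) (fun=> dotv z N)).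
  exact: continuous_dotv.
exact: cst_continuous.
Qed.

(** A plate of thickness [h] across [N], to be used with [r] of order [s] and [h] of order [s ^ 2],
    the proportions of a cap. *)
Definition slab z N (r h : R) := [set x : 'rV[R]_n | `|x - z| <= r /\ `|dotv (x - z) N| <= h].

Lemma measurable_slab z N r h : measurable (slab z N r h).
Proof.
apply: measurable_rV_closed; apply: closedI.
  apply: (@closed_comp _ _ (fun x => `|x - z|) [set y | y <= r]); last exact: closed_le.
  move=> x _; apply: (@continuous_comp _ _ _ (fun x => x - z) Num.norm).
    by apply: (@continuousB _ _ _ id (fun=> z)); [move=> ?|exact: cst_continuous].
  exact: norm_continuous.
apply: (@closed_comp _ _ (fun x => `|dotv (x - z) N|) [set y | y <= h]); last exact: closed_le.
move=> x _; apply: (@continuous_comp _ _ _ (fun x => dotv (x - z) N) Num.norm).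
  exact: continuous_dotvB.
exact: norm_continuous.
Qed.

(** With [i] the last index where [N] is nonzero, replacing the coordinate [i] by the scalar product
    with [N] is an upper triangular change of variables of determinant [N ord0 i], and it turns the
    set into a box. *)
Lemma slanted_box_volume N : N != 0 -> exists2 i, N ord0 i != 0 &
  exists2 c : R, 0 < c & forall z (r h : R), 0 <= r -> 0 <= h ->
    let S := [set x : 'rV[R]_n | (forall j, j != i -> `|x ord0 j - z ord0 j| <= r) /\
      `|dotv (x - z) N| <= h] in
    measurable S /\ lebesgue_rV S = (c * r ^+ n.-1 * h)%:E.
Proof.
move=> N0; have [i0 Ni0] : exists i, N ord0 i != 0.
  apply/existsP; rewrite -negb_forall; apply: contra N0 => /forallP H.
  by apply/eqP/rowP => i; rewrite mxE; exact/eqP.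
case: (@arg_maxnP _ i0 (fun i => N ord0 i != 0) (fun i => i : nat) Ni0) => i Ni imax.
have Nlast (j : 'I_n) : (i < j)%N -> N ord0 j = 0.
  by move=> ij; apply/eqP; apply: contraLR ij => /imax; rewrite -leqNgt.
exists i => //.
pose T : 'M[R]_n := \matrix_(j, k) if k == i then N ord0 j else (j == k)%:R.
have Tu (j k : 'I_n) : (k < j)%N -> T j k = 0.
  move=> kj; rewrite mxE; case: eqP => [ki|_]; first by apply: Nlast; rewrite -ki.
  by case: eqP kj => // ->; rewrite ltnn.
have detT : \det T = N ord0 i.
  rewrite -det_tr det_trig; last first.
    by apply/is_trig_mxP => j k jk; rewrite mxE Tu.
  rewrite (bigD1 i)//= big1 ?mulr1; first by rewrite !mxE eqxx.
  by move=> j /negbTE ji; rewrite !mxE ji eqxx.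
have TE z x k : affine_map T (- (z *m T)) x ord0 k =
    if k == i then dotv (x - z) N else x ord0 k - z ord0 k.
  rewrite /affine_map -mulmxBl mxE.
  case: ifP => ki; first by apply: eq_bigr => j _; rewrite [T _ _]mxE ki.
  rewrite (bigD1 k)//= big1 ?addr0; first by rewrite [T _ _]mxE ki eqxx mulr1 !mxE.
  by move=> j /negbTE jk; rewrite [T _ _]mxE ki jk mulr0.
exists (`|N ord0 i|^-1 * 2 ^+ n); first by rewrite mulr_gt0 ?invr_gt0 ?normr_gt0 ?exprn_gt0.
move=> z r h r0 h0 S.
pose B := [set v : 'rV[R]_n | forall j, `|v ord0 j - (0 : 'rV[R]_n) ord0 j| <= if j == i then h else r].
have SE : S = affine_map T (- (z *m T)) @^-1` B.
  apply/seteqP; split => x /=.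
    move=> [H1 H2] j; rewrite TE mxE subr0; case: ifP => // /negbT; exact: H1.
  move=> H; split; last by have := H i; rewrite TE eqxx mxE subr0.
  by move=> j /negbTE ji; have := H j; rewrite TE ji mxE subr0.
have mB : measurable B by exact: measurable_rV_box.
split; first by rewrite SE; exact: measurable_affine_preimage.
rewrite SE lebesgue_rV_upper// ?detT// /B (lebesgue_rV_box 0); last by move=> j; case: ifP.
rewrite -EFinM; congr EFin; rewrite -!mulrA; congr (_ * _).
rewrite big_split /= prodr_const card_ord; congr (_ * _).
rewrite (bigD1 i)//= eqxx mulrC; congr (_ * _).
rewrite (eq_bigr (fun=> r)) ?prodr_const; last by move=> j /negbTE ->.
by congr (_ ^+ _); rewrite cardC1 card_ord.
Qed.

(** A slab lies in the slanted box of the same size and contains the one shrunk by [C]. For the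
    latter, the coordinate [i] is recovered from the others and from the scalar product with [N],
    and [h <= r] bounds the result by [r]. *)
Lemma slab_volume N : N != 0 -> exists2 c1 : R, 0 < c1 & exists2 c2 : R, 0 < c2 &
  forall z (r h : R), 0 <= h <= r ->
  ((c1 * r ^+ n.-1 * h)%:E <= lebesgue_rV (slab z N r h) <= (c2 * r ^+ n.-1 * h)%:E)%E.
Proof.
move=> /slanted_box_volume[i Ni [c c0 H]].
pose C := 1 + (1 + \sum_j `|N ord0 j|) / `|N ord0 i|.
have S0 : 0 <= \sum_j `|N ord0 j| by apply: sumr_ge0.
have C1 : 1 <= C by rewrite lerDl divr_ge0// addr_ge0.
have C0 : 0 < C by lra.
exists (c / C ^+ n.-1 / C); first by rewrite !divr_gt0// exprn_gt0.
exists c => // z r h /andP[h0 hr].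
have r0 : 0 <= r by lra.
have [mS1 <-] := H z r h r0 h0.
apply/andP; split; last first.
  apply: le_measure; rewrite ?inE//; first exact: measurable_slab.
  move=> x [H1 H2]; split => // j _.
  by rewrite (le_trans _ H1)// (le_trans _ (coord_le_norm _ j))// !mxE.
have r'0 : 0 <= r / C by rewrite divr_ge0// ltW.
have h'0 : 0 <= h / C by rewrite divr_ge0// ltW.
have [mS2 S2E] := H z (r / C) (h / C) r'0 h'0.
have -> : c / C ^+ n.-1 / C * r ^+ n.-1 * h = c * (r / C) ^+ n.-1 * (h / C).
  by rewrite exprMn exprVn; field; rewrite ?lt0r_neq0// exprn_gt0.
rewrite -S2E; apply: le_measure; rewrite ?inE//; first exact: measurable_slab.
move=> x [H1 H2]; split; last first.
  by rewrite (le_trans H2)// ler_pdivrMr// ler_peMr.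
apply/rV_norm_leP => // j; rewrite !mxE.
have [->{j}|ji] := eqVneq j i; last first.
  by rewrite (le_trans (H1 _ ji))// ler_pdivrMr// ler_peMr.
have Ni0 : 0 < `|N ord0 i| by rewrite normr_gt0.
have : `|(x ord0 i - z ord0 i) * N ord0 i| <= (1 + \sum_j `|N ord0 j|) * (r / C).
  have -> : (x ord0 i - z ord0 i) * N ord0 i =
      dotv (x - z) N - \sum_(j | j != i) (x ord0 j - z ord0 j) * N ord0 j.
    rewrite /dotv (bigD1 i)//= !mxE [X in _ + X - _](eq_bigr (fun j => (x ord0 j - z ord0 j) * N ord0 j)).
      by rewrite addrK.
    by move=> j _; rewrite !mxE.
  rewrite (le_trans (ler_normB _ _))// mulrDl mul1r lerD//.
    by rewrite (le_trans H2)// ler_pM2r ?invr_gt0.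
  rewrite (le_trans (ler_norm_sum _ _ _))// mulr_suml [leRHS](bigD1 i)//=.
  rewrite -[leLHS]add0r lerD ?mulr_ge0 ?invr_ge0 ?(ltW C0)//.
  apply: ler_sum => j ji.
  by rewrite normrM mulrC ler_wpM2l// H1.
rewrite normrM -ler_pdivlMr// => /le_trans; apply.
rewrite mulrAC mulrCA ler_piMr// -/C ler_pdivrMr// mul1r /C.
by rewrite lerDr.
Qed.

End dotv_theory.

(** * Determinants of symmetric matrices *)

Section matrix_algebra.
Context {R : realType}.

Lemma quad_formE n (Q : 'M[R]_n) (x : 'rV[R]_n) :
  quad_form Q x = (x *m Q *m x^T) ord0 ord0.
Proof. by rewrite /quad_form dotvE. Qed.

(* By Schur complements: if [A] is the block matrix (a b; b^T A'), then the
   Schur complement [A' - b^T b / a] is again positive definite. *)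
Lemma cholesky n (A : 'M[R]_n) : A^T = A ->
  (forall x : 'rV[R]_n, x != 0 -> 0 < quad_form A x) ->
  exists T : 'M[R]_n, [/\ forall i j : 'I_n, (j < i)%N -> T i j = 0,
    forall i, 0 < T i i & T^T *m A *m T = 1%:M].
Proof.
elim: n A => [|n IH] A AT Apos.
  exists 0; split; [by case|by case|by apply/matrixP => -[]].
pose a := A ord0 ord0.
pose b : 'M[R]_(1, n) := @ursubmx _ 1 n 1 n A.
pose A' : 'M[R]_n := @drsubmx _ 1 n 1 n A.
have AE : A = block_mx a%:M b b^T A' :> 'M[R]_(1 + n, 1 + n).
  rewrite -[LHS](@submxK _ 1 n 1 n) -/b -/A'.
  have -> : @ulsubmx _ 1 n 1 n A = a%:M.
    by apply/matrixP => i j; rewrite !mxE !ord1 eqxx mulr1n; congr (A _ _); exact/val_inj.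
  congr block_mx.
  by rewrite -[in LHS]AT /b -trmx_ursub.
have quadA (x1 : 'M[R]_1) (y : 'rV[R]_n) : quad_form A (row_mx x1 y : 'rV[R]_(1 + n)) =
   ((x1 *m a%:M + y *m b^T) *m x1^T + (x1 *m b + y *m A') *m y^T) ord0 ord0.
  rewrite quad_formE [X in _ *m X *m _]AE.
  by rewrite (@mul_row_block _ 1 1 n 1 n) (@tr_row_mx _ 1 1 n) (@mul_row_col _ 1 1 n).
have a0 : 0 < a.
  have := Apos (row_mx 1%:M 0 : 'rV[R]_(1 + n)).
  rewrite quadA !mul0mx trmx1 mulmx1 trmx0 mulmx0 !addr0 mul1mx mxE eqxx mulr1n; apply.
  apply/eqP => /(congr1 (fun M : 'M[R]_(1, 1 + n) => M ord0 (lshift n (ord0 : 'I_1)))).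
  by rewrite (@row_mxEl _ 1 1 n) !mxE eqxx => /eqP; rewrite oner_eq0.
have an0 : a != 0 by rewrite gt_eqF.
pose S : 'M[R]_n := A' - a^-1 *: (b^T *m b).
have A'T : A'^T = A' by rewrite /A' trmx_drsub AT.
have ST : S^T = S by rewrite /S linearB /= linearZ /= trmx_mul trmxK A'T.
have Spos (y : 'rV[R]_n) : y != 0 -> 0 < quad_form S y.
  move=> y0.
  (* For given [y], this first coordinate minimizes the form of [A], and the minimum is the form of
     the Schur complement [S] at [y]. *)
  have := Apos (row_mx (- (a^-1 *: (y *m b^T))) y : 'rV[R]_(1 + n)).
  rewrite quadA mul_mx_scalar scalerN scalerA mulfV// scale1r addNr mul0mx add0r.
  rewrite quad_formE /S mulmxBr -scalemxAr !mulNmx -!scalemxAl mulmxA addrC; apply.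
  apply: contra y0 => /eqP H; apply/eqP/rowP => i.
  have := congr1 (fun M : 'M[R]_(1, 1 + n) => M ord0 (rshift 1 i)) H.
  by rewrite (@row_mxEr _ 1 1 n) !mxE.
have [T' [T'u T'd T'E]] := IH S ST Spos.
pose t := (Num.sqrt a)^-1.
have t0 : 0 < t by rewrite invr_gt0 sqrtr_gt0.
(* Chosen so that the first row of [A *m T] vanishes beyond its first entry. *)
pose r : 'M[R]_(1, n) := - (a^-1 *: (b *m T')).
pose T : 'M[R]_(1 + n, 1 + n) := block_mx t%:M r 0 T'.
exists T; split.
- move=> i j; have [j' ->|->] := unliftP ord0 j; have [i' ->|->] := unliftP ord0 i => //.
    rewrite !lift0 ltnS => /T'u T'ij.
    have -> : lift ord0 i' = rshift 1 i' by exact/val_inj.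
    have -> : lift ord0 j' = rshift 1 j' by exact/val_inj.
    by rewrite /T (@block_mxEdr _ 1 n 1 n).
  move=> _.
  have -> : lift ord0 i' = rshift 1 i' by exact/val_inj.
  have -> : ord0 = lshift n (ord0 : 'I_1) by exact/val_inj.
  by rewrite /T (@block_mxEdl _ 1 n 1 n) mxE.
- move=> i; have [i' ->|->] := unliftP ord0 i.
    have -> : lift ord0 i' = rshift 1 i' by exact/val_inj.
    by rewrite /T (@block_mxEdr _ 1 n 1 n).
  have -> : ord0 = lshift n (ord0 : 'I_1) by exact/val_inj.
  by rewrite /T (@block_mxEul _ 1 n 1 n) mxE eqxx mulr1n.
have ar : a%:M *m r + b *m T' = 0.
  by rewrite mul_scalar_mx /r scalerN scalerA mulfV// scale1r addNr.
rewrite -mulmxA [X in _ *m (X *m _)]AE /T (mulmx_block a%:M b b^T A' t%:M r 0 T').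
rewrite ar !mulmx0 !addr0 (tr_block_mx t%:M r 0 T').
rewrite (mulmx_block (t%:M)^T 0^T r^T T'^T (a%:M *m t%:M) 0 (b^T *m t%:M) (b^T *m r + A' *m T')).
rewrite !trmx0 !mulmx0 !mul0mx !addr0 add0r tr_scalar_mx.
have -> : r^T *m (a%:M *m t%:M) + T'^T *m (b^T *m t%:M) = 0.
  rewrite !mulmxA -mulmxDl.
  have -> : r^T *m a%:M + T'^T *m b^T = (a%:M *m r + b *m T')^T.
    by rewrite linearD /= !trmx_mul tr_scalar_mx.
  by rewrite ar trmx0 mul0mx.
have -> : T'^T *m (b^T *m r + A' *m T') = 1%:M.
  rewrite -T'E -mulmxA; congr (_ *m _).
  by rewrite /S /r mulmxBl -scalemxAl mulmxN -scalemxAr mulmxA addrC.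
have -> : t%:M *m (a%:M *m t%:M) = 1%:M :> 'M[R]_1.
  rewrite -!scalar_mxM; congr (_%:M).
  rewrite mulrCA -expr2 /t exprVn sqr_sqrtr ?mulfV//; exact: ltW.
exact: (esym (@scalar_mx_block _ 1 n 1)).
Qed.

(** A new factor adds [a i] times the product minus 1 to the error, and bounding that requires both
    estimates. With [k = 4 ^ size s] the errors add up to [3 k e ^ 2], which the base 4 absorbs. *)
Lemma prod1D_bound (I : Type) (s : seq I) (a : I -> R) (e : R) :
  0 <= e <= 1 -> (forall i, `|a i| <= e) ->
  `|\prod_(i <- s) (1 + a i) - 1 - \sum_(i <- s) a i| <= 4 ^+ size s * e ^+ 2 /\
  `|\sum_(i <- s) a i| <= 4 ^+ size s * e.
Proof.
move=> /andP[e0 e1] ae; elim: s => [|i s [IH1 IH2]] /=.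
  by rewrite !big_nil subrr subr0 normr0 mulr_ge0 ?sqr_ge0//= expr0 mul1r.
rewrite !big_cons exprS.
set P := \prod_(j <- s) _ in IH1 *; set S := \sum_(j <- s) _ in IH1 IH2 *.
have k1 : 1 <= 4 ^+ size s :> R by rewrite exprn_ege1 ?ler1n.
set k := 4 ^+ size s in k1 IH1 IH2 *.
have ke2 : k * e ^+ 2 <= k * e by rewrite ler_wpM2l ?expr2 ?ler_piMr//; lra.
split; last first.
  rewrite (le_trans (ler_normD _ _))// (le_trans (lerD (ae i) IH2))//.
  by have : e <= k * e; [rewrite ler_peMl|lra].
have -> : (1 + a i) * P - 1 - (a i + S) = (P - 1 - S) + a i * (P - 1 - S + S) by ring.
rewrite (le_trans (ler_normD _ _))//.
have : `|a i * (P - 1 - S + S)| <= e * (k * e + k * e).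
  rewrite normrM ler_pM//.
  by rewrite (le_trans (ler_normD _ _))// lerD// (le_trans IH1).
rewrite expr2 in IH1 *; move=> H.
have : 0 <= k * (e * e) by rewrite !mulr_ge0//; lra.
have : e * (k * e + k * e) = 2 * (k * (e * e)) by ring.
by lra.
Qed.

(** In the Leibniz formula the identity contributes the product of the [1 + E i i]. Any other
    permutation moves some [i] and also its image [s i], hence has two off-diagonal factors of size
    at most [e]; the remaining factors are at most 2. *)
Lemma det1D_bound n : exists2 C : R, 0 <= C & forall (E : 'M[R]_n) (e : R),
  0 <= e <= 1 -> (forall i j, `|E i j| <= e) ->
  `|\det (1%:M + E) - 1 - \tr E| <= C * e ^+ 2.
Proof.
pose m := #|{perm 'I_n}|%:R : R.
exists (4 ^+ n + m * 2 ^+ n); first by rewrite addr_ge0// mulr_ge0.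
move=> E e /andP[e0 e1] Ee.
rewrite /determinant (bigD1 1%g)//= odd_perm1 expr0 mul1r.
have -> : \prod_i (1%:M + E) i ((1%g : {perm 'I_n}) i) = \prod_i (1 + E i i).
  by apply: eq_bigr => i _; rewrite perm1 !mxE eqxx.
have [+ _] := @prod1D_bound _ (index_enum 'I_n) (fun i => E i i) e (introT andP (conj e0 e1)) (fun i => Ee i i).
have -> : size (index_enum 'I_n) = n.
  by rewrite -[RHS]card_ord cardT enumT.
rewrite -/(\tr E); set P := \prod_(i <- _) _; set Q := \sum_(s | _) _ => H.
have -> : P + Q - 1 - \tr E = (P - 1 - \tr E) + Q by ring.
rewrite (le_trans (ler_normD _ _))// mulrDl lerD//.
rewrite /Q (le_trans (ler_norm_sum _ _ _))// /m -mulrA mulr_natl.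
apply: (@le_trans _ _ (\sum_(s : {perm 'I_n} | s != 1%g) 2 ^+ n * e ^+ 2)); last first.
  rewrite sumr_const ler_wpMn2l ?mulr_ge0 ?sqr_ge0//.
  by apply: subset_leq_card; exact: subset_predT.
apply: ler_sum => s s1; rewrite normrM normrX normrN normr1 expr1n mul1r.
have [i si] : exists i, s i != i.
  apply/existsP; rewrite -negb_forall; apply: contra s1 => /forallP H1.
  by apply/eqP/permP => i; rewrite perm1; exact/eqP.
have ssi : s (s i) != s i by rewrite (inj_eq perm_inj).
rewrite (bigD1 i)//= (bigD1 (s i))//= !normrM.
have off j : s j != j -> `|(1%:M + E) j (s j)| <= e.
  by move=> /negbTE sj; rewrite !mxE eq_sym sj add0r.
rewrite mulrA mulrC ler_pM ?mulr_ge0//; last by rewrite expr2 ler_pM// off.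
rewrite normr_prod.
apply: (@le_trans _ _ (\prod_(j < n | (j != i) && (j != s i)) 2)).
  apply: ler_prod => j _; rewrite normr_ge0 /= !mxE (le_trans (ler_normD _ _))//.
  have : `|(j == s j)%:R : R| <= 1 by case: eqP; rewrite ?normr0 ?normr1.
  by have := Ee j (s j); lra.
rewrite prodr_const ler_eXn2l ?ltr1n//.
by rewrite -[leqRHS](card_ord n); exact: max_card.
Qed.

Lemma mulmx_entry_bound n (A B : 'M[R]_n) (a b : R) : 0 <= a ->
  (forall i j, `|A i j| <= a) -> (forall i j, `|B i j| <= b) ->
  forall i j, `|(A *m B) i j| <= n%:R * a * b.
Proof.
move=> a0 Aa Bb i j; rewrite mxE (le_trans (ler_norm_sum _ _ _))//.
have -> : n%:R * a * b = \sum_(k < n) a * b.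
  by rewrite sumr_const card_ord -mulrA mulr_natl.
by apply: ler_sum => k _; rewrite normrM ler_pM.
Qed.

Lemma mx_entries_bounded n (A : 'M[R]_n) : exists2 a : R, 0 <= a & forall i j, `|A i j| <= a.
Proof.
exists (\sum_i \sum_j `|A i j|).
  by apply: sumr_ge0 => i _; apply: sumr_ge0.
move=> i j; rewrite (bigD1 i)//= (bigD1 j)//= -addrA lerDl addr_ge0// ?sumr_ge0//.
by move=> k _; apply: sumr_ge0.
Qed.

(** The numbers [dV], [db], [dS] stand for the changes in volume, first and second moments when a
    set of volume [v] is added or removed. The trace expression is the first variation of the
    logarithm of determinant over volume to the power [n + 2]; the term with [db] is of second order
    because the moments are taken about the old centroid. *)
Lemma det_ratio_increase n (A : 'M[R]_n) (V W : R) : A \in unitmx -> 0 < \det A ->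
  0 < V -> 0 < W -> exists C : R, exists2 r0 : R, 0 < r0 &
  forall (dV : R) (db : 'rV[R]_n) (dS : 'M[R]_n) (v : R), 0 <= v <= r0 ->
    `|dV| <= W * v -> (forall i, `|db ord0 i| <= W * v) ->
    (forall i j, `|dS i j| <= W * v) ->
    C * v ^+ 2 < \tr (invmx A *m dS) - (n + 2)%:R * dV / V ->
    0 < V + dV /\
    \det A * (V + dV) ^+ (n + 2) <
      \det (A + dS - (V + dV)^-1 *: (db^T *m db)) * V ^+ (n + 2).
Proof.
move=> Au A0 V0 W0.
have [a a0 Aa] := mx_entries_bounded (invmx A).
have [D D0 HD] := det1D_bound n.
(* As [V + dV >= V / 2], the entries of the rank one term [F] are at most [g * v ^+ 2]. *)
pose g := 2 * W ^+ 2 / V.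
have g0 : 0 <= g by rewrite divr_ge0 ?mulr_ge0 ?sqr_ge0//; lra.
pose b := n%:R * a * (W + g).
have na0 : 0 <= n%:R * a by rewrite mulr_ge0.
have b0 : 0 <= b by rewrite mulr_ge0//; lra.
(* The three errors of second order: expansion of the determinant, trace of [invmx A *m F], and
   expansion of the power of the volume. *)
pose C := D * b ^+ 2 + n%:R * (n%:R * a * g) + 4 ^+ (n + 2) * (W / V) ^+ 2.
exists C.
(* These bounds give [v ^+ 2 <= v], then [b * v <= 1] as [det1D_bound] requires, then
   [W * v <= V / 2]. *)
exists (Num.min 1 (Num.min (1 + b)^-1 (V / (2 * W)))).
  by rewrite !lt_min ltr01 invr_gt0 divr_gt0//; lra.
move=> dV db dS v /andP[v0]; rewrite !le_min => /and3P[v1 vb vV] dVv dbv dSv H.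
have bv1 : b * v <= 1.
  rewrite -[leRHS](@mulfV _ (1 + b)); last by rewrite gt_eqF//; lra.
  by rewrite ler_pM//; lra.
have WvV : W * v <= V / 2.
  rewrite (_ : V / 2 = W * (V / (2 * W))); last by field; lra.
  by rewrite ler_pM2l.
have Vd : V / 2 <= V + dV by have := ler_norm (- dV); rewrite normrN; lra.
have Vd0 : 0 < V + dV by lra.
split => //.
pose F := (V + dV)^-1 *: (db^T *m db).
have Fv i j : `|F i j| <= g * v ^+ 2.
  rewrite /F mxE normrM gtr0_norm ?invr_gt0//.
  have -> : g * v ^+ 2 = (V / 2)^-1 * ((W * v) * (W * v)) by rewrite /g; field; lra.
  rewrite ler_pM ?invr_ge0 ?(ltW Vd0)//.
    by rewrite lef_pV2 ?posrE//; lra.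
  by rewrite mxE big_ord1 mxE normrM ler_pM.
pose E := invmx A *m (dS - F).
have v2v : v ^+ 2 <= v by rewrite expr2 ler_piMr.
have Ee i j : `|E i j| <= b * v.
  rewrite /b -mulrA; apply: mulmx_entry_bound => // k l.
  rewrite mxE [(- F) k l]mxE (le_trans (ler_normB _ _))// mulrDl lerD//.
  by rewrite (le_trans (Fv k l))// ler_wpM2l.
have detE : \det (A + dS - F) = \det A * \det (1%:M + E).
  by rewrite -det_mulmx mulmxDr mulmx1 /E mulKVmx// addrA.
have /HD/(_ Ee) : 0 <= b * v <= 1 by rewrite bv1 mulr_ge0.
rewrite ler_norml => /andP[HE _].
have trF : `|\tr (invmx A *m F)| <= n%:R * (n%:R * a * g) * v ^+ 2.
  rewrite (le_trans (ler_norm_sum _ _ _))//.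
  have -> : n%:R * (n%:R * a * g) * v ^+ 2 = \sum_(k < n) n%:R * a * (g * v ^+ 2).
    by rewrite sumr_const card_ord -!mulrA mulr_natl.
  by apply: ler_sum => k _; exact: mulmx_entry_bound.
have trE : \tr E = \tr (invmx A *m dS) - \tr (invmx A *m F).
  by rewrite /E mulmxBr raddfB.
have dVV : `|dV / V| <= W / V * v.
  by rewrite normrM normfV (gtr0_norm V0) mulrAC ler_pM2r ?invr_gt0.
have WV1 : 0 <= W / V * v <= 1.
  rewrite mulrAC divr_ge0 ?mulr_ge0 ?(ltW W0) ?(ltW V0)//= ler_pdivrMr//; lra.
(* A constant family of length [n + 2] gives the expansion of the power. *)
have [+ _] := @prod1D_bound _ (iota 0 (n + 2)) (fun=> dV / V) _ WV1 (fun=> dVV).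
rewrite size_iota !big_const_seq /= count_predT size_iota iter_addr_0 iter_mulr_1.
rewrite ler_norml => /andP[_ HP].
have P : (V + dV) ^+ (n + 2) = (1 + dV / V) ^+ (n + 2) * V ^+ (n + 2).
  by rewrite -exprMn; congr (_ ^+ _); field; lra.
rewrite P mulrA detE ltr_pM2r ?exprn_gt0// ltr_pM2l//.
have nd : (dV / V) *+ (n + 2) = (n + 2)%:R * dV / V by rewrite -mulr_natl mulrA.
rewrite nd exprMn in HP; rewrite exprMn in HE.
move: trF; rewrite ler_norml => /andP[_ trF].
rewrite trE in HE.
move: H; rewrite /C.
have : (D * b ^+ 2 + n%:R * (n%:R * a * g) + 4 ^+ (n + 2) * (W / V) ^+ 2) * v ^+ 2 =
  D * (b ^+ 2 * v ^+ 2) + n%:R * (n%:R * a * g) * v ^+ 2 + 4 ^+ (n + 2) * ((W / V) ^+ 2 * v ^+ 2) by ring.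
move=> -> H; clear -H HP HE trF.
move: (\det (1%:M + E)) (\tr (invmx A *m F)) ((1 + dV / V) ^+ (n + 2)) H HP HE trF.
move: (\tr (invmx A *m dS)) ((n + 2)%:R * dV / V) (D * (b ^+ 2 * v ^+ 2)).
move: (n%:R * (n%:R * a * g) * v ^+ 2) (4 ^+ (n + 2) * ((W / V) ^+ 2 * v ^+ 2)).
by move=> *; lra.
Qed.

End matrix_algebra.

(** * Continuity and integration *)

Section continuity.
Context {R : realType} {T : topologicalType}.
Implicit Types f g : T -> R.

Lemma contD f g : continuous f -> continuous g -> continuous (fun x => f x + g x).
Proof. by move=> cf cg x; apply: (@continuousD _ _ _ f g); [exact: cf|exact: cg]. Qed.

Lemma contM f g : continuous f -> continuous g -> continuous (fun x => f x * g x).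
Proof. by move=> cf cg x; apply: (@continuousM _ _ f g); [exact: cf|exact: cg]. Qed.

Lemma cont_sum (I : finType) (P : pred I) (f : I -> T -> R) :
  (forall i, continuous (f i)) -> continuous (fun x => \sum_(i | P i) f i x).
Proof.
move=> cf; apply: (@continuous_big R I +%R 0 P _ T _ f); first exact: add_continuous.
by move=> i _; exact: cf.
Qed.

Lemma continuous_rVP n (h : T -> 'rV[R]_n) :
  (forall i, continuous (fun x => h x ord0 i)) -> continuous h.
Proof.
move=> ch x P [Q Qx QP].
have H : nbhs x (fun y => forall i, Q ord0 i (h y ord0 i)).
  by apply: filter_forall => i; apply: ch; exact: Qx.
by apply: filterS H => y Hy; apply: QP => i j; rewrite (ord1 i).
Qed.

End continuity.

Section affine_continuity.
Context {R : realType} {n : nat}.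

Lemma cont_coord (i : 'I_n) : continuous (fun x : 'rV[R]_n => x ord0 i).
Proof. exact: coord_continuous. Qed.

Lemma cont_cst (T : topologicalType) (a : R) : continuous (fun _ : T => a).
Proof. exact: cst_continuous. Qed.

Lemma continuous_affine_map (T : 'M[R]_n) b : continuous (affine_map T b).
Proof.
apply: continuous_rVP => i.
have -> : (fun x => affine_map T b x ord0 i) =
    (fun x : 'rV[R]_n => \sum_j x ord0 j * T j i + b ord0 i); last first.
  apply: contD; last exact: cont_cst.
  by apply: cont_sum => j; apply: contM; [exact: cont_coord|exact: cont_cst].
by apply/funext => x; rewrite affine_map_coord.
Qed.

End affine_continuity.

Section integrals.
Context {R : realType} {n : nat}.
Implicit Types (D K : set 'rV[R]_n) (f g : 'rV[R]_n -> R).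

Local Notation "'I[ D ] g" := (\int[@lebesgue_rV R n]_(x in D) g x)
  (at level 36, D at level 200, g at level 36).

Lemma rintD D f g : continuous f -> continuous g -> bounded_measurable D ->
  'I[D] (fun x => f x + g x) = 'I[D] f + 'I[D] g.
Proof.
move=> cf cg bD; rewrite RintegralD//; first by case: bD.
all: exact: integrable_continuous_rV.
Qed.

Lemma rintB D f g : continuous f -> continuous g -> bounded_measurable D ->
  'I[D] (fun x => f x - g x) = 'I[D] f - 'I[D] g.
Proof.
move=> cf cg bD; rewrite RintegralB//; first by case: bD.
all: exact: integrable_continuous_rV.
Qed.

Lemma rintZ D (a : R) g : continuous g -> bounded_measurable D ->
  'I[D] (fun x => a * g x) = a * 'I[D] g.
Proof.
move=> cg bD; rewrite RintegralZl//; first by case: bD.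
exact: integrable_continuous_rV.
Qed.

Lemma rint_cst D (a : R) : bounded_measurable D -> 'I[D] (fun=> a) = a * volume D.
Proof. by move=> [mD _]; rewrite Rintegral_cst. Qed.

Lemma rint_sum D (I : Type) (s : seq I) (f : I -> 'rV[R]_n -> R) :
  (forall i, continuous (f i)) -> bounded_measurable D ->
  'I[D] (fun x => \sum_(i <- s) f i x) = \sum_(i <- s) 'I[D] (f i).
Proof.
move=> cf bD; elim: s => [|i s IH].
  rewrite big_nil -[RHS](mul0r (volume D)) -rint_cst//; apply: eq_Rintegral => x _.
  by rewrite big_nil.
rewrite big_cons -IH -rintD//; first by apply: eq_Rintegral => x _; rewrite big_cons.
by apply: (@continuous_big R I +%R 0 xpredT _ _ _ f) => //; exact: add_continuous.
Qed.

Lemma rint_le D f g : continuous f -> continuous g -> bounded_measurable D ->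
  (forall x, D x -> f x <= g x) -> 'I[D] f <= 'I[D] g.
Proof.
move=> cf cg bD fg; apply: le_Rintegral => //; first by case: bD.
all: exact: integrable_continuous_rV.
Qed.

Lemma rint_setD D D' g : continuous g -> bounded_measurable D -> measurable D' ->
  D' `<=` D -> 'I[D] g = 'I[D'] g + 'I[D `\` D'] g.
Proof.
move=> cg bD mD' D'D; have [mD _] := bD.
rewrite -[in LHS](setDUK D'D) Rintegral_setU//; first exact: measurableD.
  by rewrite setDUK//; exact: integrable_continuous_rV.
by rewrite disj_set2E; apply/eqP/seteqP; split => // x /= [D'x [_]].
Qed.

Lemma volume_ge0 D : 0 <= volume D.
Proof. exact: fine_ge0. Qed.

Lemma volumeE D : bounded_measurable D -> lebesgue_rV D = (volume D)%:E.
Proof. by move=> bD; rewrite fineK// ge0_fin_numE//; exact: bounded_measurable_fin_num. Qed.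

Lemma volume_setD D D' : bounded_measurable D -> measurable D' -> D' `<=` D ->
  volume D = volume D' + volume (D `\` D').
Proof.
move=> bD mD' D'D; have bD' := bounded_measurableS mD' D'D bD.
have bDD' := bounded_measurableD bD mD'.
have := rint_setD (@cont_cst R 'rV[R]_n 1) bD mD' D'D.
by rewrite !rint_cst// !mul1r.
Qed.

Lemma volume_le D D' : bounded_measurable D -> measurable D' -> D' `<=` D ->
  volume D' <= volume D.
Proof. by move=> bD mD' D'D; rewrite (volume_setD bD mD' D'D) lerDl volume_ge0. Qed.

Lemma volume_gt0 D : bounded_measurable D -> D° !=set0 -> 0 < volume D.
Proof.
move=> bD D0; have [mD _] := bD.
by rewrite -lte_fin -volumeE//; exact: lebesgue_rV_open_gt0.
Qed.

Lemma rint_abs_le D g (M : R) : continuous g -> bounded_measurable D ->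
  (forall x, D x -> `|g x| <= M) -> `|'I[D] g| <= M * volume D.
Proof.
move=> cg bD gM; rewrite ler_norml; apply/andP; split.
  rewrite -mulNr -rint_cst//; apply: rint_le => //; first exact: cont_cst.
  by move=> x /gM; rewrite ler_norml => /andP[].
rewrite -rint_cst//; apply: rint_le => //; first exact: cont_cst.
by move=> x /gM; rewrite ler_norml => /andP[].
Qed.

Lemma rint_gt0 D g (x0 : 'rV[R]_n) : continuous g -> bounded_measurable D ->
  (forall x, D x -> 0 <= g x) -> D° x0 -> 0 < g x0 -> 0 < 'I[D] g.
Proof.
move=> cg bD g0 Dx0 gx0; have [mD _] := bD.
pose U := D° `&` [set x | g x0 / 2 < g x].
have oU : open U.
  apply: openI; first exact: open_interior.
  by apply: (@open_comp _ _ g [set y | g x0 / 2 < y]) => [x _|]; [exact: cg|exact: open_gt].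
have Ux0 : U x0 by split => //=; rewrite ltr_pdivrMr// ltr_pMr// ltr1n.
have UD : U `<=` D by move=> x [/interior_subset].
have mU := measurable_rV_open oU.
have bU := bounded_measurableS mU UD bD.
rewrite (rint_setD cg bD mU UD) ltr_wpDr//.
  by apply: Rintegral_ge0 => x [Dx _]; exact: g0.
apply: (@lt_le_trans _ _ (g x0 / 2 * volume U)).
  rewrite mulr_gt0 ?divr_gt0// volume_gt0//; exists x0.
  by rewrite (_ : U° = U)//; apply/interior_id.
rewrite -rint_cst//; apply: rint_le => //; first exact: cont_cst.
by move=> x [_ /ltW].
Qed.

Lemma integral_fineE D g : continuous g -> bounded_measurable D ->
  (\int[lebesgue_rV]_(x in D) (g x)%:E)%E = ('I[D] g)%:E.
Proof.
move=> cg bD; rewrite /Rintegral fineK//.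
by apply: integrable_fin_num; [case: bD|exact: integrable_continuous_rV].
Qed.

End integrals.

(** * Moments and covariance *)

Section moments.
Context {R : realType} {n : nat}.
Implicit Types (D K : set 'rV[R]_n) (z y : 'rV[R]_n).

Local Notation "'I[ D ] g" := (\int[@lebesgue_rV R n]_(x in D) g x)
  (at level 36, D at level 200, g at level 36).

Definition moment1 z D : 'rV[R]_n := \row_i 'I[D] (fun x => x ord0 i - z ord0 i).

Definition moment2 z D : 'M[R]_n :=
  \matrix_(i, j) 'I[D] (fun x => (x ord0 i - z ord0 i) * (x ord0 j - z ord0 j)).

Definition centroid D : 'rV[R]_n := (volume D)^-1 *: moment1 0 D.

Definition covmx D := moment2 (centroid D) D.

Lemma cont_coordB z i : continuous (fun x : 'rV[R]_n => x ord0 i - z ord0 i).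
Proof. by apply: contD; [exact: cont_coord|exact: cont_cst]. Qed.

Lemma cont_coordB2 z i j :
  continuous (fun x : 'rV[R]_n => (x ord0 i - z ord0 i) * (x ord0 j - z ord0 j)).
Proof. by apply: contM; exact: cont_coordB. Qed.

Lemma cont_dotvB2 z y : continuous (fun x : 'rV[R]_n => dotv (x - z) y ^+ 2).
Proof.
by under eq_fun do rewrite expr2; apply: contM; exact: continuous_dotvB.
Qed.

Lemma quad_form_sum (Q : 'M[R]_n) y :
  quad_form Q y = \sum_i \sum_j Q i j * (y ord0 i * y ord0 j).
Proof.
rewrite /quad_form /dotv exchange_big /=; apply: eq_bigr => j _.
by rewrite mxE mulr_suml; apply: eq_bigr => i _; rewrite mulrAC mulrC mulrA.
Qed.

Lemma rint_dotvB D z y : bounded_measurable D ->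
  'I[D] (fun x => dotv (x - z) y) = dotv (moment1 z D) y.
Proof.
move=> bD; rewrite /dotv.
transitivity ('I[D] (fun x : 'rV[R]_n => \sum_i y ord0 i * (x ord0 i - z ord0 i))).
  by apply: eq_Rintegral => x _; apply: eq_bigr => i _; rewrite !mxE mulrC.
rewrite rint_sum//; last first.
  by move=> i; apply: contM; [exact: cont_cst|exact: cont_coordB].
by apply: eq_bigr => i _; rewrite rintZ// ?mxE 1?mulrC//; exact: cont_coordB.
Qed.

Lemma rint_quad_form D z (Q : 'M[R]_n) : bounded_measurable D ->
  'I[D] (fun x => quad_form Q (x - z)) = \sum_i \sum_j Q i j * moment2 z D i j.
Proof.
move=> bD.
have cij i j : continuous (fun x : 'rV[R]_n =>
    Q i j * ((x ord0 i - z ord0 i) * (x ord0 j - z ord0 j))).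
  by apply: contM; [exact: cont_cst|exact: cont_coordB2].
transitivity ('I[D] (fun x : 'rV[R]_n => \sum_i \sum_j Q i j * ((x ord0 i - z ord0 i) * (x ord0 j - z ord0 j)))).
  apply: eq_Rintegral => x _; rewrite quad_form_sum.
  by apply: eq_bigr => i _; apply: eq_bigr => j _; rewrite !mxE.
rewrite rint_sum//; last by move=> i; apply: cont_sum => j; exact: cij.
apply: eq_bigr => i _; rewrite rint_sum//; apply: eq_bigr => j _.
by rewrite rintZ ?mxE//; exact: cont_coordB2.
Qed.

Lemma cont_quad_form z (Q : 'M[R]_n) : continuous (fun x : 'rV[R]_n => quad_form Q (x - z)).
Proof.
under eq_fun do rewrite quad_form_sum.
apply: cont_sum => i; apply: cont_sum => j; apply: contM; first exact: cont_cst.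
have -> : (fun x : 'rV[R]_n => (x - z) ord0 i * (x - z) ord0 j) =
    (fun x => (x ord0 i - z ord0 i) * (x ord0 j - z ord0 j)).
  by apply/funext => x; rewrite !mxE.
exact: cont_coordB2.
Qed.

Lemma dotv_sqr_quad_form (x y : 'rV[R]_n) : dotv x y ^+ 2 = quad_form (y^T *m y) x.
Proof.
rewrite quad_form_sum expr2 {1}/dotv mulr_suml; apply: eq_bigr => i _.
rewrite mulr_sumr; apply: eq_bigr => j _.
by rewrite mxE big_ord1 !mxE; ring.
Qed.

Lemma rint_dotvB2 D z y : bounded_measurable D ->
  'I[D] (fun x => dotv (x - z) y ^+ 2) = quad_form (moment2 z D) y.
Proof.
move=> bD; under eq_Rintegral do rewrite dotv_sqr_quad_form.
rewrite rint_quad_form// quad_form_sum.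
by apply: eq_bigr => i _; apply: eq_bigr => j _; rewrite mxE big_ord1 !mxE mulrC.
Qed.

Lemma moment1_shift D z z' : bounded_measurable D ->
  moment1 z' D = moment1 z D + volume D *: (z - z').
Proof.
move=> bD; apply/rowP => i; rewrite !mxE.
have -> : volume D * (z ord0 i - z' ord0 i) = 'I[D] (fun=> z ord0 i - z' ord0 i).
  by rewrite rint_cst// mulrC.
rewrite -rintD//; first by apply: eq_Rintegral => x _; ring.
- exact: cont_coordB.
- exact: cont_cst.
Qed.

Lemma centroidE D z : bounded_measurable D -> volume D != 0 ->
  centroid D = z + (volume D)^-1 *: moment1 z D.
Proof.
move=> bD V0; rewrite /centroid (moment1_shift z)// scalerDr scalerA mulVf//.
by rewrite scale1r subr0 addrC.
Qed.

Lemma moment1_centroid D : bounded_measurable D -> volume D != 0 ->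
  moment1 (centroid D) D = 0.
Proof.
move=> bD V0; rewrite (moment1_shift 0)// sub0r /centroid scalerN scalerA.
by rewrite mulfV// scale1r subrr.
Qed.

(** The parallel axis theorem. It allows the moments of a perturbed body to be taken about the
    centroid of the original one. *)
Lemma covmxE D z : bounded_measurable D -> volume D != 0 ->
  covmx D = moment2 z D - (volume D)^-1 *: ((moment1 z D)^T *m moment1 z D).
Proof.
move=> bD V0; rewrite /covmx (centroidE z)//.
set w := _ *: moment1 z D.
have m1w i : moment1 z D ord0 i = volume D * w ord0 i.
  by rewrite [w _ _]mxE mulrA mulfV// mul1r.
have zw k : (z + w) ord0 k = z ord0 k + w ord0 k by rewrite mxE.
apply/matrixP => i j; rewrite [LHS]mxE [RHS]mxE [moment2 z D i j]mxE.
have wE : ((volume D)^-1 *: ((moment1 z D)^T *m moment1 z D)) i j =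
    volume D * (w ord0 i * w ord0 j).
  by rewrite mxE mxE big_ord1 [(moment1 z D)^T _ _]mxE !m1w; field.
rewrite [X in _ = _ + X]mxE wE.
pose F (x : 'rV[R]_n) : R := - w ord0 j * (x ord0 i - z ord0 i) + (- w ord0 i * (x ord0 j - z ord0 j)
  + w ord0 i * w ord0 j).
have c1 (a : R) k : continuous (fun x : 'rV[R]_n => a * (x ord0 k - z ord0 k)).
  by apply: contM; [exact: cont_cst|exact: cont_coordB].
have c2 : continuous (fun x : 'rV[R]_n => - w ord0 i * (x ord0 j - z ord0 j) + w ord0 i * w ord0 j).
  by apply: contD; [exact: c1|exact: cont_cst].
transitivity ('I[D] (fun x : 'rV[R]_n => (x ord0 i - z ord0 i) * (x ord0 j - z ord0 j) + F x)).
  by apply: eq_Rintegral => x _; rewrite /F !zw; ring.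
rewrite rintD//; [|exact: cont_coordB2|exact: contD].
congr (_ + _); rewrite rintD// rintD//; last exact: cont_cst.
rewrite rint_cst// !rintZ//; [|exact: cont_coordB|exact: cont_coordB].
have mE k : 'I[D] (fun x => x ord0 k - z ord0 k) = volume D * w ord0 k by rewrite -m1w mxE.
by rewrite !mE; field.
Qed.

Lemma moment2_tr z D : (moment2 z D)^T = moment2 z D.
Proof. by apply/matrixP => i j; rewrite !mxE; apply: eq_Rintegral => x _; rewrite mulrC. Qed.

(** The form is the integral of a square, and an interior point that happens to lie on its zero
    hyperplane can be moved off it in the direction [y]. *)
Lemma moment2_pos z D y : bounded_measurable D -> D° !=set0 -> y != 0 ->
  0 < quad_form (moment2 z D) y.
Proof.
move=> bD [p Dp] y0; rewrite -rint_dotvB2//.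
have [q [Dq q0]] : exists q, D° q /\ dotv (q - z) y != 0.
  have [p0|p0] := eqVneq (dotv (p - z) y) 0; last by exists p.
  have /nbhs_ballP[e /= e0 peD] : nbhs p D° by apply: open_nbhs_nbhs; split => //; exact: open_interior.
  exists (p + (e / 2 / `|y|) *: y); split.
    apply: peD; rewrite -ball_normE /= opprD addNKr normrN normrZ gtr0_norm; last first.
      by rewrite !divr_gt0// normr_gt0.
    by rewrite divfK ?normr_eq0//; lra.
  rewrite addrAC dotvDl p0 add0r dotvZl mulf_neq0 ?gt_eqF ?dotv_gt0//.
  by rewrite !divr_gt0// normr_gt0.
apply: (@rint_gt0 _ _ _ _ q) => //.
- exact: cont_dotvB2.
- by move=> x _; rewrite sqr_ge0.
- by rewrite lt_neqAle sqr_ge0 andbT eq_sym sqrf_eq0.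
Qed.

Lemma moment2_det_gt0 z D : bounded_measurable D -> D° !=set0 -> 0 < \det (moment2 z D).
Proof.
move=> bD D0.
have [T [Tu T0 TE]] := cholesky (moment2_tr z D) (fun y => @moment2_pos z D y bD D0).
have /(congr1 determinant) := TE.
rewrite !det_mulmx det_tr det1 mulrAC -expr2 => H.
have T2 : 0 < \det T ^+ 2.
  by rewrite lt_neqAle sqr_ge0 andbT eq_sym; apply: contra_eq_neq H => ->; rewrite mul0r eq_sym oner_eq0.
by rewrite -(pmulr_rgt0 _ T2) H.
Qed.

End moments.

(** * The isotropy constant as a determinant *)

Section isotropy.
Context {R : realType} {n : nat}.
Implicit Types (D K B : set 'rV[R]_n) (x y z b : 'rV[R]_n) (T : 'M[R]_n).

Local Notation "'I[ D ] g" := (\int[@lebesgue_rV R n]_(x in D) g x)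
  (at level 36, D at level 200, g at level 36).

Lemma affine_mapK T b : T \in unitmx ->
  cancel (affine_map T b) (affine_map (invmx T) (- (b *m invmx T))).
Proof. by move=> Tu x; rewrite /affine_map mulmxDl mulmxK// addrK. Qed.

Lemma affine_mapVK T b : T \in unitmx ->
  cancel (affine_map (invmx T) (- (b *m invmx T))) (affine_map T b).
Proof. by move=> Tu x; rewrite /affine_map mulmxDl mulNmx !mulmxKV// subrK. Qed.

Lemma affine_image_preimage T b B : T \in unitmx ->
  affine_map T b @` B = affine_map (invmx T) (- (b *m invmx T)) @^-1` B.
Proof.
move=> Tu; apply/seteqP; split => x /=; first by move=> [y By <-]; rewrite affine_mapK.
by move=> Bx; exists (affine_map (invmx T) (- (b *m invmx T)) x) => //; rewrite affine_mapVK.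
Qed.

Lemma affine_preimage_image T b B : T \in unitmx ->
  affine_map T b @^-1` (affine_map T b @` B) = B.
Proof.
move=> Tu; apply/seteqP; split => x /=; last by move=> Bx; exists x.
by move=> [y By /(can_inj (affine_mapK b Tu)) <-].
Qed.

Lemma affine_image_of_preimage T b B : T \in unitmx ->
  affine_map T b @` (affine_map T b @^-1` B) = B.
Proof.
move=> Tu; apply/seteqP; split => x /=; first by move=> [y Bfy <-].
by move=> Bx; exists (affine_map (invmx T) (- (b *m invmx T)) x) => //=; rewrite affine_mapVK.
Qed.

Lemma upper_volume_preserving T b : (forall i j : 'I_n, (j < i)%N -> T i j = 0) ->
  \det T = 1 -> volume_preserving (affine_map T b).
Proof.
move=> Tu T1 B mB.
have Tunit : T \in unitmx by rewrite unitmxE T1 unitr1.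
have mfB : measurable (affine_map T b @` B).
  by rewrite affine_image_preimage//; exact: measurable_affine_preimage.
have := lebesgue_rV_upper (T := T) b Tu _ mfB.
rewrite T1 oner_eq0 normr1 invr1 mul1e affine_preimage_image// => ->//.
Qed.

Lemma compact_affine_image T b K : compact K -> compact (affine_map T b @` K).
Proof.
move=> cK; apply: continuous_compact => //; apply: continuous_subspaceT.
exact: continuous_affine_map.
Qed.

Lemma integral_volume_preserving T b K (g : 'rV[R]_n -> R) : T \in unitmx ->
  volume_preserving (affine_map T b) -> compact K -> continuous g ->
  (\int[lebesgue_rV]_(x in affine_map T b @` K) (g x)%:E =
   \int[lebesgue_rV]_(x in K) (g (affine_map T b x))%:E)%E.
Proof.
move=> Tu vp cK cg.
have mf := measurable_affine_map T b.
have mfK := measurable_rV_compact (@compact_affine_image T b K cK).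
rewrite (@eq_measure_integral _ _ _ _
  (measure_function_pushforward__canonical__measure_function_Measure (@lebesgue_rV R n) mf)); last first.
  move=> A mA _ /=; rewrite /pushforward -(vp (affine_map T b @^-1` A)).
    by rewrite affine_image_of_preimage.
  exact: measurable_affine_preimage.
rewrite (@integral_pushforward _ _ _ _ _ _ mf _ _ (EFin \o g)) ?affine_preimage_image//.
  by apply/measurable_EFinP; exact: continuous_measurable_rV.
apply: (@integrable_continuous_rV _ _ _ (g \o affine_map T b)).
  by move=> x; apply: continuous_comp; [exact: continuous_affine_map|exact: cg].
exact: bounded_measurable_compact.
Qed.

Lemma quad_form_polarization (Q : 'M[R]_n) (c : R) : Q^T = Q ->
  (forall y, quad_form Q y = c * dotv y y) -> Q = c%:M.
Proof.
move=> QT H.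
pose e (i : 'I_n) : 'rV[R]_n := delta_mx ord0 i.
have eQ i j : dotv (e i *m Q) (e j) = Q i j.
  rewrite dotvE -rowE mxE (bigD1 j)//= big1 => [|k /negbTE kj].
    by rewrite !mxE !eqxx mulr1 addr0.
  by rewrite !mxE eqxx kj mulr0.
have ee i j : dotv (e i) (e j) = (i == j)%:R.
  rewrite /dotv (bigD1 j)//= big1 ?addr0 => [|k /negbTE kj].
    by rewrite !mxE !eqxx mulr1 eq_sym.
  by rewrite !mxE kj andbF mulr0.
apply/matrixP => i j; rewrite mxE.
have := H (e i + e j); rewrite /quad_form mulmxDl !dotvDl !dotvDr !eQ !ee.
have Hi k : Q k k = c by have := H (e k); rewrite /quad_form eQ ee eqxx mulr1.
rewrite !Hi !eqxx (eq_sym j i).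
have -> : Q j i = Q i j by rewrite -[in LHS]QT mxE.
by rewrite -mulr_natr; case: eqP => _ /=; lra.
Qed.

(** Pulled back to [K], the first moment condition says that the centroid goes to 0, which
    determines [b]; once this holds, the second moment form is that of [T^T *m covmx K *m T]. *)
Lemma isotropic_withP T b K M : T \in unitmx -> volume_preserving (affine_map T b) ->
  compact K -> 0 < volume K ->
  isotropic_with (affine_map T b @` K) M <->
  b = - (centroid K *m T) /\ T^T *m covmx K *m T = (M ^+ 2)%:M.
Proof.
move=> Tu vp cK V0.
have bK := bounded_measurable_compact cK.
have Vn0 : volume K != 0 by rewrite gt_eqF.
have dE x y : dotv (affine_map T b x) y =
    dotv (x - centroid K) (y *m T^T) + dotv (centroid K *m T + b) y.
  have -> : dotv (x - centroid K) (y *m T^T) = dotv ((x - centroid K) *m T) y.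
    by rewrite !dotvE trmx_mul trmxK mulmxA.
  by rewrite -dotvDl mulmxBl addrA subrK.
have cg y : continuous (fun x => dotv x y) by exact: continuous_dotv.
have cg2 y : continuous (fun x : 'rV[R]_n => dotv x y ^+ 2).
  by under eq_fun do rewrite expr2; apply: contM.
have cf (g : 'rV[R]_n -> R) : continuous g -> continuous (fun x => g (affine_map T b x)).
  by move=> cg0 x; apply: (@continuous_comp _ _ _ (affine_map T b) g); [exact: continuous_affine_map|exact: cg0].
have I1 y : (\int[lebesgue_rV]_(x in affine_map T b @` K) (dotv x y)%:E)%E =
    (volume K * dotv (centroid K *m T + b) y)%:E.
  rewrite (integral_volume_preserving _ _ _ (cg y))// (integral_fineE (cf _ (cg y)))//.
  under eq_Rintegral do rewrite dE.
  rewrite rintD ?rint_cst ?rint_dotvB ?moment1_centroid ?dotv0l ?add0r 1?mulrC//.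
  - exact: continuous_dotvB.
  - exact: cont_cst.
have I2 y : b = - (centroid K *m T) ->
   (\int[lebesgue_rV]_(x in affine_map T b @` K) (dotv x y ^+ 2)%:E)%E =
    (quad_form (T^T *m covmx K *m T) y)%:E.
  move=> bE.
  have dE' x : dotv (affine_map T b x) y = dotv (x - centroid K) (y *m T^T).
    by rewrite dE bE subrr dotv0l addr0.
  rewrite (integral_volume_preserving _ _ _ (cg2 y))// (integral_fineE (cf _ (cg2 y)))//.
  under eq_Rintegral do rewrite dE'.
  by rewrite rint_dotvB2// !quad_formE trmx_mul trmxK !mulmxA.
have symm : (T^T *m covmx K *m T)^T = T^T *m covmx K *m T.
  by rewrite !trmx_mul trmxK moment2_tr mulmxA.
split.
  move=> iso.
  have b0 : centroid K *m T + b = 0.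
    (* The image of the centroid is tested against itself. *)
    apply: dotv_eq0; have [+ _] := iso (centroid K *m T + b).
    by rewrite I1 => -[] /eqP; rewrite mulf_eq0 (negbTE Vn0)/= => /eqP.
  have bE : b = - (centroid K *m T) by apply/eqP; rewrite -addr_eq0 addrC b0.
  split => //; apply: quad_form_polarization => // y.
  by have [_] := iso y; rewrite I2// enorm_sqr => -[].
move=> [bE TE] y; split.
  by rewrite I1 bE subrr dotv0l mulr0.
by rewrite I2// TE enorm_sqr /quad_form mul_mx_scalar dotvZl.
Qed.

(** If [w *m T^T = 0], the scalar product with [w] is constant on the image of [K]. As the image has
    positive volume, the first moment condition makes this constant 0, and then the second moment
    vanishes, against [0 < M]. *)
Lemma volume_preserving_unitmx T b K M : (0 < n)%N -> volume_preserving (affine_map T b) ->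
  compact K -> 0 < volume K -> 0 < M -> isotropic_with (affine_map T b @` K) M ->
  T \in unitmx.
Proof.
move=> n0 vp cK V0 M0 iso; rewrite unitmxE unitfE.
apply/negP => T0.
have /det0P[w w0 wT] : \det T^T == 0 by rewrite det_tr.
have bK := bounded_measurable_compact cK.
have bfK := bounded_measurable_compact (@compact_affine_image T b K cK).
have VE : volume (affine_map T b @` K) = volume K.
  by rewrite /volume vp//; case: bK.
have wE x : dotv (affine_map T b x) w = dotv b w.
  have Tw : T *m w^T = 0 by apply: trmx_inj; rewrite trmx_mul trmxK wT trmx0.
  by rewrite /affine_map dotvDl dotvE -mulmxA Tw mulmx0 mxE add0r.
have wE' x : (affine_map T b @` K) x -> dotv x w = dotv b w by move=> [y _ <-].
have cg2 : continuous (fun x : 'rV[R]_n => dotv x w ^+ 2).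
  by under eq_fun do rewrite expr2; apply: contM; exact: continuous_dotv.
have [] := iso w.
rewrite (integral_fineE (@continuous_dotv _ _ w))// (integral_fineE cg2)//.
have -> : 'I[affine_map T b @` K] (fun x => dotv x w) = dotv b w * volume K.
  rewrite -VE -rint_cst//; apply: eq_Rintegral => x /set_mem; exact: wE'.
have -> : 'I[affine_map T b @` K] (fun x => dotv x w ^+ 2) = dotv b w ^+ 2 * volume K.
  by rewrite -VE -rint_cst//; apply: eq_Rintegral => x /set_mem /wE' ->.
move=> [] /eqP; rewrite mulf_eq0 orbC gt_eqF//= => /eqP ->; rewrite expr0n mul0r => -[] /esym/eqP.
by rewrite enorm_sqr mulf_eq0 sqrf_eq0 gt_eqF// gt_eqF// dotv_gt0.
Qed.

(** [T1] and [T2] need not be triangular, so their determinants are out of reach of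
    [lebesgue_rV_upper]. But [invmx T1 *m T2] is [r] times an orthogonal matrix and maps Euclidean
    balls to balls, whose volumes can be compared by means of a scalar matrix. *)
Lemma volume_preserving_scalar_det (T1 T2 : 'M[R]_n) b1 b2 (r : R) : (0 < n)%N -> 0 < r ->
  T1 \in unitmx -> T2 \in unitmx ->
  volume_preserving (affine_map T1 b1) -> volume_preserving (affine_map T2 b2) ->
  (invmx T1 *m T2) *m (invmx T1 *m T2)^T = (r ^+ 2)%:M -> r = 1.
Proof.
move=> n0 r0 T1u T2u vp1 vp2; set S := invmx T1 *m T2 => SS.
pose E := [set x : 'rV[R]_n | dotv x x <= 1].
have cE : compact E.
  apply: bounded_closed_compact.
    exists 1; split; first exact: num_real.
    move=> N N1 x /= Ex; apply: le_trans (ltW N1).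
    by rewrite -(@ler_pXn2r _ 2)// ?nnegrE// expr1n (le_trans (norm2_le_dotv x)).
  apply: (@closed_comp _ _ (fun x : 'rV[R]_n => dotv x x) [set r | r <= 1]); last exact: closed_le.
  move=> x _; have -> : (fun x : 'rV[R]_n => dotv x x) = (fun x => quad_form 1%:M (x - 0)).
    by apply/funext => y; rewrite /quad_form mulmx1 subr0.
  exact: cont_quad_form.
have bE := bounded_measurable_compact cE; have [mE _] := bE.
have VE : 0 < volume E.
  apply: volume_gt0 => //; exists 0.
  apply/nbhs_ballP; exists (n.+1%:R^-1) => /=; first by rewrite invr_gt0.
  move=> x; rewrite -ball_normE /= sub0r normrN => xn.
  rewrite /E /= (le_trans (dotv_le_norm2 _))//.
  have n10 : 0 < n.+1%:R :> R by [].
  have xn1 : `|x| * n.+1%:R <= 1 by rewrite -ler_pdivlMr// mul1r ltW.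
  have x1 : `|x| <= 1 by rewrite (le_trans _ xn1)// ler_peMr// ler1n.
  rewrite expr2 mulrA -[leRHS]mulr1 ler_pM// mulrC (le_trans _ xn1)// ler_wpM2l// ler_nat//.
have rn0 : r != 0 by rewrite gt_eqF.
have T1S : T1 *m S = T2 by rewrite /S mulmxA mulmxV// mul1mx.
pose S' := (r ^- 2) *: S^T.
have SS' : S *m S' = 1%:M.
  by rewrite /S' -scalemxAr SS -scalemx1 scalerA mulVf ?scale1r// expf_eq0.
have S'S : S' *m S = 1%:M by exact: mulmx1C.
have Snorm y : dotv (y *m S) (y *m S) = r ^+ 2 * dotv y y.
  by rewrite !dotvE trmx_mul mulmxA -(mulmxA y) SS mul_mx_scalar -scalemxAl mxE.
(* Both sides of the volume identity below are images of the unit ball [E]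
   under volume preserving maps, but the left-hand one is a ball of radius [r]. *)
pose b := b2 - b1 *m S.
pose F := affine_map (r^-1)%:M (- (r^-1 *: b)) @^-1` E.
have FE : F = affine_map T2 b2 @` (affine_map T1 b1 @^-1` E).
  apply/seteqP; split => x; rewrite /F /=.
    rewrite /E /= /affine_map mul_mx_scalar -scalerBr dotvZl dotvZr => Ex.
    pose y := (x - b) *m S'.
    exists ((y - b1) *m invmx T1).
      rewrite /= mulmxKV// subrK.
      have : r ^+ 2 * dotv y y <= r ^+ 2.
        rewrite -Snorm /y -mulmxA S'S mulmx1.
        have -> : dotv (x - b) (x - b) = r ^+ 2 * (r^-1 * (r^-1 * dotv (x - b) (x - b))) by field.
        by rewrite -[leRHS]mulr1 ler_pM2l// exprn_gt0.
      by rewrite ger_pMr// exprn_gt0.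
    rewrite -mulmxA -/S mulmxBl /y -mulmxA S'S mulmx1 /b.
    by rewrite opprB addrA [X in X + b2]addrAC addrK subrK.
  move=> [y + <-]; rewrite /E /= => Ey.
  have -> : affine_map (r^-1)%:M (- (r^-1 *: b)) (affine_map T2 b2 y) =
      r^-1 *: (affine_map T1 b1 y *m S).
    rewrite /affine_map mul_mx_scalar -scalerBr; congr (_ *: _).
    by rewrite /b opprB addrA [X in X - b2]addrAC addrK mulmxDl -mulmxA T1S.
  rewrite dotvZl dotvZr Snorm (_ : _ * _ = dotv (affine_map T1 b1 y) (affine_map T1 b1 y))//.
  by field.
have mP : measurable (affine_map T1 b1 @^-1` E) by exact: measurable_affine_preimage.
have : lebesgue_rV F = lebesgue_rV E.
  by rewrite FE vp2// -vp1// affine_image_of_preimage.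
rewrite /F lebesgue_rV_upper//; last 2 first.
- by move=> i j ji; rewrite mxE; case: eqP ji => // ->; rewrite ltnn.
- by rewrite det_scalar expf_neq0// invr_neq0.
rewrite volumeE// -EFinM => -[] /eqP.
rewrite -[X in _ == X]mul1r (inj_eq (mulIf (lt0r_neq0 VE))) det_scalar.
rewrite normrX gtr0_norm ?invr_gt0// exprVn invrK pexpr_eq1 ?(ltW r0)//.
by move/eqP.
Qed.

(** A Cholesky factor of the covariance, normalized to determinant 1, provides one admissible value
    [l]. As [get] may select any admissible [M], uniqueness is needed as well: two isotropic
    positions differ by [M / l] times an orthogonal matrix, so [M / l = 1]. *)
Lemma isotropic_moment_spec K : (0 < n)%N -> convex_body K ->
  0 < isotropic_moment K /\ isotropic_moment K ^+ (2 * n) = \det (covmx K).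
Proof.
move=> n0 [cK _ Ki].
have bK := bounded_measurable_compact cK.
have V0 : 0 < volume K by exact: volume_gt0.
have [T0 [T0u T0d T0E]] := cholesky (moment2_tr (centroid K) K)
  (fun y => @moment2_pos R n (centroid K) K y bK Ki).
have dT0 : 0 < \det T0.
  rewrite -det_tr det_trig; first by apply: prodr_gt0 => i _; rewrite mxE.
  by apply/is_trig_mxP => i j ij; rewrite mxE T0u.
(* The factor that makes the determinant of [l *: T0] equal to 1; since [T0] turns the covariance
   into the identity, [l] is also the resulting moment. *)
pose l := (\det T0) `^ (- n%:R^-1).
have l0 : 0 < l by rewrite powR_gt0.
have ln : l ^+ n * \det T0 = 1.
  rewrite -powR_mulrn ?ltW// -powRrM mulNr mulVf ?pnatr_eq0 -?lt0n//.
  by rewrite powRN powRr1 ?ltW// mulVf// gt_eqF.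
pose T1 := l *: T0.
have dT1 : \det T1 = 1 by rewrite detZ.
have T1unit : T1 \in unitmx by rewrite unitmxE dT1 unitr1.
pose b1 := - (centroid K *m T1).
have vp1 : volume_preserving (affine_map T1 b1).
  by apply: upper_volume_preserving => // i j ji; rewrite mxE T0u// mulr0.
have T1E : T1^T *m covmx K *m T1 = (l ^+ 2)%:M.
  have -> : T1^T = l *: T0^T by rewrite /T1 linearZ.
  by rewrite -!scalemxAl -scalemxAr T0E scalerA scalemx1.
have iso1 : isotropic_with (affine_map T1 b1 @` K) l by apply/isotropic_withP.
have ldet : l ^+ (2 * n) = \det (covmx K).
  have /(congr1 determinant) := T1E.
  by rewrite !det_mulmx det_tr dT1 mul1r mulr1 det_scalar -exprM => ->.
have := @getPex _ [set M : R | 0 < M /\ exists (T : 'M[R]_n) (b : 'rV[R]_n),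
    volume_preserving (affine_map T b) /\
    isotropic_with (affine_map T b @` K) M].
rewrite -/(isotropic_moment K) => /(_ _)[].
  by exists l; split => //; exists T1, b1.
move: (isotropic_moment K) => M M0 [T [b [vp iso]]].
have Tu := volume_preserving_unitmx n0 vp cK V0 M0 iso.
have [_ TE] := (isotropic_withP M Tu vp cK V0).1 iso.
suff -> : M = l by [].
pose S := invmx T1 *m T.
have ln0 : l != 0 by rewrite gt_eqF.
have SS : S^T *m S = ((M / l) ^+ 2)%:M.
  have AE : covmx K = (invmx T1)^T *m (l ^+ 2)%:M *m invmx T1.
    by rewrite -T1E !mulmxA -trmx_mul mulmxV// trmx1 mul1mx mulmxK.
  have := TE; rewrite AE mul_mx_scalar -!(scalemxAl, scalemxAr) => /(congr1 (GRing.scale (l ^- 2))).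
  rewrite scalerA mulVf ?expf_eq0// scale1r => H.
  by rewrite /S trmx_mul !mulmxA -[_ *m _ *m invmx T1]mulmxA H -[in RHS]scalemx1 -scalemx1 scalerA exprMn exprVn mulrC.
have SS' : S *m S^T = ((M / l) ^+ 2)%:M.
  have c0 : (M / l) ^+ 2 != 0 by rewrite expf_eq0/= mulf_neq0 ?invr_neq0// gt_eqF.
  have : (((M / l) ^+ 2)^-1 *: S^T) *m S = 1%:M.
    by rewrite -scalemxAl SS -scalemx1 scalerA mulVf// scale1r.
  move/mulmx1C; rewrite -scalemxAr => /(congr1 (GRing.scale ((M / l) ^+ 2))).
  by rewrite scalerA mulfV// scale1r scalemx1.
have := volume_preserving_scalar_det n0 (divr_gt0 M0 l0) T1unit Tu vp1 vp SS'.
by move/eqP; rewrite -[1](mulfV ln0) (inj_eq (mulIf _)) ?invr_neq0// => /eqP.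
Qed.

Lemma isotropy_constant_lt K K' : (0 < n)%N -> convex_body K -> convex_body K' ->
  \det (covmx K) * volume K' ^+ (n + 2) < \det (covmx K') * volume K ^+ (n + 2) ->
  isotropy_constant K < isotropy_constant K'.
Proof.
move=> n0 hK hK' H.
have [M0 ME] := isotropic_moment_spec n0 hK.
have [M0' ME'] := isotropic_moment_spec n0 hK'.
have V0 : 0 < volume K by case: hK => cK _ Ki; apply: volume_gt0 => //; exact: bounded_measurable_compact.
have V0' : 0 < volume K' by case: hK' => cK _ Ki; apply: volume_gt0 => //; exact: bounded_measurable_compact.
have pE (a : R) : 0 < a -> (a `^ ((n + 2)%:R / (2 * n)%:R)) ^+ (2 * n) = a ^+ (n + 2).
  move=> a0; rewrite -powR_mulrn ?powR_ge0// -powRrM divfK ?powR_mulrn ?ltW//.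
  by rewrite pnatr_eq0 muln_eq0 /= -lt0n.
rewrite /isotropy_constant -(@ltr_pXn2r _ (2 * n)) ?nnegrE ?divr_ge0 ?powR_ge0 ?(ltW M0) ?(ltW M0')//; last first.
  by rewrite muln_gt0.
by rewrite !exprMn !exprVn !pE// ME ME' ltr_pdivrMr ?exprn_gt0// mulrAC ltr_pdivlMr ?exprn_gt0.
Qed.

End isotropy.

(** * First variation *)

Section first_variation.
Context {R : realType} {n : nat}.
Implicit Types (D K : set 'rV[R]_n).

Local Notation "'I[ D ] g" := (\int[@lebesgue_rV R n]_(x in D) g x)
  (at level 36, D at level 200, g at level 36).

Lemma convex_body_bounded_measurable K : convex_body K -> bounded_measurable K.
Proof. by move=> [cK _ _]; exact: bounded_measurable_compact. Qed.

Lemma convex_body_volume_gt0 K : convex_body K -> 0 < volume K.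
Proof. by move=> hK; apply: volume_gt0; [exact: convex_body_bounded_measurable|case: hK]. Qed.

(* The density of the first variation of [\det (covmx K) / volume K ^+ (n + 2)],
   normalized by the value of that ratio. *)
Definition variation_density K (x : 'rV[R]_n) : R :=
  quad_form (invmx (covmx K)) (x - centroid K) - (n + 2)%:R / volume K.

Lemma cont_variation_density K : continuous (variation_density K).
Proof. by apply: contD; [exact: cont_quad_form|exact: cont_cst]. Qed.

(** The sign [s] is 1 when [D] is added and -1 when it is removed; the hypothesis on integrals
    expresses both. That [C] and [r0] depend on [K] and [rho] alone permits [D] to shrink. *)
Lemma isotropy_constant_variation K (rho : R) : (0 < n)%N -> convex_body K ->
  exists C : R, exists2 r0 : R, 0 < r0 & forall K' D (s : R), convex_body K' ->
    bounded_measurable D -> (forall x, D x -> `|x| <= rho) -> `|s| = 1 ->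
    (forall g : 'rV[R]_n -> R, continuous g -> 'I[K'] g = 'I[K] g + s * 'I[D] g) ->
    volume D <= r0 -> C * volume D ^+ 2 < s * 'I[D] (variation_density K) ->
    isotropy_constant K < isotropy_constant K'.
Proof.
move=> n0 hK; have bK := convex_body_bounded_measurable hK.
have V0 := convex_body_volume_gt0 hK.
have Ki : K° !=set0 by case: hK.
pose c := centroid K; pose A := covmx K.
have A0 : 0 < \det A by exact: moment2_det_gt0.
have Au : A \in unitmx by rewrite unitmxE unitfE gt_eqF.
pose w : R := `|rho| + `|c|.
have w0 : 0 <= w by rewrite addr_ge0.
(* On [D] the integrands of volume, first and second moments are at most 1, [w] and [w ^+ 2]. *)
pose W : R := 1 + w + w ^+ 2.
have W0 : 0 < W by rewrite ltr_wpDr ?sqr_ge0// ltr_wpDr.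
have [C [r0 r00 HC]] := det_ratio_increase Au A0 V0 W0.
exists C; exists r0 => // K' D s hK' bD Drho s1 HI Dr0 HCD.
apply: isotropy_constant_lt => //.
have bK' := convex_body_bounded_measurable hK'.
have V0' := convex_body_volume_gt0 hK'.
have VE : volume K' = volume K + s * volume D.
  by have := HI _ (@cont_cst R 'rV[R]_n 1); rewrite !rint_cst// !mul1r.
have m1E : moment1 c K' = s *: moment1 c D.
  apply/rowP => i; have := HI _ (@cont_coordB R n c i).
  have /rowP/(_ i) := moment1_centroid bK (lt0r_neq0 V0).
  by rewrite !mxE => ->; rewrite add0r.
pose dS := s *: moment2 c D.
have m2E : moment2 c K' = A + dS.
  by apply/matrixP => i j; have := HI _ (@cont_coordB2 R n c i j); rewrite !mxE.
have cov' : covmx K' = A + dS - (volume K + s * volume D)^-1 *: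
    ((moment1 c K')^T *m moment1 c K').
  by rewrite (covmxE c)// ?gt_eqF// m2E VE.
have xw x i : D x -> `|x ord0 i - c ord0 i| <= w.
  move=> Dx; rewrite (le_trans (ler_normB _ _))// lerD ?coord_le_norm//.
  by rewrite (le_trans (coord_le_norm _ _))// (le_trans (Drho _ Dx)) ?ler_norm.
have vD0 := volume_ge0 D.
have [] := HC (s * volume D) (moment1 c K') dS (volume D).
- by rewrite vD0.
- by rewrite normrM s1 mul1r ger0_norm// ler_peMl//; rewrite /W; have := sqr_ge0 w; lra.
- move=> i; rewrite m1E mxE normrM s1 mul1r mxE.
  apply: (le_trans (rint_abs_le (@cont_coordB R n c i) bD (fun x Dx => xw x i Dx))).
  by rewrite ler_wpM2r//; rewrite /W; have := sqr_ge0 w; lra.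
- move=> i j; rewrite mxE normrM s1 mul1r mxE.
  apply: (le_trans (@rint_abs_le _ _ D _ (w ^+ 2) (@cont_coordB2 R n c i j) bD _)).
    by move=> x Dx; rewrite normrM expr2 ler_pM// xw.
  by rewrite ler_wpM2r//; rewrite /W; lra.
- apply: (lt_le_trans HCD); rewrite /variation_density rintB//; last first.
  + exact: cont_cst.
  + exact: cont_quad_form.
  rewrite rint_cst// rint_quad_form// mulrBr le_eqVlt; apply/orP; left; apply/eqP.
  congr (_ - _); last by ring.
  rewrite /dS -scalemxAr linearZ /=; congr (_ * _).
  apply: eq_bigr => i _; rewrite mxE; apply: eq_bigr => j _.
  by rewrite -[in LHS](moment2_tr c D) mxE.
by rewrite -VE => _; rewrite cov' -VE; apply.
Qed.

End first_variation.

(** * Quadratic forms and convex sets *)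

Section quadratic_forms.
Context {R : realType} {n : nat}.
Implicit Types (u v : 'rV[R]_n) (Q : 'M[R]_n).

Definition bilin Q u v : R := dotv (u *m Q) v.

Lemma quad_form_bilin Q u : quad_form Q u = bilin Q u u.
Proof. by []. Qed.

Lemma bilinDl Q u v w : bilin Q (u + v) w = bilin Q u w + bilin Q v w.
Proof. by rewrite /bilin mulmxDl dotvDl. Qed.

Lemma bilinDr Q u v w : bilin Q w (u + v) = bilin Q w u + bilin Q w v.
Proof. by rewrite /bilin dotvDr. Qed.

Lemma bilinZl Q a u v : bilin Q (a *: u) v = a * bilin Q u v.
Proof. by rewrite /bilin -scalemxAl dotvZl. Qed.

Lemma bilinZr Q a u v : bilin Q u (a *: v) = a * bilin Q u v.
Proof. by rewrite /bilin dotvZr. Qed.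

Lemma bilinNr Q u v : bilin Q u (- v) = - bilin Q u v.
Proof. by rewrite -scaleN1r bilinZr mulN1r. Qed.

Lemma bilin0l Q u : bilin Q 0 u = 0.
Proof. by rewrite -(scale0r u) bilinZl mul0r. Qed.

Lemma bilinC Q u v : Q^T = Q -> bilin Q u v = bilin Q v u.
Proof.
move=> QT; rewrite /bilin [RHS]dotvC !dotvE.
by rewrite trmx_mul QT mulmxA.
Qed.

Lemma quad_form0 Q : quad_form Q 0 = 0.
Proof. by rewrite quad_form_bilin bilin0l. Qed.

Lemma quad_formZ Q a u : quad_form Q (a *: u) = a ^+ 2 * quad_form Q u.
Proof. by rewrite !quad_form_bilin bilinZl bilinZr mulrA. Qed.

Lemma quad_formN Q u : quad_form Q (- u) = quad_form Q u.
Proof. by rewrite -scaleN1r quad_formZ sqrrN expr1n mul1r. Qed.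

Lemma quad_formD Q u v : Q^T = Q ->
  quad_form Q (u + v) = quad_form Q u + 2 * bilin Q u v + quad_form Q v.
Proof.
by move=> QT; rewrite !quad_form_bilin bilinDl !bilinDr (bilinC v u QT); ring.
Qed.

Lemma quad_formB Q u v : Q^T = Q ->
  quad_form Q (u - v) = quad_form Q u - 2 * bilin Q u v + quad_form Q v.
Proof. by move=> QT; rewrite quad_formD// bilinNr quad_formN; ring. Qed.

Lemma quad_form_conv Q u v (l : R) : Q^T = Q ->
  quad_form Q ((1 - l) *: u + l *: v) =
  (1 - l) * quad_form Q u + l * quad_form Q v - l * (1 - l) * quad_form Q (u - v).
Proof.
move=> QT; rewrite (quad_formB u v QT) quad_formD// !quad_formZ bilinZl bilinZr; ring.
Qed.

Lemma bilin_bound Q : exists2 L : R, 0 < L & forall u v, `|bilin Q u v| <= L * (`|u| * `|v|).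
Proof.
have [a a0 Qa] := mx_entries_bounded Q.
exists (n%:R * (n%:R * a) + 1); first by rewrite ltr_wpDl// !mulr_ge0.
move=> u v; rewrite (le_trans (normr_dotv_le _ _))// [leRHS]mulrA ler_wpM2r//.
have H : `|u *m Q| <= n%:R * a * `|u|.
  apply/rV_norm_leP => [|i]; first by rewrite !mulr_ge0.
  rewrite mxE (le_trans (ler_norm_sum _ _ _))//.
  have -> : n%:R * a * `|u| = \sum_(k < n) `|u| * a by rewrite sumr_const card_ord -mulrA mulr_natl mulrC.
  by apply: ler_sum => k _; rewrite normrM ler_pM// coord_le_norm.
have : n%:R * `|u *m Q| <= n%:R * (n%:R * a * `|u|) by rewrite ler_wpM2l.
by have := normr_ge0 u; rewrite mulrDl mul1r -!mulrA; lra.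
Qed.

(** By homogeneity, [m] can be the minimum of the form on the compact unit sphere of the
    hyperplane. *)
Lemma quad_form_coercive Q N : (forall u, orthv N u -> u != 0 -> 0 < quad_form Q u) ->
  exists2 m : R, 0 < m & forall u, orthv N u -> m * `|u| ^+ 2 <= quad_form Q u.
Proof.
move=> Qpos.
pose A := [set u : 'rV[R]_n | `|u| = 1 /\ dotv u N = 0].
have cq : continuous (quad_form Q : 'rV[R]_n -> R).
  by have := @cont_quad_form R n 0 Q; under eq_fun do rewrite subr0.
(* There is no minimum to take when the hyperplane is reduced to 0. *)
have [A0|/set0P A0] := eqVneq A set0.
  exists 1 => // u uN; have [->|u0] := eqVneq u 0; first by rewrite normr0 quad_form0 expr0n mulr0.
  suff : A (`|u|^-1 *: u) by rewrite A0.
  split; last by rewrite dotvZl uN mulr0.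
  by rewrite normrZ normfV normr_id mulVf// normr_eq0.
have cA : compact A.
  apply: bounded_closed_compact.
    exists 1; split; first exact: num_real.
    by move=> M M1 u [u1 _] /=; rewrite u1 ltW.
  apply: closedI.
    apply: (@closed_comp _ _ (fun u : 'rV[R]_n => `|u|) [set y | y = 1]); last exact: closed_eq.
    by move=> ? _; exact: norm_continuous.
  apply: (@closed_comp _ _ (fun u : 'rV[R]_n => dotv u N) [set y | y = 0]); last exact: closed_eq.
  by move=> ? _; exact: continuous_dotv.
have [u0 + Hu0] := @EVT_min_rV R n (quad_form Q) A A0 cA (continuous_subspaceT cq).
move=> /set_mem [u01 u0N].
exists (quad_form Q u0).
  by apply: Qpos => //; rewrite -normr_eq0 u01 oner_eq0.
move=> u uN; have [->|un0] := eqVneq u 0; first by rewrite normr0 quad_form0 expr0n mulr0.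
have nu0 : `|u| != 0 by rewrite normr_eq0.
have : quad_form Q u0 <= quad_form Q (`|u|^-1 *: u).
  apply: Hu0; apply/mem_set; split; last by rewrite dotvZl uN mulr0.
  by rewrite normrZ normfV normr_id mulVf.
by rewrite quad_formZ exprVn ler_pdivlMl ?exprn_gt0 ?normr_gt0// mulrC.
Qed.

End quadratic_forms.

Section convexity.
Context {R : realType} {n : nat}.
Implicit Types (K : set 'rV[R]_n) (x y : 'rV[R]_n).

Lemma convex_setP K : convex_set K <->
  forall x y (l : R), 0 <= l <= 1 -> K x -> K y -> K ((1 - l) *: x + l *: y).
Proof.
split.
  move=> cK x y l l01 Kx Ky.
  have := @cK y x (Itv01 (andP l01).1 (andP l01).2) (mem_set Ky) (mem_set Kx).
  by move=> /set_mem; rewrite addrC.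
move=> cK x y l /set_mem Kx /set_mem Ky; apply/mem_set.
have := cK y x l%:num _ Ky Kx; rewrite addrC; apply.
by apply/andP; split.
Qed.

(** The last point of the segment that belongs to [K] is not interior, since otherwise the segment
    would stay in [K] a little longer. *)
Lemma boundary_segment K x y : closed K -> K x -> ~ K y ->
  exists2 l : R, 0 <= l < 1 & boundary K ((1 - l) *: x + l *: y).
Proof.
move=> clK Kx nKy.
pose f (l : R) : 'rV[R]_n := (1 - l) *: x + l *: y.
have cf : continuous f.
  apply: continuous_rVP => i.
  have -> : (fun l => f l ord0 i) = (fun l => x ord0 i + l * (y ord0 i - x ord0 i)).
    by apply/funext => l; rewrite !mxE; ring.
  by apply: contD; [exact: cont_cst|apply: contM; [move=> ?|exact: cont_cst]].
pose A := [set` `[0, 1 : R]] `&` (f @^-1` K).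
have cA : compact A.
  apply: compact_closedI; first exact: segment_compact.
  by apply: closed_comp => // l _; exact: cf.
have A0 : A !=set0.
  exists 0; split; first by rewrite /= in_itv /= lexx ler01.
  by rewrite /f /= subr0 scale1r scale0r addr0.
have cid : continuous (@id R) by move=> ?.
have [l] := @compact_EVT_max _ R id A A0 cA (continuous_subspaceT cid).
move=> /set_mem [/= + Kl] lmax; rewrite in_itv /= => /andP[l0 l1].
have l1' : l < 1.
  rewrite lt_neqAle l1 andbT; apply/eqP => le1; apply: nKy.
  by move: Kl; rewrite /f le1 subrr scale0r add0r scale1r.
exists l; first by rewrite l0.
split; first exact: subset_closure.
move=> /nbhs_ballP[e /= e0 eK].
pose d := Num.min (1 - l) (e / 2 / (1 + `|y - x|)).
have yx0 : 0 < 1 + `|y - x| by rewrite ltr_pwDl.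
have d0 : 0 < d by rewrite lt_min subr_gt0 l1' !divr_gt0.
have : l + d <= l.
  apply: lmax; apply/mem_set; split.
    rewrite /= in_itv /= addr_ge0 ?(ltW d0)//=.
    have : d <= 1 - l by rewrite ge_min lexx.
    by lra.
  apply: eK; rewrite -ball_normE /=.
  have -> : (1 - l) *: x + l *: y - f (l + d) = d *: (x - y).
    by apply/rowP => i; rewrite !mxE; ring.
  rewrite normrZ gtr0_norm// distrC.
  apply: (@le_lt_trans _ _ (e / 2)); last by lra.
  apply: (@le_trans _ _ (d * (1 + `|y - x|))); first by rewrite ler_pM2l// lerDr.
  by rewrite -ler_pdivlMr// ge_min lexx orbT.
by lra.
Qed.

End convexity.

(** * Distances between bodies *)

Section distances.
Context {R : realType} {n : nat}.
Implicit Types (K : set 'rV[R]_n) (x y : 'rV[R]_n).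

(** The hypotheses place [K'] between the homothetic copies of [K] about [P] of ratios [1 - s] and
    [1 + s]. This handles both distances at once: points move by at most [s * C], and the ratio of
    the copies is [(1 + s) / (1 - s)]. *)
Lemma dist_sandwich K P (d : set 'rV[R]_n -> set 'rV[R]_n -> R) (e : R) :
  d = @hausdorff_dist R n \/ d = @banach_mazur_dist R n ->
  convex_body K -> K P -> 0 < e ->
  exists2 s0 : R, 0 < s0 & forall (s : R) K', 0 <= s <= s0 ->
    (forall x, K x -> K' ((1 - s) *: x + s *: P)) ->
    (forall x, K' x -> exists2 y, K y & x = (1 + s) *: y - s *: P) ->
    d K' K < e.
Proof.
move=> hd [cK _ _] KP e0.
have [_ [rho Krho]] := bounded_measurable_compact cK.
have rho0 : 0 <= rho by rewrite (le_trans _ (Krho _ KP)).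
pose C : R := n%:R * (2 * rho).
have C0 : 0 <= C by rewrite !mulr_ge0.
(* The first two bounds give [2 * s / (1 - s) <= 4 * s < e] for the Banach-Mazur distance, the third
   [s * C < e] for the Hausdorff distance. *)
exists (Num.min (1 / 2) (Num.min (e / 8) (e / 2 / (1 + C)))).
  by rewrite !lt_min !divr_gt0//; lra.
move=> s K' /andP[s0]; rewrite !le_min => /and3P[s1 s2 s3] KK' K'K.
have sC : s * C < e.
  have : s * (1 + C) <= e / 2 by rewrite -ler_pdivlMr//; lra.
  by rewrite mulrDr mulr1; lra.
have yP y : K y -> enorm (s *: (y - P)) <= s * C.
  move=> Ky; rewrite (le_trans (enorm_le_norm _))// normrZ ger0_norm// mulrCA ler_wpM2l//.
  rewrite /C ler_wpM2l// (le_trans (ler_normB _ _))// mulr2n mulrDl !mul1r.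
  by rewrite lerD// Krho.
have eN x : enorm (- x) = enorm x by rewrite /enorm dotvNl dotvNr opprK.
case: hd => ->.
  apply: le_lt_trans sC; apply: ge_inf; first by exists 0 => r [].
  split; first by rewrite mulr_ge0.
    move=> x /K'K[y Ky ->]; exists y => //; rewrite /eball /=.
    have -> : (1 + s) *: y - s *: P - y = s *: (y - P).
      by apply/rowP => i; rewrite !mxE; ring.
    exact: yP.
  move=> y Ky; exists ((1 - s) *: y + s *: P); first exact: KK'.
  rewrite /eball /=.
  have -> : y - ((1 - s) *: y + s *: P) = s *: (y - P).
    by apply/rowP => i; rewrite !mxE; ring.
  exact: yP.
have s1' : 0 < 1 - s by lra.
have sn0 : 1 - s != 0 by rewrite gt_eqF.
pose l := (1 + s) / (1 - s).
have l1 : 1 <= l by rewrite ler_pdivlMr//; lra.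
rewrite /banach_mazur_dist; set S := (X in inf X).
have Sl : S l.
  split => //; exists P, P, ((1 - s)^-1)%:M; split.
  - by rewrite unitmxE det_scalar unitrX// unitfE invr_eq0.
  - move=> _ [z Kz <-]; exists ((1 - s) *: z + s *: P); first exact: KK'.
    rewrite mul_mx_scalar; apply/rowP => i; rewrite !mxE; field; exact: sn0.
  - move=> _ [_ /K'K[y Ky ->] <-]; exists y => //.
    rewrite mul_mx_scalar /l; apply/rowP => i; rewrite !mxE; field; exact: sn0.
have S1 : lbound S 1 by move=> r [].
have infS1 : 1 <= inf S by apply: lb_le_inf => //; exists l.
have infSl : inf S <= l by apply: ge_inf => //; exists 1.
apply: (@le_lt_trans _ _ (l - 1)); last first.
  have -> : l - 1 = 2 * s / (1 - s) by rewrite /l; field; exact: sn0.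
  by rewrite ltr_pdivrMr//; nra.
(* The logarithm is bounded by [inf S - 1]. *)
have H := @le_ln1Dx R (inf S - 1).
rewrite [1 + _]addrC subrK in H; apply: (@le_trans _ _ (inf S - 1)); last by lra.
by apply: H; lra.
Qed.

Lemma convex_body_interior_ball K : convex_body K -> exists P : 'rV[R]_n,
  exists2 r : R, 0 < r & forall x, `|x - P| <= r -> K x.
Proof.
move=> [_ _ [P /nbhs_ballP[e /= e0 PeK]]]; exists P, (e / 2); first by rewrite divr_gt0.
by move=> x xP; apply: PeK; rewrite -ball_normE /= distrC; lra.
Qed.

End distances.

(** * Contact with paraboloids *)

Section curvature.
Context {R : realType} {n : nat}.
Implicit Types (K : set 'rV[R]_n) (X N Y x : 'rV[R]_n).

Definition frame_pt X N Y (y : R) : 'rV[R]_n := X + Y + y *: N.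

Lemma frame_pt_dot X N Y y : orthv N Y -> dotv N N = 1 -> dotv (frame_pt X N Y y - X) N = y.
Proof.
move=> YN N1; have -> : frame_pt X N Y y - X = Y + y *: N.
  by apply/rowP => i; rewrite !mxE; ring.
by rewrite dotvDl dotvZl YN N1 add0r mulr1.
Qed.

Lemma frame_ptP X N x : dotv N N = 1 -> exists Y, exists2 y, orthv N Y & x = frame_pt X N Y y.
Proof.
move=> N1; exists (x - X - dotv (x - X) N *: N), (dotv (x - X) N).
  by rewrite /orthv /= (dotvBl (x - X)) dotvZl N1 mulr1 subrr.
by apply/rowP => i; rewrite !mxE; ring.
Qed.

Lemma frame_pt_conv X N Y1 Y2 (y1 y2 l : R) :
  (1 - l) *: frame_pt X N Y1 y1 + l *: frame_pt X N Y2 y2 =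
  frame_pt X N ((1 - l) *: Y1 + l *: Y2) ((1 - l) * y1 + l * y2).
Proof. by apply/rowP => i; rewrite !mxE; ring. Qed.

Lemma frame_pt_conv0 X N Y (y l : R) :
  (1 - l) *: X + l *: frame_pt X N Y y = frame_pt X N (l *: Y) (l * y).
Proof. by apply/rowP => i; rewrite !mxE; ring. Qed.

Lemma orthvD N Y1 Y2 : orthv N Y1 -> orthv N Y2 -> orthv N (Y1 + Y2).
Proof. by rewrite /orthv /= dotvDl => -> ->; rewrite addr0. Qed.

Lemma orthvZ N a Y : orthv N Y -> orthv N (a *: Y).
Proof. by rewrite /orthv /= dotvZl => ->; rewrite mulr0. Qed.

Lemma orthvN N Y : orthv N Y -> orthv N (- Y).
Proof. by rewrite -scaleN1r; exact: orthvZ. Qed.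

Lemma orthvB N Y1 Y2 : orthv N Y1 -> orthv N Y2 -> orthv N (Y1 - Y2).
Proof. by move=> h1 h2; apply: orthvD => //; exact: orthvN. Qed.

Lemma orthv0 N : orthv N 0.
Proof. exact: dotv0l. Qed.

Lemma unit_norm_le1 N : dotv N N = 1 -> `|N| <= 1.
Proof. by move=> N1; rewrite -(@ler_pXn2r _ 2)// ?nnegrE// expr1n -N1 norm2_le_dotv. Qed.

Lemma frame_pt_norm X N Y y : dotv N N = 1 -> `|frame_pt X N Y y - X| <= `|Y| + `|y|.
Proof.
move=> N1; have -> : frame_pt X N Y y - X = Y + y *: N.
  by apply/rowP => i; rewrite !mxE; ring.
rewrite (le_trans (ler_normD _ _))// lerD2l normrZ ler_piMr//.
exact: unit_norm_le1.
Qed.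

Lemma frame_pt_norm_y X N Y y : orthv N Y -> dotv N N = 1 ->
  `|y| <= n%:R * `|frame_pt X N Y y - X|.
Proof.
move=> YN N1; rewrite -{1}(frame_pt_dot X y YN N1) (le_trans (normr_dotv_le _ _))//.
by rewrite ler_piMr ?mulr_ge0//; exact: unit_norm_le1.
Qed.

Lemma frame_pt_norm_Y X N Y y : orthv N Y -> dotv N N = 1 ->
  `|Y| <= (n%:R + 1) * `|frame_pt X N Y y - X|.
Proof.
move=> YN N1; have YE : Y = (frame_pt X N Y y - X) - y *: N.
  by apply/rowP => i; rewrite !mxE; ring.
rewrite {1}YE (le_trans (ler_normB _ _))// mulrDl mul1r addrC.
rewrite lerD2r normrZ (le_trans _ (frame_pt_norm_y X y YN N1))//.
by rewrite ler_piMr//; exact: unit_norm_le1.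
Qed.

(* What is used of a point of positive generalized curvature: near [X], and in
   the frame given by the inner normal [N], the body is squeezed between two
   paraboloids arbitrarily close to [y = quad_form Q Y]. *)
Record paraboloid_contact K X N (Q : 'M[R]_n) : Prop := ParaboloidContact {
  contact_unit : dotv N N = 1;
  contact_sym : Q^T = Q;
  contact_pos : forall Y, orthv N Y -> Y != 0 -> 0 < quad_form Q Y;
  contact_mem : K X;
  contact_ge0 : forall Y y, orthv N Y -> K (frame_pt X N Y y) -> 0 <= y;
  contact_near : forall e : R, 0 < e < 1 -> exists2 a : R, 0 < a &
    forall Y y, orthv N Y -> `|Y| <= a -> `|y| <= a ->
      (K (frame_pt X N Y y) -> (1 - e) * quad_form Q Y <= y) /\
      ((1 + e) * quad_form Q Y <= y -> K (frame_pt X N Y y));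
  contact_local : forall a : R, 0 < a -> exists2 h : R, 0 < h &
    forall Y y, orthv N Y -> K (frame_pt X N Y y) -> y < h -> `|Y| <= a /\ `|y| <= a }.

(** The definition of curvature speaks of boundary points only. Membership in [K] is deduced by
    joining a point of [K] to a point outside and applying the estimate where the segment crosses
    the boundary. *)
Lemma positive_curvature_contact K X : convex_body K -> boundary K X ->
  positive_generalized_curvature K X -> exists N Q, paraboloid_contact K X N Q.
Proof.
move=> hK [cKX _] [N [Q [[enN Nin] QT Qpos Qcurv]]]; exists N, Q.
have [cK /convex_setP convK _] := hK.
have clK : closed K by apply: compact_closed => //; exact: norm_hausdorff.
have KX : K X by exact: clK.
have N1 : dotv N N = 1 by rewrite -enorm_sqr enN expr1n.
have ge0 Y y : orthv N Y -> K (frame_pt X N Y y) -> 0 <= y.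
  by move=> YN /Nin; rewrite frame_pt_dot.
have q0 Y : orthv N Y -> 0 <= quad_form Q Y.
  by move=> YN; have [->|/(Qpos _ YN)/ltW//] := eqVneq Y 0; rewrite quad_form0.
(* A point of [K] strictly above the tangent hyperplane: move from the centre of an inscribed ball
   by its radius along [N]. *)
have [Y1 [y1 [YN1 y10 KY1]]] : exists Y1, exists y1, [/\ orthv N Y1, 0 < y1 & K (frame_pt X N Y1 y1)].
  have [P [r r0 Pr]] := convex_body_interior_ball hK.
  have [Y [y YN PE]] := frame_ptP X P N1.
  exists Y, (y + r); split => //.
    have : 0 <= y - r; last by lra.
    apply: (ge0 Y) => //; apply: Pr; rewrite PE.
    have -> : frame_pt X N Y (y - r) - frame_pt X N Y y = (- r) *: N.
      by apply/rowP => i; rewrite !mxE; ring.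
    by rewrite normrZ normrN gtr0_norm// ler_piMr ?(ltW r0)//; exact: unit_norm_le1.
  apply: Pr; rewrite PE.
  have -> : frame_pt X N Y (y + r) - frame_pt X N Y y = r *: N.
    by apply/rowP => i; rewrite !mxE; ring.
  by rewrite normrZ gtr0_norm// ler_piMr ?(ltW r0)//; exact: unit_norm_le1.
have near e : 0 < e < 1 -> exists2 a : R, 0 < a &
    forall Y y, orthv N Y -> `|Y| <= a -> `|y| <= a ->
      (K (frame_pt X N Y y) -> (1 - e) * quad_form Q Y <= y) /\
      ((1 + e) * quad_form Q Y <= y -> K (frame_pt X N Y y)).
  move=> /andP[e0 e1]; have [a a0 Ha] := Qcurv _ e0.
  (* Converts the Euclidean radius [a] into a bound on the sup norms of both components. *)
  pose b := a / (2 * n%:R + 1).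
  have n20 : 0 < 2 * n%:R + 1 :> R by rewrite ltr_wpDl// mulr_ge0.
  have b0 : 0 < b by rewrite divr_gt0.
  have Hb Y y : orthv N Y -> `|Y| <= b -> `|y| <= b -> boundary K (frame_pt X N Y y) ->
      (1 - e) * quad_form Q Y <= y <= (1 + e) * quad_form Q Y.
    move=> YN Yb yb bd; apply: Ha => //; split => //.
    rewrite /eball /= (le_trans (enorm_le_norm _))//.
    apply: (@le_trans _ _ (n%:R * (2 * b))).
      rewrite ler_wpM2l// (le_trans (frame_pt_norm _ _ _ N1))//; lra.
    rewrite /b; have : (2 * n%:R + 1) * (a / (2 * n%:R + 1)) = a by field; lra.
    by move: b0; rewrite /b; move: (a / _) => c; lra.
  exists b => // Y y YN Yb yb; split => [KY|qy].
    have y0 := ge0 _ _ YN KY.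
    (* Descending along [N] from a point of [K] leaves [K] at a height between 0 and [y], where the
       lower estimate applies. *)
    have nK : ~ K (frame_pt X N Y (-1)) by move=> /(ge0 _ _ YN); lra.
    have [l /andP[l0 l1]] := boundary_segment clK KY nK.
    rewrite frame_pt_conv -scalerDl subrK scale1r => bd.
    have Kl : 0 <= (1 - l) * y + l * -1 by apply: (ge0 Y) => //; apply: clK; case: bd.
    have ly : 0 <= l * y by rewrite mulr_ge0.
    have /andP[+ _] : (1 - e) * quad_form Q Y <= (1 - l) * y + l * -1 <= (1 + e) * quad_form Q Y.
      apply: Hb => //; rewrite ger0_norm//.
      by move: yb; rewrite ger0_norm//; lra.
    by lra.
  (* Suppose the point is outside [K]. A small multiple of [(Y1, y1)] lies in [K] and strictly above
     the upper paraboloid. The region above that paraboloid is convex, so the crossing point of the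
     segment between the two lies strictly above it too, against the estimate on the boundary. *)
  apply: contrapT => nK.
  have [M HM] : exists M : R, M = 1 + `|Y1| + y1 + (1 + e) * quad_form Q Y1 by eexists.
  have q1 := q0 _ YN1.
  have eq1 : 0 <= (1 + e) * quad_form Q Y1 by rewrite mulr_ge0//; lra.
  have M1 : 1 <= M by have := normr_ge0 Y1; lra.
  (* In turn: the point is in [K] by convexity, it is within range of the estimate, and its height
     of order [t] exceeds the form of order [t ^ 2]. *)
  pose t := Num.min 1 (Num.min (b / M) (y1 / (2 * M))).
  have t0 : 0 < t by rewrite !lt_min !divr_gt0//; lra.
  have t1 : t <= 1 by rewrite ge_min lexx.
  have tb : t * M <= b by rewrite -ler_pdivlMr; [rewrite !ge_min lexx orbT|lra].
  have ty : t * M < y1.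
    have : t * (2 * M) <= y1 by rewrite -ler_pdivlMr; [rewrite !ge_min lexx !orbT|lra].
    have : 0 < t * M by rewrite mulr_gt0//; lra.
    by lra.
  have KtY : K (frame_pt X N (t *: Y1) (t * y1)).
    by rewrite -frame_pt_conv0; apply: convK => //; rewrite (ltW t0).
  have [l /andP[l0 l1]] := boundary_segment clK KtY nK.
  rewrite frame_pt_conv; set Z := _ + _; set z := _ + _ => bd.
  have ZN : orthv N Z by apply: orthvD; apply: orthvZ => //; exact: orthvZ.
  have conv_le (u v : R) : u <= b -> v <= b -> (1 - l) * u + l * v <= b.
    move=> ub vb; have : 0 <= (1 - l) * (b - u) + l * (b - v).
      by rewrite addr_ge0// mulr_ge0// subr_ge0// ltW.
    by clear; lra.
  have Zb : `|Z| <= b.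
    rewrite (le_trans (ler_normD _ _))// normrZ [`|l *: _|]normrZ (ger0_norm l0).
    rewrite ger0_norm; last lra.
    apply: conv_le => //; rewrite normrZ gtr0_norm//.
    by rewrite (le_trans _ tb)// ler_wpM2l ?ltW//; have := normr_ge0 Y1; lra.
  have zb : `|z| <= b.
    rewrite (le_trans (ler_normD _ _))// normrM [`|l * _|]normrM (ger0_norm l0).
    rewrite ger0_norm; last lra.
    apply: conv_le => //; rewrite gtr0_norm ?mulr_gt0//.
    by rewrite (le_trans _ tb)// ler_wpM2l ?ltW//; have := normr_ge0 Y1; lra.
  have /andP[_] := Hb _ _ ZN Zb zb bd.
  apply/negP; rewrite -ltNge /Z /z quad_form_conv// quad_formZ.
  have quv : 0 <= quad_form Q (t *: Y1 - Y) by apply: q0; apply: orthvB => //; exact: orthvZ.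
  have H1 : 0 <= (1 + e) * (l * (1 - l) * quad_form Q (t *: Y1 - Y)).
    by rewrite !mulr_ge0// ?subr_ge0 ?addr_ge0 ?(ltW l1) ?(ltW e0).
  have H2 : l * ((1 + e) * quad_form Q Y) <= l * y by rewrite ler_wpM2l.
  have H3 : (1 - l) * (t * (t * ((1 + e) * quad_form Q Y1))) < (1 - l) * (t * y1).
    rewrite ltr_pM2l; last by rewrite subr_gt0.
    rewrite ltr_pM2l// (le_lt_trans _ ty)// ler_wpM2l ?ltW//.
    by have := normr_ge0 Y1; lra.
  apply: (@lt_le_trans _ _ ((1 - l) * (t * y1) + l * ((1 + e) * quad_form Q Y))); last lra.
  have -> : (1 + e) * ((1 - l) * (t ^+ 2 * quad_form Q Y1) + l * quad_form Q Y -
      l * (1 - l) * quad_form Q (t *: Y1 - Y)) =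
    (1 - l) * (t * (t * ((1 + e) * quad_form Q Y1))) + l * ((1 + e) * quad_form Q Y)
     - (1 + e) * (l * (1 - l) * quad_form Q (t *: Y1 - Y)) by ring.
  by move: H1 H2 H3; move: (_ * (_ * (_ * (_ * _)))) => u1; lra.
split => // a a0.
have h12 : 0 < (1 / 2 : R) < 1 by lra.
have [b b0 Hb] := near _ h12.
have [m m0 Hm] := quad_form_coercive Qpos.
pose c := Num.min a b.
have c0 : 0 < c by rewrite lt_min a0.
have ca : c <= a by rewrite ge_min lexx.
have cb : c <= b by rewrite ge_min lexx orbT.
pose h := Num.min c (m * c ^+ 2 / 2).
have h0 : 0 < h by rewrite lt_min c0 divr_gt0// mulr_gt0// exprn_gt0.
have hc : h <= c by rewrite ge_min lexx.
have hm : h <= m * c ^+ 2 / 2 by rewrite ge_min lexx orbT.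
exists h => // Y y YN KY yh.
have y0 := ge0 _ _ YN KY.
rewrite (ger0_norm y0); split; last by lra.
have [Yc|Yc] := leP `|Y| c; first exact: le_trans ca.
have Y0 : 0 < `|Y| by lra.
(* Were [Y] long, the point shrunk towards [X] until its horizontal part has norm [c] would still be
   in [K], and the lower paraboloid with [e = 1 / 2] would force its height to be at least
   [m * c ^+ 2 / 2 >= h]. *)
pose l := c / `|Y|.
have l0 : 0 < l by rewrite divr_gt0.
have l1 : l <= 1 by rewrite ler_pdivrMr//; lra.
have lY : `|l *: Y| = c by rewrite normrZ gtr0_norm// divfK// gt_eqF.
have ly : l * y <= y by rewrite ler_piMl.
have ly0 : 0 <= l * y by rewrite mulr_ge0// ltW.
have lYb : `|l *: Y| <= b by rewrite lY.
have lyb : `|l * y| <= b by rewrite ger0_norm//; lra.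
have [+ _] := Hb _ _ (orthvZ l YN) lYb lyb.
rewrite -frame_pt_conv0 => H.
have l01 : 0 <= l <= 1 by rewrite (ltW l0).
have H1 := H (convK _ _ _ l01 KX KY).
have := Hm (l *: Y) (orthvZ l YN); rewrite lY => H2.
by move: H1 H2 ly hm yh; clear; lra.
Qed.

End curvature.

(** * Perturbation principles *)

Section perturbation_principles.
Context {R : realType} {n : nat}.
Implicit Types (K D : set 'rV[R]_n) (x p : 'rV[R]_n).

Local Notation "'I[ D ] g" := (\int[@lebesgue_rV R n]_(x in D) g x)
  (at level 36, D at level 200, g at level 36).

(** The boolean [sym] lets one argument serve both statements. *)
Definition locally_maximal (sym : bool) (d : set 'rV[R]_n -> set 'rV[R]_n -> R) K :=
  exists2 e : R, 0 < e & forall K', convex_body K' -> (sym -> centrally_symmetric K') ->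
    d K' K < e -> isotropy_constant K' <= isotropy_constant K.

Lemma centrally_symmetricP K : centrally_symmetric K <-> forall x, K x -> K (- x).
Proof.
split; first by move=> KE x Kx; rewrite KE; exists x.
move=> H; apply/seteqP; split => x /=; last by move=> [y Ky <-]; exact: H.
by move=> Kx; exists (- x); rewrite ?opprK//; exact: H.
Qed.

(** [P] is the centre of the homotheties that compare bodies, so it has to be 0 in the symmetric
    case. Averaging a ball in [K] with its mirror image produces a ball about 0. *)
Lemma symmetric_center (sym : bool) K : convex_body K -> (sym -> centrally_symmetric K) ->
  exists P : 'rV[R]_n, exists2 r : R, 0 < r &
    (sym -> P = 0) /\ forall x, `|x - P| <= r -> K x.
Proof.
move=> hK; have [P [r r0 Pr]] := convex_body_interior_ball hK.
have [_ /convex_setP convK _] := hK.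
case: sym; last by move=> _; exists P, r.
move=> /(_ isT)/centrally_symmetricP symK; exists 0, r => //; split => // x.
rewrite subr0 => xr.
have -> : x = (1 - 1 / 2) *: (P + x) + (1 / 2) *: (- (P - x)).
  by apply/rowP => i; rewrite !mxE; field.
apply: convK; first by lra.
  by apply: Pr; rewrite addrAC subrr add0r.
by apply: symK; apply: Pr; rewrite addrAC subrr add0r normrN.
Qed.

Lemma shrunk_interior K K' P (r s : R) : convex_set K -> 0 < r -> 0 <= s < 1 ->
  (forall x, `|x - P| <= r -> K x) -> (forall x, K x -> K' ((1 - s) *: x + s *: P)) ->
  K'° !=set0.
Proof.
move=> convK r0 /andP[s0 s1] Pr KK'; exists P; apply/nbhs_ballP.
have s1' : 0 < 1 - s by rewrite subr_gt0.
exists ((1 - s) * r) => /=; first by rewrite mulr_gt0.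
move=> x; rewrite -ball_normE /= distrC => xP.
have -> : x = (1 - s) *: (P + (1 - s)^-1 *: (x - P)) + s *: P.
  by apply/rowP => i; rewrite !mxE; field; rewrite gt_eqF.
apply: KK'; apply: Pr; rewrite addrAC subrr add0r normrZ gtr0_norm ?invr_gt0//.
by rewrite ler_pdivrMl// ltW.
Qed.

(** The map [x |-> - x] is triangular with determinant of modulus 1, preserves [K] and changes the
    sign of the integrand. *)
Lemma moment1_symmetric K : convex_body K -> centrally_symmetric K -> moment1 0 K = 0.
Proof.
move=> [cK _ _] symK; have bK := bounded_measurable_compact cK.
have Tu : (- 1%:M : 'M[R]_n) \in unitmx by rewrite unitmxE -scaleN1r detZ det1 mulr1 unitrX// unitrN1.
have KE : affine_map (- 1%:M) 0 @` K = K.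
  rewrite [RHS]symK; congr (_ @` _); apply/funext => x.
  by rewrite /affine_map mulmxN mulmx1 addr0.
have vp : volume_preserving (affine_map (- 1%:M : 'M[R]_n) 0).
  move=> B mB.
  have mfB : measurable (affine_map (- 1%:M) 0 @` B).
    by rewrite affine_image_preimage//; exact: measurable_affine_preimage.
  rewrite -[in RHS](affine_preimage_image 0 B Tu) lebesgue_rV_upper//.
  - by rewrite -scaleN1r detZ det1 mulr1 normrX normrN normr1 expr1n invr1 mul1e.
  - by move=> i j ji; rewrite !mxE; case: eqP ji => [->|]; rewrite ?ltnn ?oppr0.
  - by rewrite -unitfE -unitmxE.
apply/rowP => i; rewrite mxE [RHS]mxE.
have cg := @cont_coordB R n 0 i.
have := integral_volume_preserving Tu vp cK cg; rewrite KE.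
rewrite !integral_fineE//; last first.
  move=> x; apply: (@continuous_comp _ _ _ (affine_map (- 1%:M : 'M[R]_n) 0) (fun x => x ord0 i - (0 : 'rV[R]_n) ord0 i)).
    exact: continuous_affine_map.
  exact: cg.
move=> [] H.
have : 'I[K] (fun x => affine_map (- 1%:M) 0 x ord0 i - (0 : 'rV[R]_n) ord0 i) =
  -1 * 'I[K] (fun x => x ord0 i - (0 : 'rV[R]_n) ord0 i).
  rewrite -rintZ//; apply: eq_Rintegral => x _.
  by rewrite /affine_map mulmxN mulmx1 !mxE; ring.
by rewrite -H => H1; lra.
Qed.

Lemma variation_density_even K : convex_body K -> centrally_symmetric K ->
  forall x, variation_density K (- x) = variation_density K x.
Proof.
move=> hK symK x; rewrite /variation_density /centroid moment1_symmetric// scaler0 !subr0.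
by rewrite quad_formN.
Qed.

(** The condition on [l] says that the shrunk copy of [K] about [P] survives the cut. Hence what
    remains is a convex body close to [K], and local maximality bounds the first variation by the
    quadratic error. The constants are uniform in the cut. *)
Lemma cut_principle (sym : bool) d K : (0 < n)%N ->
  d = @hausdorff_dist R n \/ d = @banach_mazur_dist R n ->
  convex_body K -> (sym -> centrally_symmetric K) -> locally_maximal sym d K ->
  exists P : 'rV[R]_n, exists2 r : R, 0 < r & (sym -> P = 0) /\ (forall x, `|x - P| <= r -> K x) /\
  exists C : R, exists2 r0 : R, 0 < r0 & exists2 s0 : R, 0 < s0 &
  forall (l : 'rV[R]_n -> R) (tau s : R), continuous l ->
    (forall x y t, l ((1 - t) *: x + t *: y) = (1 - t) * l x + t * l y) ->
    0 <= s <= s0 -> (forall x, K x -> tau <= l ((1 - s) *: x + s *: P)) ->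
    let D := K `&` [set x | l x < tau \/ (sym /\ l (- x) < tau)] in
    bounded_measurable D /\
    (volume D <= r0 -> - ('I[D] (variation_density K)) <= C * volume D ^+ 2).
Proof.
move=> n0 hd hK symK [e e0 Hmax].
have [P [r rr0 [P0 Pr]]] := symmetric_center hK symK.
exists P, r => //; split => //; split => //.
have [cK convK _] := hK; have bK := bounded_measurable_compact cK.
have [_ [rho Krho]] := bK.
have KP : K P by apply: Pr; rewrite subrr normr0 ltW.
have [C [r0 r00 HC]] := isotropy_constant_variation rho n0 hK.
have [s1 s10 Hd] := dist_sandwich hd hK KP e0; clear hd.
exists C, r0 => //; exists (Num.min s1 (1 / 2)).
  by rewrite lt_min s10; lra.
move=> l tau s cl affl /andP[s0]; rewrite le_min => /andP[ss1 s2] Hl D.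
pose K' := K `&` [set x | tau <= l x /\ (sym -> tau <= l (- x))].
have clN : continuous (fun x => l (- x)).
  have cN : continuous (fun x : 'rV[R]_n => - x).
    apply: continuous_rVP => i.
    have -> : (fun x : 'rV[R]_n => (- x) ord0 i) = (fun x => -1 * x ord0 i).
      by apply/funext => x; rewrite mxE mulN1r.
    by apply: contM; [exact: cont_cst|exact: cont_coord].
  by move=> x; apply: (@continuous_comp _ _ _ (fun x : 'rV[R]_n => - x) l); [exact: cN|exact: cl].
have DE : D = K `\` K'.
  apply/seteqP; split => x [Kx] /=.
    by move=> H; split => // -[_ [H1 H2]]; case: H => [|[/H2]]; rewrite ltNge ?H1// => ->.
  move=> H; split => //=; have [//|lx] := ltP (l x) tau; first by left.
  right; have [hs|/negP hs] := boolP sym; last by exfalso; apply: H; split.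
  by split => //; rewrite ltNge; apply/negP => lNx; apply: H; split.
have cK' : compact K'.
  apply: compact_closedI => //.
  case: (sym); last first.
    rewrite (_ : [set _ | _] = l @^-1` [set y | tau <= y]).
      by apply: closed_comp => [x _|]; [exact: cl|exact: closed_ge].
    by apply/seteqP; split => x //= [].
  rewrite (_ : [set _ | _] = l @^-1` [set y | tau <= y] `&` (fun x => l (- x)) @^-1` [set y | tau <= y]).
    apply: closedI; first by apply: closed_comp => [x _|]; [exact: cl|exact: closed_ge].
    by apply: (@closed_comp _ _ (fun x => l (- x))) => [x _|]; [exact: clN|exact: closed_ge].
  by apply/seteqP; split => x /= [h1 h2]; split => //; exact: h2.
have [mK' _] := bounded_measurable_compact cK'.
have bD : bounded_measurable D by rewrite DE; exact: bounded_measurableD.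
split => // Dr0; rewrite leNgt; apply/negP => HD.
have KK' x : K x -> K' ((1 - s) *: x + s *: P).
  move=> Kx; split.
    by move/convex_setP : convK; apply => //; lra.
  split; first exact: Hl.
  case: (sym) P0 symK => // /(_ isT) P0 /(_ isT)/centrally_symmetricP symK _.
  have -> : - ((1 - s) *: x + s *: P) = (1 - s) *: (- x) + s *: P.
    by rewrite P0 scaler0 !addr0 scalerN.
  by apply: Hl; exact: symK.
have hK' : convex_body K'.
  split => //; last first.
    by apply: (shrunk_interior convK rr0 _ Pr KK'); lra.
  apply/convex_setP => x y t t01 [Kx [lx lx']] [Ky [ly ly']].
  have conv_ge (a b : R) : tau <= a -> tau <= b -> tau <= (1 - t) * a + t * b.
    have /andP[t0 t1] := t01.
    move=> ha hb; have : 0 <= (1 - t) * (a - tau) + t * (b - tau).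
      by rewrite addr_ge0// mulr_ge0// subr_ge0.
    by clear; lra.
  split; first by move/convex_setP : convK; exact.
  split; first by rewrite affl; exact: conv_ge.
  move=> hs.
  have -> : - ((1 - t) *: x + t *: y) = (1 - t) *: (- x) + t *: (- y).
    by rewrite !scalerN opprD.
  by rewrite affl; apply: conv_ge; [exact: lx'|exact: ly'].
have symK' : sym -> centrally_symmetric K'.
  move=> hs; apply/centrally_symmetricP => x [Kx [lx lx']].
  split; first by have /centrally_symmetricP := symK hs; exact.
  by split => [|_]; [exact: lx'|rewrite opprK].
have dK' : d K' K < e.
  apply: (Hd s) => //; first by rewrite s0.
  (* The outer inclusion holds because cutting only removes points and [K] is star-shaped about
     [P]. *)
  move=> x [Kx _]; exists ((1 - s / (1 + s)) *: x + (s / (1 + s)) *: P).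
    move/convex_setP : convK; apply => //.
    by rewrite divr_ge0 ?addr_ge0//= ler_pdivrMr ?ltr_pwDl// mul1r lerDr.
  by apply/rowP => i; rewrite !mxE; field; rewrite gt_eqF// ltr_pwDl.
have := Hmax _ hK' symK' dK'; rewrite leNgt => /negP; apply.
apply: (HC K' D (-1)) => //.
- by move=> x [Kx _]; exact: Krho.
- by rewrite normrN normr1.
- move=> g cg; rewrite (rint_setD cg bK mK'); last by move=> x [].
  by rewrite DE; lra.
- by rewrite mulN1r.
Qed.

Definition cone_tip K p := [set x : 'rV[R]_n | exists2 k, K k &
  exists2 t : R, 0 <= t <= 1 & x = (1 - t) *: k + t *: p].

Lemma sub_cone_tip K p : K `<=` cone_tip K p.
Proof.
move=> x Kx; exists x => //; exists 0; first by rewrite lexx ler01.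
by rewrite subr0 scale1r scale0r addr0.
Qed.

Lemma cone_tip_tip K p : K !=set0 -> cone_tip K p p.
Proof.
move=> [k Kk]; exists k => //; exists 1; first by rewrite lexx ler01.
by rewrite subrr scale0r add0r scale1r.
Qed.

Lemma compact_cone_tip K p : compact K -> compact (cone_tip K p).
Proof.
move=> cK.
pose F (z : R * 'rV[R]_n) : 'rV[R]_n := (1 - z.1) *: z.2 + z.1 *: p.
have -> : cone_tip K p = F @` ([set` `[0, 1]] `*` K).
  apply/seteqP; split => x /=.
    by move=> [k Kk [t t01 ->]]; exists (t, k) => //; split => //=; rewrite in_itv.
  by move=> [[t k] [/= + Kk] <-]; rewrite in_itv /= => t01; exists k => //; exists t.
apply: continuous_compact; last by apply: compact_setX => //; exact: segment_compact.
apply: continuous_subspaceT; apply: continuous_rVP => i.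
have -> : (fun z => F z ord0 i) = (fun z => z.2 ord0 i + z.1 * (p ord0 i + -1 * z.2 ord0 i)).
  by apply/funext => z; rewrite !mxE; ring.
have c1 : continuous (fun z : R * 'rV[R]_n => z.1) by move=> z; exact: cvg_fst.
have c2 : continuous (fun z : R * 'rV[R]_n => z.2 ord0 i).
  move=> z; apply: (@continuous_comp _ _ _ snd (fun x : 'rV[R]_n => x ord0 i)); first exact: cvg_snd.
  exact: cont_coord.
apply: contD => //; apply: contM => //; apply: contD; first exact: cont_cst.
by apply: contM => //; exact: cont_cst.
Qed.

Lemma convex_cone_tip K p : convex_set K -> convex_set (cone_tip K p).
Proof.
move=> /convex_setP convK; apply/convex_setP => _ _ l l01 [k Kk [t t01 ->]] [k' Kk' [t' t'01 ->]].
pose a := (1 - l) * (1 - t); pose b := l * (1 - t').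
have a0 : 0 <= a by rewrite mulr_ge0//; lra.
have b0 : 0 <= b by rewrite mulr_ge0//; lra.
(* [a + b] is the total weight on [K]. If it vanishes, the point is [p] itself and any base point
   will do; otherwise the base point is the weighted mean of [k] and [k']. *)
have [ab0|ab0] := eqVneq (a + b) 0.
  have [a_0 b_0] : a = 0 /\ b = 0 by lra.
  exists k => //; exists 1; first by rewrite lexx ler01.
  apply/rowP => i; rewrite !mxE.
  have -> : (1 - l) * ((1 - t) * k ord0 i + t * p ord0 i) + l * ((1 - t') * k' ord0 i + t' * p ord0 i)
    = a * k ord0 i + b * k' ord0 i + (1 - a - b) * p ord0 i by rewrite /a /b; ring.
  by rewrite a_0 b_0; ring.
exists ((1 - b / (a + b)) *: k + (b / (a + b)) *: k').
  apply: convK => //; rewrite divr_ge0 ?addr_ge0//= ler_pdivrMr; first by lra.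
  by rewrite lt_neqAle eq_sym ab0 addr_ge0.
exists (1 - a - b).
  have -> : 1 - a - b = (1 - l) * t + l * t' by rewrite /a /b; ring.
  rewrite addr_ge0 ?mulr_ge0//=; try lra.
  have : 0 <= a + b by rewrite addr_ge0.
  rewrite /a /b; lra.
by apply/rowP => i; rewrite !mxE /a /b; field; move: ab0; rewrite /a /b.
Qed.

(* The convex hull of [K] and [p], and also [- p] in the symmetric case: as
   [0] belongs to a symmetric [K], it is the union of the two cones. *)
Definition tip_hull (sym : bool) K p :=
  cone_tip K p `|` [set x | sym /\ cone_tip K p (- x)].

(** The case that matters is a segment between the two cones. The weights of [p] and [- p] partly
    cancel, leaving a coefficient [c] whose sign selects the cone; the weight lost in the
    cancellation is given to 0, which belongs to [K]. *)
Lemma convex_tip_hull (sym : bool) K p : convex_set K -> (sym -> centrally_symmetric K) ->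
  (sym -> K 0) -> convex_set (tip_hull sym K p).
Proof.
move=> convK symK K0; have /convex_setP := @convex_cone_tip K p convK => cc.
apply/convex_setP.
suff mixed x y l : 0 <= l <= 1 -> sym -> cone_tip K p x -> cone_tip K p (- y) ->
    tip_hull sym K p ((1 - l) *: x + l *: y).
  move=> x y l l01 [Tx|[hs Tx]] [Ty|[hs' Ty]].
  - by left; exact: cc.
  - exact: mixed.
  - have -> : (1 - l) *: x + l *: y = (1 - (1 - l)) *: y + (1 - l) *: x.
      by rewrite subKr addrC.
    by apply: mixed => //; lra.
  - right; split => //.
    have -> : - ((1 - l) *: x + l *: y) = (1 - l) *: (- x) + l *: (- y).
      by rewrite !scalerN opprD.
    exact: cc.
move=> l01 hs [k Kk [t t01 ->]] [k' Kk' [t' t'01 /(congr1 (@GRing.opp _))]].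
rewrite opprK => ->.
have /centrally_symmetricP sK := symK hs; have {}K0 := K0 hs.
have gen (a b c : R) k1 k2 : 0 <= a -> 0 <= b -> 0 <= c -> a + b + c <= 1 -> K k1 -> K k2 ->
    cone_tip K p (a *: k1 + b *: k2 + c *: p).
  move=> a0 b0 c0 abc Kk1 Kk2; move/convex_setP : convK => convK.
  have [c1|c1] := eqVneq c 1.
    have [-> ->] : a = 0 /\ b = 0 by lra.
    rewrite c1 !scale0r add0r scale1r add0r; apply: cone_tip_tip; by exists 0.
  have c1' : 0 < 1 - c by have := c1; rewrite neq_lt; lra.
  have Kc z u : K z -> 0 <= u <= 1 -> K (u *: z).
    by move=> Kz u01; have := convK 0 z u u01 K0 Kz; rewrite scaler0 add0r.
  exists ((a / (1 - c)) *: k1 + (b / (1 - c)) *: k2).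
    have [ab0|ab0] := eqVneq (a + b) 0.
      have [-> ->] : a = 0 /\ b = 0 by lra.
      by rewrite !mul0r !scale0r addr0.
    have ab : 0 < a + b by rewrite lt_neqAle eq_sym ab0 addr_ge0.
    have -> : (a / (1 - c)) *: k1 + (b / (1 - c)) *: k2 =
       ((a + b) / (1 - c)) *: ((1 - b / (a + b)) *: k1 + (b / (a + b)) *: k2).
      by apply/rowP => i; rewrite !mxE; field; rewrite ab0/= gt_eqF.
    apply: Kc; last first.
      apply/andP; split; first by apply: divr_ge0; [exact: addr_ge0|exact: ltW].
      by rewrite ler_pdivrMr//; lra.
    apply: convK => //; apply/andP; split; first by apply: divr_ge0 => //; exact: ltW.
    by rewrite ler_pdivrMr//; lra.
  exists c; first by lra.
  by apply/rowP => i; rewrite !mxE; field; rewrite gt_eqF.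
pose a := (1 - l) * (1 - t); pose b := l * (1 - t'); pose c := (1 - l) * t - l * t'.
have a0 : 0 <= a by rewrite mulr_ge0//; lra.
have b0 : 0 <= b by rewrite mulr_ge0//; lra.
have t0 : 0 <= (1 - l) * t by rewrite mulr_ge0//; lra.
have t'0 : 0 <= l * t' by rewrite mulr_ge0//; lra.
have E : (1 - l) *: ((1 - t) *: k + t *: p) + l *: - ((1 - t') *: k' + t' *: p) =
    a *: k + b *: (- k') + c *: p.
  by apply/rowP => i; rewrite !mxE /a /b /c; ring.
have abt : a + b + (1 - l) * t + l * t' = 1 by rewrite /a /b; ring.
rewrite E; have [c0|c0] := leP 0 c.
  by left; apply: gen => //; [rewrite /c; lra|exact: sK].
right; split => //.
have -> : - (a *: k + b *: - k' + c *: p) = a *: (- k) + b *: k' + (- c) *: p.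
  by apply/rowP => i; rewrite !mxE; ring.
by apply: gen => //; [rewrite oppr_ge0 ltW|rewrite /c; lra|exact: sK].
Qed.

(** A tip [p] close to the point [X] of [K] stays in a slightly enlarged copy of [K], so the hull is
    close to [K]. Positivity of the added volume is exported because the final estimate is divided
    by it. *)
Lemma tip_principle (sym : bool) d K : (0 < n)%N ->
  d = @hausdorff_dist R n \/ d = @banach_mazur_dist R n ->
  convex_body K -> (sym -> centrally_symmetric K) -> locally_maximal sym d K ->
  forall X, K X ->
  exists C : R, exists2 r0 : R, 0 < r0 & exists2 s0 : R, 0 < s0 &
  forall p, `|p - X| <= s0 -> ~ K p ->
    let D := [set x | ~ K x /\ (cone_tip K p x \/ (sym /\ cone_tip K p (- x)))] in
    bounded_measurable D /\
    (volume D <= r0 -> 0 < volume D /\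
     'I[D] (variation_density K) <= C * volume D ^+ 2).
Proof.
move=> n0 hd hK symK [e e0 Hmax] X KX.
have [P [r rr0 [P0 Pr]]] := symmetric_center hK symK.
have [cK convK _] := hK; have bK := bounded_measurable_compact cK.
have [mK [rho Krho]] := bK.
have clK : closed K by apply: compact_closed => //; exact: norm_hausdorff.
have KP : K P by apply: Pr; rewrite subrr normr0 ltW.
have [C [r0 r00 HC]] := isotropy_constant_variation (3 * rho) n0 hK.
have [s1 s10 Hd] := dist_sandwich hd hK KP e0; clear hd.
have rho0 : 0 <= rho by rewrite (le_trans _ (Krho _ KP)).
pose s := Num.min s1 (1 / 2).
have s0 : 0 < s by rewrite lt_min s10; lra.
have ss1 : s <= s1 by rewrite ge_min lexx.
have s12 : s <= 1 / 2 by rewrite ge_min lexx orbT.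
exists C, r0 => //; exists (s * r); first by rewrite mulr_gt0.
move=> p pX nKp D.
pose K' := tip_hull sym K p.
have KK' : K `<=` K' by move=> x Kx; left; exact: sub_cone_tip.
have DE : D = K' `\` K.
  by apply/seteqP; split => x /=; [move=> [nK [T|T]]|move=> [[T|T] nK]]; split => //; [left|right|left|right].
have coneNE : [set x | cone_tip K p (- x)] = affine_map (- 1%:M) 0 @` cone_tip K p.
  apply/seteqP; split => x /=.
    by move=> Tx; exists (- x) => //; rewrite /affine_map mulmxN mulmx1 opprK addr0.
  by move=> [y Ty <-]; rewrite /affine_map mulmxN mulmx1 addr0 opprK.
have cK' : compact K'.
  apply: compactU; first exact: compact_cone_tip.
  case: (sym).
    rewrite (_ : [set _ | _] = [set x | cone_tip K p (- x)]).
      by rewrite coneNE; apply: compact_affine_image; exact: compact_cone_tip.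
    by apply/seteqP; split => x //= [].
  rewrite (_ : [set _ | _] = set0); first exact: compact0.
  by apply/seteqP; split => x //= [].
have bK' := bounded_measurable_compact cK'.
have bD : bounded_measurable D by rewrite DE; exact: bounded_measurableD.
split => // Dr0.
(* The cone contains the ball of radius [t * r] about [t *: P + (1 - t) *: p]. As [p] is outside the
   closed set [K], this ball avoids [K] for small [t]. *)
have D0 : D° !=set0.
  have /nbhs_ballP[g /= g0 pg] : nbhs p (~` K).
    by apply: open_nbhs_nbhs; split => //; exact: closed_openC.
  have Pp0 : 0 < 1 + `|P - p| + r by have := normr_ge0 (P - p); lra.
  pose t := Num.min 1 (g / 2 / (1 + `|P - p| + r)).
  have t0 : 0 < t by rewrite lt_min ltr01 !divr_gt0.
  have t1 : t <= 1 by rewrite ge_min lexx.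
  have tg : t * (1 + `|P - p| + r) < g.
    apply: (@le_lt_trans _ _ (g / 2)); last lra.
    by rewrite -ler_pdivlMr// ge_min lexx orbT.
  exists (t *: P + (1 - t) *: p); apply/nbhs_ballP; exists (t * r) => /=; first by rewrite mulr_gt0.
  move=> x; rewrite -ball_normE /= distrC => xr; split.
    apply: pg; rewrite -ball_normE /= distrC.
    have -> : x - p = (x - (t *: P + (1 - t) *: p)) + t *: (P - p).
      by apply/rowP => i; rewrite !mxE; ring.
    rewrite (le_lt_trans (ler_normD _ _))// normrZ gtr0_norm//.
    apply: le_lt_trans tg; rewrite !mulrDr mulr1.
    by lra.
  left; exists (P + t^-1 *: (x - (t *: P + (1 - t) *: p))).
    apply: Pr; rewrite addrAC subrr add0r normrZ gtr0_norm ?invr_gt0//.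
    by rewrite ler_pdivrMl// ltW.
  exists (1 - t); first by lra.
  by apply/rowP => i; rewrite !mxE; field; rewrite gt_eqF.
have VD := volume_gt0 bD D0.
split => //; rewrite leNgt; apply/negP => HD.
have hK' : convex_body K'.
  split => //.
    apply: convex_tip_hull => // hs; rewrite -(P0 hs); exact: KP.
  exists P; apply/nbhs_ballP; exists r => // x; rewrite -ball_normE /= distrC => xr.
  by apply: KK'; apply: Pr; exact: ltW.
have symK' : sym -> centrally_symmetric K'.
  move=> hs; apply/centrally_symmetricP => x [Tx|[_ Tx]]; last by left.
  by right; split => //; rewrite opprK.
have Ke x : cone_tip K p x -> exists2 y, K y & x = (1 + s) *: y - s *: P.
  move=> [k Kk [t t01 ->]].
  pose y1 := (1 - s / (1 + s)) *: k + (s / (1 + s)) *: P.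
  (* The point with [(1 + s) *: y2 - s *: P = p]. The bound [s * r] on the distance from [p] to [X]
     keeps [P + s^-1 *: (p - X)] in the ball about [P] contained in [K]. *)
  pose y2 := (1 - s / (1 + s)) *: X + (s / (1 + s)) *: (P + s^-1 *: (p - X)).
  move/convex_setP : (convK) => cvK.
  have s01 : 0 <= s / (1 + s) <= 1.
    by rewrite divr_ge0 ?addr_ge0 ?(ltW s0)//= ler_pdivrMr ?addr_gt0// mul1r lerDr.
  exists ((1 - t) *: y1 + t *: y2).
    apply: (cvK) => //; first exact: (cvK).
    apply: (cvK) => //; apply: Pr; rewrite addrAC subrr add0r normrZ gtr0_norm ?invr_gt0//.
    by rewrite ler_pdivrMl.
  have sn0 : s != 0 by rewrite gt_eqF.
  have s1n0 : 1 + s != 0 by rewrite gt_eqF// addr_gt0.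
  by apply/rowP => i; rewrite !mxE; field; rewrite sn0.
have dK' : d K' K < e.
  apply: (Hd s) => //; first by rewrite (ltW s0).
    by move=> x Kx; apply: KK'; move/convex_setP : convK; apply => //; lra.
  move=> x [/Ke//|[hs /Ke[y Ky yE]]]; exists (- y).
    by have /centrally_symmetricP := symK hs; exact.
  by rewrite -[LHS]opprK yE P0// !scaler0 !subr0 scalerN.
have pn : `|p| <= 3 * rho.
  have [|y Ky ->] := Ke p; first by apply: cone_tip_tip; exists P.
  rewrite (le_trans (ler_normB _ _))// !normrZ !gtr0_norm//; last lra.
  have : (1 + s) * `|y| <= (1 + s) * rho by rewrite ler_wpM2l ?Krho//; lra.
  have : s * `|P| <= s * rho by rewrite ler_wpM2l ?Krho//; lra.
  have : s * rho <= 1 / 2 * rho by rewrite ler_wpM2r.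
  by rewrite mulrDl mul1r; lra.
have cone_norm x : cone_tip K p x -> `|x| <= 3 * rho.
  move=> [k Kk [t t01 ->]]; rewrite (le_trans (ler_normD _ _))// !normrZ.
  have /andP[t0 t1] := t01; rewrite !ger0_norm ?subr_ge0//.
  have : (1 - t) * `|k| <= (1 - t) * (3 * rho).
    by rewrite ler_wpM2l ?subr_ge0// (le_trans (Krho _ Kk))// ler_peMl// ler1n.
  have : t * `|p| <= t * (3 * rho) by rewrite ler_wpM2l.
  by clear; lra.
have := Hmax _ hK' symK' dK'; rewrite leNgt => /negP; apply.
apply: (HC K' D 1) => //.
- by move=> x [_ [|[_]]] /cone_norm//; rewrite normrN.
- by rewrite normr1.
- by move=> g cg; rewrite (rint_setD cg bK' mK KK') mul1r DE.
- by rewrite mul1r.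
Qed.

End perturbation_principles.

(** * Blow-up at a contact point *)

Section blow_up.
Context {R : realType} {n : nat}.
Implicit Types (D : set 'rV[R]_n) (Y u : 'rV[R]_n).

(** The common form to which the smallness conditions on [e], [g] and [s] are brought; higher powers
    of [s] are first bounded by [s]. *)
Lemma near0_lin (A b : R) : 0 < b -> \forall s \near 0^'+, A * s < b.
Proof.
move=> b0; near=> s.
have s0 : 0 < s by near: s; exact: nbhs_right_gt.
have A0 : 0 < `|A| + 1 by rewrite ltr_wpDl.
have : s < b / (`|A| + 1).
  by near: s; apply: nbhs_right_lt; rewrite divr_gt0.
rewrite ltr_pdivlMr// => H; apply: le_lt_trans H.
by rewrite mulrC ler_wpM2l ?ltW// ltr_pwDr// ler_norm.
Unshelve. all: by end_near. Qed.

Variables (K : set 'rV[R]_n) (X N : 'rV[R]_n) (Q : 'M[R]_n).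
Hypotheses (hK : convex_body K) (hc : paraboloid_contact K X N Q).

Local Notation q := (quad_form Q).
Local Notation B := (bilin Q).
Let N1 := contact_unit hc.
Let QT := contact_sym hc.

Definition scaled_pt (s : R) Y (y : R) : 'rV[R]_n := frame_pt X N (s *: Y) (s ^+ 2 * y).

Lemma contact_quad_ge0 Y : orthv N Y -> 0 <= q Y.
Proof.
by move=> YN; have [->|/(contact_pos hc YN)/ltW//] := eqVneq Y 0; rewrite quad_form0.
Qed.

(** The parallelogram identity for [u] and [Y - u], with the form of their difference dropped. *)
Lemma quad_form_triangle u Y : orthv N u -> orthv N Y -> q Y <= 2 * q u + 2 * q (Y - u).
Proof.
move=> uN YN; have ZN := orthvB YN uN; have YE := subrK u Y.
move: (Y - u) ZN YE => Z ZN <-.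
have := contact_quad_ge0 (orthvB ZN uN).
by rewrite (quad_formB Z u QT) (quad_formD Z u QT); lra.
Qed.

Lemma scaled_bounds u c : 0 <= c -> orthv N u -> exists2 r : R, 1 <= r &
  forall Y (y : R), orthv N Y -> q (Y - u) <= c -> `|y - q Y| <= c ->
    [/\ `|Y| <= r, `|y| <= r & q Y <= r].
Proof.
move=> c0 uN; have [m m0 Hm] := quad_form_coercive (contact_pos hc).
have qu := contact_quad_ge0 uN.
have cm0 : 0 <= c / m by rewrite divr_ge0// ltW.
exists (2 + `|u| + c / m + 2 * q u + 3 * c).
  by have := normr_ge0 u; lra.
move=> Y y YN Yu yY.
have YuN := orthvB YN uN.
(* A number is at most 1 or at most its square, which avoids a square root. *)
have Y1 : `|Y - u| <= 1 + c / m.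
  have H : `|Y - u| ^+ 2 <= c / m by rewrite ler_pdivlMr// mulrC (le_trans (Hm _ YuN)).
  have [|Y1] := leP `|Y - u| 1; first by lra.
  rewrite -[leLHS]mulr1 (le_trans _ (le_trans H _))//; last by rewrite lerDr.
  by rewrite expr2 ler_wpM2l//; lra.
have Yn : `|Y| <= `|u| + `|Y - u| by rewrite -{1}(subrK u Y) addrC ler_normD.
have qY0 := contact_quad_ge0 YN.
have qY : q Y <= 2 * q u + 2 * c by have := quad_form_triangle uN YN; lra.
have yn : `|y| <= c + q Y.
  by rewrite -{1}(subrK (q Y) y) (le_trans (ler_normD _ _))// (ger0_norm qY0) lerD2r.
have nu := normr_ge0 u.
by split; lra.
Qed.

(** [D] is covered by a slab about [X] and, for the mirror images in the symmetric case, one about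
    [- X]; their width of order [s] and thickness of order [s ^ 2] give volumes of order
    [s ^ (n - 1) * s ^ 2]. *)
Lemma volume_scaled_le (r : R) : (0 < n)%N -> 1 <= r -> exists2 C : R, 0 < C &
  forall (s : R) D, 0 < s <= 1 -> bounded_measurable D ->
    (forall x, D x -> exists Y, exists2 y : R, [/\ orthv N Y, `|Y| <= r & `|y| <= r] &
      x = scaled_pt s Y y \/ - x = scaled_pt s Y y) ->
    volume D <= C * s ^+ n.+1.
Proof.
move=> n0 r1.
have Nn0 : N != 0.
  by apply/eqP => N0; have := N1; rewrite N0 dotv0l => /eqP; rewrite eq_sym oner_eq0.
have [c1 c10 [c2 c20 Hc]] := slab_volume Nn0.
exists (2 * (c2 * (2 * r) ^+ n.-1 * r)).
  by rewrite !mulr_gt0 ?exprn_gt0 ?mulr_gt0//; lra.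
move=> s D /andP[s0 s1] bD HD.
have s2s : s ^+ 2 <= s by rewrite expr2 ler_piMl// ltW.
pose S z := slab z N (2 * r * s) (r * s ^+ 2).
have hr : 0 <= r * s ^+ 2 <= 2 * r * s.
  have r0 : 0 <= r by lra.
  rewrite mulr_ge0 ?sqr_ge0//= (_ : 2 * r * s = r * (2 * s)); last by ring.
  by rewrite ler_wpM2l//; lra.
have SD : D `<=` S X `|` S (- X).
  move=> x /HD[Y [y [YN Yr yr] xE]].
  have Sx : S X (scaled_pt s Y y).
    split; last first.
      rewrite /scaled_pt frame_pt_dot//; last exact: orthvZ.
      by rewrite normrM ger0_norm ?sqr_ge0// mulrC ler_wpM2r ?sqr_ge0.
    rewrite (le_trans (frame_pt_norm _ _ _ N1))// normrZ normrM ger0_norm ?(ltW s0)//.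
    rewrite ger0_norm ?sqr_ge0//.
    have : s * `|Y| <= s * r by rewrite ler_wpM2l// ltW.
    have : s ^+ 2 * `|y| <= s * r by rewrite ler_pM// sqr_ge0.
    by lra.
  case: xE => xE; first by left; rewrite xE.
  right; case: Sx; rewrite -xE => h1 h2; split.
    by move: h1; rewrite -opprD normrN opprK.
  by move: h2; rewrite -opprD dotvNl normrN opprK.
have [mD _] := bD.
rewrite -lee_fin -volumeE//.
have mS z : measurable (S z) by exact: measurable_slab.
apply: (@le_trans _ _ (lebesgue_rV (S X `|` S (- X)))).
  by apply: le_measure; rewrite ?inE//; exact: measurableU.
apply: (le_trans (measureU2 _ _ _)) => //.
have /andP[_ h1] := Hc X _ _ hr; have /andP[_ h2] := Hc (- X) _ _ hr.
apply: (le_trans (leeD h1 h2)); rewrite -EFinD lee_fin.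
have -> : s ^+ n.+1 = s ^+ n.-1 * s ^+ 2 by rewrite -exprD; case: (n) n0 => // k _; rewrite /= addn2.
rewrite [(2 * r * s) ^+ _]exprMn le_eqVlt; apply/orP; left; apply/eqP; ring.
Qed.

Lemma volume_slab_ge (rho : R) : (0 < n)%N -> 0 < rho -> exists2 c : R, 0 < c &
  forall (s : R) z, 0 < s <= 1 ->
    bounded_measurable (slab z N (rho * s) (rho * s ^+ 2)) /\
    c * s ^+ n.+1 <= volume (slab z N (rho * s) (rho * s ^+ 2)).
Proof.
move=> n0 rho0.
have Nn0 : N != 0.
  by apply/eqP => N0; have := N1; rewrite N0 dotv0l => /eqP; rewrite eq_sym oner_eq0.
have [c1 c10 [c2 c20 Hc]] := slab_volume Nn0.
exists (c1 * rho ^+ n.-1 * rho); first by rewrite !mulr_gt0// exprn_gt0.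
move=> s z /andP[s0 s1].
have s2s : s ^+ 2 <= s by rewrite expr2 ler_piMl// ltW.
have bS : bounded_measurable (slab z N (rho * s) (rho * s ^+ 2)).
  split; first exact: measurable_slab.
  exists (rho * s + `|z|) => x [xz _].
  by rewrite -{1}(subrK z x) (le_trans (ler_normD _ _))// lerD2r.
split => //; rewrite -lee_fin -volumeE//.
have hr : 0 <= rho * s ^+ 2 <= rho * s.
  by rewrite mulr_ge0 ?sqr_ge0 ?(ltW rho0)//= ler_wpM2l// ltW.
have /andP[h1 _] := Hc z _ _ hr; apply: le_trans h1; rewrite lee_fin.
have -> : s ^+ n.+1 = s ^+ n.-1 * s ^+ 2 by rewrite -exprD; case: (n) n0 => // k _; rewrite /= addn2.
rewrite exprMn le_eqVlt; apply/orP; left; apply/eqP; ring.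
Qed.

Lemma body_frame_bound : exists2 M : R, 0 < M & forall Y (y : R), orthv N Y ->
  K (frame_pt X N Y y) -> `|Y| <= M /\ `|y| <= M.
Proof.
have [_ [rho Krho]] := convex_body_bounded_measurable hK.
have rho0 : 0 <= rho by rewrite (le_trans _ (Krho _ (contact_mem hc))).
exists ((n%:R + 1) * (2 * rho) + 1).
  by rewrite ltr_wpDl// !mulr_ge0// addr_ge0.
move=> Y y YN KY.
have xX : `|frame_pt X N Y y - X| <= 2 * rho.
  rewrite (le_trans (ler_normB _ _))// mulr2n mulrDl !mul1r.
  by rewrite lerD ?Krho//; exact: contact_mem hc.
have H1 : (n%:R + 1) * `|frame_pt X N Y y - X| <= (n%:R + 1) * (2 * rho).
  by rewrite ler_wpM2l// addr_ge0.
have := frame_pt_norm_Y X y YN N1; have := frame_pt_norm_y X y YN N1.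
have := normr_ge0 (frame_pt X N Y y - X).
by rewrite mulrDl mul1r in H1 *; split; lra.
Qed.

Lemma unscale (s : R) Y (y : R) : 0 < s -> orthv N Y -> exists Y', exists2 y' : R,
  orthv N Y' & Y = s *: Y' /\ y = s ^+ 2 * y'.
Proof.
move=> s0 YN; have sn0 : s != 0 by rewrite gt_eqF.
exists (s^-1 *: Y), (s ^- 2 * y); first exact: orthvZ.
by rewrite scalerA mulfV// scale1r mulrA mulfV ?mul1r// expf_eq0.
Qed.

(* The value at [X + Y + y *: N] of the linear functional defining the cap that
   is cut off around the point [scaled_pt s u (q u)] of the paraboloid. *)
Definition cap_height u (s : R) Y (y : R) : R := y - 2 * s * B u Y + s ^+ 2 * q u.

(** In scaled coordinates the height is measured from the tangent hyperplane of the paraboloid at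
    [u], so cutting at [s ^+ 2] moves that hyperplane inwards by 1. *)
Lemma cap_heightE u s Y y :
  cap_height u s (s *: Y) (s ^+ 2 * y) = s ^+ 2 * (y - q Y + q (Y - u)).
Proof. by rewrite /cap_height bilinZr quad_formB// (bilinC Y u QT); ring. Qed.

Lemma cap_functional u (s : R) : exists l : 'rV[R]_n -> R, [/\ continuous l,
  (forall x y t, l ((1 - t) *: x + t *: y) = (1 - t) * l x + t * l y) &
  forall Y y, orthv N Y -> l (frame_pt X N Y y) = cap_height u s Y y].
Proof.
(* Projecting to the hyperplane orthogonal to [N] keeps the component [y] out of the bilinear
   term. *)
pose w : 'rV[R]_n := u *m Q - dotv (u *m Q) N *: N.
exists (fun x => dotv (x - X) (N - (2 * s) *: w) + s ^+ 2 * q u); split.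
- by apply: contD; [exact: continuous_dotvB|exact: cont_cst].
- move=> x y t.
  have -> : (1 - t) *: x + t *: y - X = (1 - t) *: (x - X) + t *: (y - X).
    by apply/rowP => i; rewrite !mxE; ring.
  by rewrite dotvDl !dotvZl; ring.
- move=> Y y YN; rewrite dotvBr frame_pt_dot// dotvZr /cap_height.
  congr (_ - _ * _ + _).
  have -> : frame_pt X N Y y - X = Y + y *: N.
    by apply/rowP => i; rewrite !mxE; ring.
  rewrite /w /bilin dotvBr dotvZr !dotvDl !dotvZl YN N1 (dotvC Y) (dotvC N).
  by ring.
Qed.

(** On the cap [y] is of order [s], so [contact_local] brings the point into the range of the
    paraboloid estimates. In scaled coordinates these give [q (Y - u) < 1 + e * q Y], and the
    right-hand side is at most [3 / 2 + q (Y - u) / 2] by [quad_form_triangle] and the choice of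
    [e]; hence the bound 3. *)
Lemma cap_location u (e : R) : orthv N u -> 0 < e < 1 -> 4 * e <= 1 -> 4 * e * q u <= 1 ->
  \forall s \near 0^'+, forall Y (y : R), orthv N Y -> K (frame_pt X N Y y) ->
    cap_height u s Y y < s ^+ 2 ->
    exists Y', exists2 y' : R, orthv N Y' & [/\ Y = s *: Y', y = s ^+ 2 * y', q (Y' - u) <= 3,
      - (e * q Y') <= y' - q Y' & y' - q Y' <= 1].
Proof.
move=> uN e01 e4 eu.
have [a a0 Ha] := contact_near hc e01.
have [h h0 Hh] := contact_local hc a0.
have [M M0 HM] := body_frame_bound.
have [L L0 HL] := bilin_bound Q.
have qu := contact_quad_ge0 uN.
near=> s => Y y YN KY cap.
have s0 : 0 < s by near: s; exact: nbhs_right_gt.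
have s1 : s < 1 by near: s; apply: nbhs_right_lt.
have sh : (1 + 2 * (L * (`|u| * M))) * s < h by near: s; exact: near0_lin.
have [YM yM] := HM _ _ YN KY.
have yh : y < h.
  have : B u Y <= L * (`|u| * M).
    rewrite (le_trans (ler_norm _))// (le_trans (HL _ _))// ler_wpM2l ?(ltW L0)//.
    by rewrite ler_wpM2l.
  move=> /(ler_wpM2l (ltW s0)).
  have : s * s <= s * 1 by rewrite ler_wpM2l ?(ltW s0)// ltW.
  have : 0 <= s ^+ 2 * q u by rewrite mulr_ge0// sqr_ge0.
  move: cap sh; rewrite /cap_height expr2.
  have -> : (1 + 2 * (L * (`|u| * M))) * s = s + 2 * (s * (L * (`|u| * M))) by ring.
  have -> : 2 * s * B u Y = 2 * (s * B u Y) by ring.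
  clear; move: (s * B u Y) (s * (L * _)) (s * s * q u) (s * s) => *; lra.
have [Ya ya] := Hh _ _ YN KY yh.
have [/(_ KY) low _] := Ha _ _ YN Ya ya.
have [Y' [y' Y'N [YE yE]]] := unscale y s0 YN.
exists Y', y' => //.
have s20 : 0 < s ^+ 2 by rewrite exprn_gt0.
have low' : (1 - e) * q Y' <= y'.
  by move: low; rewrite YE yE quad_formZ mulrCA ler_pM2l.
have cap' : y' - q Y' + q (Y' - u) < 1.
  by move: cap; rewrite YE yE cap_heightE -[ltRHS]mulr1 ltr_pM2l.
have tri := quad_form_triangle uN Y'N.
have qY'u := contact_quad_ge0 (orthvB Y'N uN).
have /andP[e0 e1] := e01.
have etri : e * q Y' <= 2 * e * q u + 2 * e * q (Y' - u).
  by have := ler_wpM2l (ltW e0) tri; rewrite mulrDr !mulrA ![e * 2]mulrC.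
have e4q : 4 * e * q (Y' - u) <= 1 * q (Y' - u) by rewrite ler_wpM2r.
suff [h1 h2 h3] : [/\ q (Y' - u) <= 3, - (e * q Y') <= y' - q Y' & y' - q Y' <= 1] by [].
move: cap' low' tri qY'u etri e4q e4 eu.
have -> : (1 - e) * q Y' = q Y' - e * q Y' by ring.
rewrite -!(mulrA _ e); move: (e * q Y') (e * q u) (e * quad_form Q (Y' - u)).
move: (quad_form Q (Y' - u)) (q u) (q Y') => g1 g2 g3 g4 g5 g6; clear.
by move=> h1 h2 h3 h4 h5 h6 h7 h8; split; lra.
Unshelve. all: by end_near. Qed.

End blow_up.

(* A slab of size comparable to the cap, inside the cap and away from the
   paraboloid. *)
Lemma slab_in_cap (R : realType) (n : nat) (K : set 'rV[R]_n) X N (Q : 'M[R]_n) u :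
  paraboloid_contact K X N Q -> orthv N u -> exists2 rho : R, 0 < rho & forall e : R, 0 < e < 1 ->
  8 * e * (2 * quad_form Q u + 1) <= 1 -> \forall s \near 0^'+,
    forall x, slab (scaled_pt X N s u (quad_form Q u + 1 / 2)) N (rho * s) (rho * s ^+ 2) x ->
    K x /\ exists Y, exists2 y : R, orthv N Y &
      [/\ x = scaled_pt X N s Y y, quad_form Q (Y - u) <= 1, 1 / 4 <= y - quad_form Q Y <= 1 &
          cap_height Q u s (s *: Y) (s ^+ 2 * y) < s ^+ 2].
Proof.
move=> hc uN; have N1 := contact_unit hc; have QT := contact_sym hc.
have [L L0 HL] := bilin_bound Q.
have qu := contact_quad_ge0 hc uN.
pose c : R := n%:R + 1.
have c1 : 1 <= c by rewrite lerDr.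
have c0 : 0 < c by lra.
(* A displacement [(W, w)] within the slab changes [y - q Y] by at most [rho * E]; the three terms
   account for [w], the bilinear term and [q W]. *)
pose E := 1 + 2 * (L * (`|u| * c)) + L * (c * c).
have Lu0 : 0 <= L * (`|u| * c) by rewrite !mulr_ge0//; lra.
have Lc0 : 0 < L * (c * c) by rewrite !mulr_gt0.
have E1 : 1 <= E by rewrite /E; lra.
have E0 : 0 < E by lra.
(* Keeps [y - q Y] within 1/8 of its value 1/2 at the centre of the slab. It does not depend on [e],
   which is later chosen small against the volume of the slab. *)
pose rho := (8 * E)^-1.
have rho0 : 0 < rho by rewrite invr_gt0 mulr_gt0.
have rhoE : rho * E = 1 / 8 by rewrite /rho; field; lra.
have rho1 : rho <= 1.
  by rewrite /rho invf_le1; [lra|rewrite mulr_gt0].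
exists rho => // e e01 eu.
have [a a0 Ha] := contact_near hc e01.
near=> s => x [xZ xN].
have s0 : 0 < s by near: s; exact: nbhs_right_gt.
have s1 : s < 1 by near: s; apply: nbhs_right_lt.
have sa1 : (`|u| + c) * s < a by near: s; exact: near0_lin.
have sa2 : (quad_form Q u + 2) * s < a by near: s; exact: near0_lin.
have s20 : 0 < s ^+ 2 by rewrite exprn_gt0.
set Z := scaled_pt _ _ _ _ _ in xZ xN.
have [W0 [w0 W0N xE]] := frame_ptP Z x N1.
have [W [w WN [WE wE]]] := unscale w0 s0 W0N.
have xZW := frame_pt_norm_Y Z w0 W0N N1.
have Wc : `|W| <= c * rho.
  rewrite -(ler_pM2l s0) -[s * `|W|](_ : `|s *: W| = _); last first.
    by rewrite normrZ gtr0_norm.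
  by rewrite -WE (le_trans xZW)// -xE mulrCA ler_wpM2l ?(ltW c0)// mulrC.
have wr : `|w| <= rho.
  move: xN; rewrite xE frame_pt_dot// wE normrM gtr0_norm// mulrC.
  by rewrite ler_pM2r.
have BW : `|bilin Q u W| <= L * (`|u| * c) * rho.
  by rewrite (le_trans (HL _ _))// -!mulrA ler_wpM2l ?(ltW L0)// ler_wpM2l.
have qW0 := contact_quad_ge0 hc WN.
have qW : quad_form Q W <= L * (c * c) * rho.
  rewrite (le_trans (ler_norm _))// quad_form_bilin (le_trans (HL _ _))//.
  rewrite -mulrA ler_wpM2l ?(ltW L0)// (@le_trans _ _ ((c * rho) * (c * rho)))//.
    by rewrite ler_pM.
  rewrite (_ : c * rho * (c * rho) = c * c * rho * rho); last ring.
  by rewrite ler_piMr// !mulr_ge0// ltW.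
have YN : orthv N (u + W) by exact: orthvD.
have qY : quad_form Q (u + W) = quad_form Q u + 2 * bilin Q u W + quad_form Q W by rewrite quad_formD.
have sumE : rho + 2 * (L * (`|u| * c) * rho) + L * (c * c) * rho = 1 / 8.
  by rewrite -rhoE /E; ring.
have := ler_norm (bilin Q u W); have := ler_norm (- bilin Q u W); rewrite normrN => B1 B2.
have := ler_norm w; have := ler_norm (- w); rewrite normrN => w1 w2.
have Lur : 0 <= L * (`|u| * c) * rho by rewrite mulr_ge0// ltW.
have sig : 3 / 8 <= quad_form Q u + 1 / 2 + w - quad_form Q (u + W) <= 5 / 8.
  by rewrite qY; clear -B1 B2 w1 w2 BW qW qW0 wr sumE; lra.
have qWs : quad_form Q W <= 1 / 8 by clear -qW sumE Lur rho0; lra.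
have Wu : u + W - u = W by rewrite addrAC subrr add0r.
have xP : x = scaled_pt X N s (u + W) (quad_form Q u + 1 / 2 + w).
  by rewrite xE /Z /scaled_pt WE wE; apply/rowP => i; rewrite !mxE; ring.
split; last first.
  exists (u + W), (quad_form Q u + 1 / 2 + w) => //; split => //.
  - by rewrite Wu (le_trans qWs)// ler_pdivrMr// mul1r ler1n.
  - by move: sig; move: (_ - quad_form Q (u + W)) => g; clear; lra.
  - rewrite (cap_heightE hc) -[ltRHS]mulr1 ltr_pM2l// Wu.
    by move: sig qWs; move: (_ - quad_form Q (u + W)) (quad_form Q W) => g1 g2; clear; lra.
have qYu : quad_form Q (u + W) <= 2 * quad_form Q u + 1.
  have := quad_form_triangle hc uN YN; rewrite Wu.
  by move: qWs; move: (quad_form Q W) (quad_form Q u) (quad_form Q (u + W)) => g1 g2 g3; clear; lra.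
rewrite xP /scaled_pt.
have sYa : `|s *: (u + W)| <= a.
  rewrite normrZ gtr0_norm// ltW// (le_lt_trans _ sa1)// mulrC ler_wpM2r ?(ltW s0)//.
  rewrite (le_trans (ler_normD _ _))// lerD2l (le_trans Wc)// ler_piMr// ltW//.
have yn : `|quad_form Q u + 1 / 2 + w| <= quad_form Q u + 2.
  have H : quad_form Q u + 1 / 2 + w <= quad_form Q u + 2.
    by move: (le_trans w2 (le_trans wr rho1)); move: (quad_form Q u) (w) => g1 g2; clear; lra.
  have H' : - (quad_form Q u + 2) <= quad_form Q u + 1 / 2 + w.
    by move: (le_trans w1 (le_trans wr rho1)) (qu); move: (quad_form Q u) (w) => g1 g2; clear; lra.
  by rewrite ler_norml H'.
have sya : `|s ^+ 2 * (quad_form Q u + 1 / 2 + w)| <= a.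
  rewrite normrM (gtr0_norm s20) ltW// (le_lt_trans _ sa2)// mulrC ler_pM//; first exact: ltW.
  by rewrite expr2 ler_piMl ?ltW.
have [_] := Ha _ _ (orthvZ s YN) sYa sya; apply.
rewrite quad_formZ mulrCA ler_pM2l//.
have /andP[e0 e1] := e01.
have eq : e * quad_form Q (u + W) <= e * (2 * quad_form Q u + 1) by rewrite ler_wpM2l// ltW.
rewrite mulrDl mul1r; move: eq eu sig; rewrite -mulrA.
move: (e * _) (e * _) => p1 p2; move: (quad_form Q (u + W)) (quad_form Q u) => p3 p4; clear; lra.
Unshelve. all: by end_near. Qed.

(** * Removing caps *)

Section cut.
Context {R : realType} {n : nat}.

Local Notation "'I[ D ] g" := (\int[@lebesgue_rV R n]_(x in D) g x)
  (at level 36, D at level 200, g at level 36).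

(** Leading term of order [k] under the parabolic scaling, uniformly on bounded sets. It serves for
    [k] equal to 0, 1 and 2 in turn, as the vanishing of each term exposes the next. *)
Definition has_expansion (X N : 'rV[R]_n) (f : 'rV[R]_n -> R) (k : nat)
    (h : 'rV[R]_n -> R -> R) := forall r : R, 1 <= r ->
  exists2 C : R, 0 <= C & forall (s : R) Y (y : R), 0 < s <= 1 -> orthv N Y ->
    `|Y| <= r -> `|y| <= r ->
    `|f (scaled_pt X N s Y y) - s ^+ k * h Y y| <= C * s ^+ k.+1.

(** On the cap [y - q Y] may be as low as [- e * q Y], so the hypothesis on [h] leaves a positive
    part of relative size [e]. The slab of [slab_in_cap], where [y - q Y >= 1 / 4], outweighs it. As
    [k <= 2 <= n], the quadratic error, of order [s ^ (2 n + 2)], is negligible against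
    [s ^ k * s ^ (n + 1)]. *)
Lemma cut_contradiction (sym : bool) d (K : set 'rV[R]_n) X N (Q : 'M[R]_n) u k h (kappa : R) :
  (2 <= n)%N -> d = @hausdorff_dist R n \/ d = @banach_mazur_dist R n ->
  convex_body K -> (sym -> centrally_symmetric K) -> locally_maximal sym d K ->
  paraboloid_contact K X N Q -> orthv N u -> (k <= 2)%N -> 0 < kappa ->
  has_expansion X N (variation_density K) k h ->
  (forall Y (y : R), orthv N Y -> quad_form Q (Y - u) <= 10 -> `|y - quad_form Q Y| <= 10 ->
    h Y y <= - kappa * (y - quad_form Q Y)) -> False.
Proof.
move=> n2 hd hK symK Hmax hc uN k2 kappa0 Hexp Hh.
have n0 : (0 < n)%N by apply: leq_trans n2.
have N1 := contact_unit hc.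
have [P [r r0 [P0 [Pr [C [v0 v00 [sig0 sig00 HC]]]]]]] := cut_principle n0 hd hK symK Hmax.
clear hd Hmax.
have [M M0 HM] := body_frame_bound hK hc.
have [L L0 HL] := bilin_bound Q.
have c10 : (0 : R) <= 10 by [].
have [rr rr1 Hrr] := scaled_bounds hc c10 uN.
have [VC VC0 HVC] := volume_scaled_le hc n0 rr1.
have [rho rho0 Hrho] := slab_in_cap hc uN.
have [c1 c1_0 Hc1] := volume_slab_ge hc n0 rho0.
have [Cf Cf0 HCf] := Hexp _ rr1.
have qu := contact_quad_ge0 hc uN.
(* The conditions on [e] are those of [cap_location] and [slab_in_cap], then [e * rr <= 1] to stay
   in the region where [h] is controlled, and last that the positive part be at most a quarter of
   what the slab contributes. *)
have [e [e01 e4 eu eqs erV]] : exists e : R, [/\ 0 < e < 1, 4 * e <= 1,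
    4 * e * quad_form Q u <= 1, 8 * e * (2 * quad_form Q u + 1) <= 1 &
    e * rr <= 1 /\ 16 * (rr * VC) * e <= c1].
  near (0 : R)^'+ => e; exists e; split.
  - apply/andP; split; first by near: e; exact: nbhs_right_gt.
    by near: e; apply: nbhs_right_lt.
  - by apply: ltW; near: e; exact: near0_lin.
  - rewrite mulrAC; apply: ltW; near: e; exact: near0_lin.
  - rewrite mulrAC; apply: ltW; near: e; exact: near0_lin.
  - split; last by apply: ltW; near: e; exact: near0_lin.
    by rewrite mulrC; apply: ltW; near: e; exact: near0_lin.
have /andP[e0 e1] := e01.
have [YP [yP YPN PE]] := frame_ptP X P N1.
have KP : K P by apply: Pr; rewrite subrr normr0 ltW.
have yPr : r <= yP.
  have : 0 <= yP - r; last by rewrite subr_ge0.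
  apply: (contact_ge0 hc YPN); apply: Pr; rewrite PE.
  have -> : frame_pt X N YP (yP - r) - frame_pt X N YP yP = (- r) *: N.
    by apply/rowP => i; rewrite !mxE; ring.
  rewrite normrZ normrN gtr0_norm// ler_piMr ?(ltW r0)//.
  exact: unit_norm_le1.
pose c : R := 2 * (L * (`|u| * M)).
have c0 : 0 <= c by rewrite !mulr_ge0// ltW.
pose A := Cf * c1 + Cf * VC + `|C| * (VC * VC).
near (0 : R)^'+ => s.
have s0 : 0 < s by near: s; exact: nbhs_right_gt.
have s1 : s < 1 by near: s; apply: nbhs_right_lt.
have s01 : 0 < s <= 1 by rewrite s0 ltW.
have ssig : (c + 1) / r * s < sig0 by near: s; exact: near0_lin.
have ssig1 : (c + 1) / r * s < 1 by near: s; exact: near0_lin.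
have sv : VC * s < v0 by near: s; exact: near0_lin.
have sA : A * s < kappa * c1 / 8.
  by near: s; apply: near0_lin; rewrite divr_gt0// mulr_gt0.
have s20 : 0 < s ^+ 2 by rewrite exprn_gt0.
have Hloc : forall Y (y : R), orthv N Y -> K (frame_pt X N Y y) ->
    cap_height Q u s Y y < s ^+ 2 ->
    exists Y', exists2 y' : R, orthv N Y' & [/\ Y = s *: Y', y = s ^+ 2 * y',
      quad_form Q (Y' - u) <= 3,
      - (e * quad_form Q Y') <= y' - quad_form Q Y' & y' - quad_form Q Y' <= 1].
  by near: s; exact: (cap_location hK hc uN e01 e4 eu).
have HS : forall x, slab (scaled_pt X N s u (quad_form Q u + 1 / 2)) N (rho * s) (rho * s ^+ 2) x ->
    K x /\ exists Y, exists2 y : R, orthv N Y &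
      [/\ x = scaled_pt X N s Y y, quad_form Q (Y - u) <= 1, 1 / 4 <= y - quad_form Q Y <= 1 &
          cap_height Q u s (s *: Y) (s ^+ 2 * y) < s ^+ 2].
  by near: s; exact: (Hrho e e01 eqs).
have [l [lc laff lE]] := cap_functional hc u s.
have lK x : K x -> - (c * s) <= l x.
  have [Y [y YN ->]] := frame_ptP X x N1; move=> Kx.
  rewrite lE// /cap_height; have y0 := contact_ge0 hc YN Kx.
  have [YM _] := HM _ _ YN Kx.
  have BM : bilin Q u Y <= L * (`|u| * M).
    rewrite (le_trans (ler_norm _))// (le_trans (HL _ _))// ler_wpM2l ?(ltW L0)//.
    by rewrite ler_wpM2l.
  have sBM := ler_wpM2l (ltW s0) BM.
  have sq : 0 <= s ^+ 2 * quad_form Q u by rewrite mulr_ge0// ltW.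
  have -> : - (c * s) = - 2 * (s * (L * (`|u| * M))) by rewrite /c; ring.
  have -> : 2 * s * bilin Q u Y = 2 * (s * bilin Q u Y) by ring.
  move: sBM sq y0; move: (s * bilin _ _ _) (s * (L * _)) (s ^+ 2 * _) => z1 z2 z3.
  by clear; lra.
have lP : r - c * s <= l P.
  have := lK P KP; rewrite PE lE// /cap_height => lPK.
  have [YM _] : `|YP| <= M /\ `|yP| <= M by apply: HM => //; rewrite -PE.
  have BM : bilin Q u YP <= L * (`|u| * M).
    rewrite (le_trans (ler_norm _))// (le_trans (HL _ _))// ler_wpM2l ?(ltW L0)//.
    by rewrite ler_wpM2l.
  have sBM := ler_wpM2l (ltW s0) BM.
  have sq : 0 <= s ^+ 2 * quad_form Q u by rewrite mulr_ge0// ltW.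
  have -> : c * s = 2 * (s * (L * (`|u| * M))) by rewrite /c; ring.
  have -> : 2 * s * bilin Q u YP = 2 * (s * bilin Q u YP) by ring.
  move: sBM sq yPr; move: (s * bilin _ _ _) (s * (L * _)) (s ^+ 2 * _) => z1 z2 z3.
  by clear; lra.
(* The functional is at least [- c * s] on [K] and [r - c * s] at [P]; moving by [sig] towards [P]
   therefore raises it to at least [s >= s ^+ 2]. *)
pose sig := (c + 1) / r * s.
have sig_0 : 0 <= sig by rewrite mulr_ge0 ?(ltW s0)// divr_ge0 ?(ltW r0)// addr_ge0.
have sigr : sig * r = (c + 1) * s by rewrite /sig; field; rewrite gt_eqF.
have Hl x : K x -> s ^+ 2 <= l ((1 - sig) *: x + sig *: P).
  move=> Kx; rewrite laff.
  have h1 : (1 - sig) * - (c * s) <= (1 - sig) * l x.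
    by rewrite ler_wpM2l ?lK// subr_ge0 ltW.
  have h2 := ler_wpM2l sig_0 lP.
  have ss : s ^+ 2 <= s by rewrite expr2 ler_piMl// ltW.
  have h3 : (1 - sig) * - (c * s) + sig * (r - c * s) = (c + 1) * s - c * s.
    by rewrite -sigr; ring.
  by move: h1 h2 h3 ss; clear; lra.
have sig_s0 : 0 <= sig <= sig0 by rewrite sig_0 ltW.
have := HC l (s ^+ 2) sig lc laff sig_s0 Hl.
set D := (X in let D := X in _) => -[bD HD].
pose f := variation_density K.
have cf : continuous f := @cont_variation_density R n K.
(* [b1] bounds the density from above on the whole cap, and [- b2] does so on the slab. *)
pose b1 := s ^+ k * (kappa * (e * rr) + Cf * s).
pose b2 := s ^+ k * (kappa / 4 - Cf * s).
have sk0 : 0 < s ^+ k by rewrite exprn_gt0.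
have capD x : K x -> l x < s ^+ 2 -> exists Y, exists2 y : R,
    [/\ orthv N Y, `|Y| <= rr & `|y| <= rr] & x = scaled_pt X N s Y y /\ f x <= b1.
  have [Y0 [y0 Y0N ->]] := frame_ptP X x N1; move=> Kx; rewrite lE// => lx.
  have [Y [y YN [-> -> Yu sgl sgu]]] := Hloc _ _ Y0N Kx lx.
  have qY0 := contact_quad_ge0 hc YN.
  have Yu10 : quad_form Q (Y - u) <= 10 by move: Yu; clear; lra.
  have erq : 0 <= e * quad_form Q Y by rewrite mulr_ge0// ltW.
  have [Yr yr qYr] : [/\ `|Y| <= rr, `|y| <= rr & quad_form Q Y <= rr].
    have [|Yr _ qYr] := Hrr Y (quad_form Q Y) YN Yu10; first by rewrite subrr normr0.
    apply: Hrr => //; rewrite ler_norml.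
    have eqr : e * quad_form Q Y <= e * rr by rewrite ler_wpM2l// ltW.
    by apply/andP; split; move: eqr erV.1 sgl sgu; clear; lra.
  have sg10 : `|y - quad_form Q Y| <= 10.
    have eqr : e * quad_form Q Y <= e * rr by rewrite ler_wpM2l// ltW.
    rewrite ler_norml.
    by apply/andP; split; move: eqr erV.1 sgl sgu; clear; lra.
  exists Y, y; first by split.
  split => //.
  have := HCf s Y y s01 YN Yr yr; rewrite -/f => /ler_normlP[_ Hf].
  have h1 := Hh Y y YN Yu10 sg10.
  have h2 : h Y y <= kappa * (e * rr).
    apply: (le_trans h1); rewrite mulNr -mulrN ler_pM2l//.
    have : e * quad_form Q Y <= e * rr by rewrite ler_wpM2l// ltW.
    by move: sgl; clear; lra.
  have h3 := ler_wpM2l (ltW sk0) h2.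
  have -> : b1 = s ^+ k * (kappa * (e * rr)) + Cf * s ^+ k.+1 by rewrite /b1 exprSr; ring.
  by move: Hf h3; rewrite /scaled_pt; clear; lra.
have fN : sym -> forall x, f (- x) = f x.
  by move=> hs; apply: variation_density_even => //; exact: symK.
have DD x : D x -> exists Y, exists2 y : R,
    [/\ orthv N Y, `|Y| <= rr & `|y| <= rr] &
    (x = scaled_pt X N s Y y \/ - x = scaled_pt X N s Y y) /\ f x <= b1.
  move=> [Kx [lx|[hs lx]]].
    by have [Y [y Yy [-> fx]]] := capD _ Kx lx; exists Y, y => //; split => //; left.
  have KNx : K (- x) by have /centrally_symmetricP := symK hs; exact.
  have [Y [y Yy [xE fx]]] := capD _ KNx lx; exists Y, y => //.
  by rewrite fN// in fx; split => //; right.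
have VD : volume D <= VC * s ^+ n.+1.
  apply: HVC => // x /DD[Y [y Yy [xE _]]]; by exists Y, y.
set S := slab _ _ _ _ in HS.
have [bS VS] := Hc1 s (scaled_pt X N s u (quad_form Q u + 1 / 2)) s01.
rewrite -/S in bS VS; have [mS _] := bS.
have SD : S `<=` D.
  move=> x Sx; have [Kx [Y [y YN [xE _ _ cap]]]] := HS x Sx.
  by split => //; left; rewrite xE /scaled_pt lE//; exact: orthvZ.
have Sf x : S x -> f x <= - b2.
  move=> Sx; have [Kx [Y [y YN [xE Yu /andP[sg1 sg2] _]]]] := HS x Sx.
  have Yu10 : quad_form Q (Y - u) <= 10 by move: Yu; clear; lra.
  have sg10 : `|y - quad_form Q Y| <= 10.
    by rewrite ler_norml; apply/andP; split; move: sg1 sg2; clear; lra.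
  have [Yr yr _] := Hrr _ _ YN Yu10 sg10.
  have := HCf s Y y s01 YN Yr yr; rewrite -/f -xE => /ler_normlP[_ Hf].
  have h1 := Hh Y y YN Yu10 sg10.
  have h2 : h Y y <= - (kappa / 4).
    apply: (le_trans h1); rewrite mulNr lerN2 ler_pM2l//.
    by move: sg1; clear; lra.
  have h3 := ler_wpM2l (ltW sk0) h2.
  have -> : - b2 = s ^+ k * - (kappa / 4) + Cf * s ^+ k.+1 by rewrite /b2 exprSr; ring.
  by move: Hf h3; clear; lra.
have b1_0 : 0 <= b1.
  by rewrite mulr_ge0 ?(ltW sk0)// addr_ge0// mulr_ge0// ?mulr_ge0 ?(ltW kappa0) ?(ltW e0) ?(ltW s0)//; move: rr1; clear; lra.
have b2_0 : 0 <= b2.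
  rewrite mulr_ge0 ?(ltW sk0)// subr_ge0.
  have : Cf * s * c1 <= kappa / 8 * c1.
    have : 0 <= (Cf * VC + `|C| * (VC * VC)) * s.
      by rewrite mulr_ge0 ?(ltW s0)// addr_ge0// !mulr_ge0// ltW.
    by move: sA; rewrite /A; clear; lra.
  rewrite ler_pM2r// => H; apply: (le_trans H).
  by move: (kappa) (kappa0); clear; move=> *; lra.
have bDS : bounded_measurable (D `\` S) by exact: bounded_measurableD.
have I1 : 'I[S] f <= - b2 * volume S.
  by rewrite -rint_cst//; apply: rint_le => //; exact: cont_cst.
have I2 : 'I[D `\` S] f <= b1 * volume (D `\` S).
  rewrite -rint_cst//; apply: rint_le => //; first exact: cont_cst.
  by move=> x [/DD[Y [y _ [_ fx]]] _].
have IE : 'I[D] f = 'I[S] f + 'I[D `\` S] f by exact: rint_setD.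
have VDS : volume (D `\` S) <= volume D.
  by have [mDS _] := bDS; apply: (volume_le bD mDS); exact: subDsetl.
have sn0 : 0 < s ^+ n.+1 by rewrite exprn_gt0.
have snk : s ^+ n.+1 <= s ^+ k * s.
  by rewrite -exprSr; apply: ler_wiXn2l; [exact: ltW|exact: ltW|rewrite ltnS (leq_trans k2)].
have sns : s ^+ n.+1 <= s.
  by rewrite -[leRHS]expr1; apply: ler_wiXn2l; [exact: ltW|exact: ltW|].
have Dv0 : volume D <= v0.
  by rewrite (le_trans VD)// (le_trans _ (ltW sv))// ler_wpM2l// ltW.
have VD0 := volume_ge0 D.
have HCD : C * volume D ^+ 2 <= `|C| * (VC * VC) * (s ^+ k * s) * s ^+ n.+1.
  have -> : `|C| * (VC * VC) * (s ^+ k * s) * s ^+ n.+1 =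
      `|C| * ((VC * s ^+ n.+1) * (VC * (s ^+ k * s))) by ring.
  apply: (@le_trans _ _ (`|C| * volume D ^+ 2)).
    by rewrite ler_wpM2r ?sqr_ge0// ler_norm.
  rewrite ler_wpM2l// expr2; apply: ler_pM => //.
  by rewrite (le_trans VD)// ler_wpM2l// ltW.
have J1 : b2 * (c1 * s ^+ n.+1) <= b2 * volume S by rewrite ler_wpM2l.
have J2 : b1 * volume (D `\` S) <= b1 * (VC * s ^+ n.+1).
  by rewrite ler_wpM2l// (le_trans VDS).
have : (b2 * c1 - b1 * VC) * s ^+ n.+1 <= `|C| * (VC * VC) * (s ^+ k * s) * s ^+ n.+1.
  apply: le_trans HCD; apply: le_trans (HD Dv0); rewrite -/f IE.
  have -> : (b2 * c1 - b1 * VC) * s ^+ n.+1 = b2 * (c1 * s ^+ n.+1) - b1 * (VC * s ^+ n.+1) by ring.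
  rewrite mulNr in I1; rewrite opprD; apply: lerD.
    by rewrite (le_trans J1)// lerNr.
  by rewrite lerN2 (le_trans I2).
rewrite ler_pM2r// /b1 /b2.
have -> : s ^+ k * (kappa / 4 - Cf * s) * c1 - s ^+ k * (kappa * (e * rr) + Cf * s) * VC =
   s ^+ k * ((kappa / 4 - Cf * s) * c1 - (kappa * (e * rr) + Cf * s) * VC) by ring.
have -> : `|C| * (VC * VC) * (s ^+ k * s) = s ^+ k * (`|C| * (VC * VC) * s) by ring.
rewrite ler_pM2l//; apply/negP; rewrite -ltNge.
have := ler_wpM2l (ltW kappa0) erV.2.
have kc : 0 < kappa * c1 by rewrite mulr_gt0.
move: sA; rewrite /A.
have -> : kappa * (16 * (rr * VC) * e) = 16 * (kappa * (e * rr) * VC) by ring.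
rewrite !mulrDl !mulNr.
have -> : Cf * c1 * s = Cf * s * c1 by ring.
have -> : Cf * VC * s = Cf * s * VC by ring.
have -> : kappa / 4 * c1 = kappa * c1 / 4 by ring.
move: kc; move: (kappa * c1) (Cf * s * c1) (Cf * s * VC) (kappa * (e * rr) * VC) (`|C| * _ * s).
by clear; move=> *; lra.
Unshelve. all: by end_near. Qed.

End cut.

(** * Adding tips *)

Section tip.
Context {R : realType} {n : nat}.

Lemma scaled_pt_conv (X N : 'rV[R]_n) s Y1 Y2 (y1 y2 l : R) :
  (1 - l) *: scaled_pt X N s Y1 y1 + l *: scaled_pt X N s Y2 y2 =
  scaled_pt X N s ((1 - l) *: Y1 + l *: Y2) ((1 - l) * y1 + l * y2).
Proof. by apply/rowP => i; rewrite !mxE; ring. Qed.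

(** Here [t] is the weight of a body point at horizontal distance [Z] from the tip and at height
    [y], and [b] is the bilinear term of [u] and [Z]. The body point is above the lower paraboloid
    and the mixed point below the upper one; in the combination [b] cancels up to terms in [e],
    which leaves an upper bound on [t * (1 - t) * qZ]. *)
Lemma tip_cone_estimate (qu qZ b e t y : R) : 0 <= qu -> 0 <= qZ -> 0 < e ->
  16 * e <= 1 -> 8 * e * qu <= 1 -> 0 <= t <= 1 / 2 ->
  (1 - e) * (qu + 2 * b + qZ) <= y ->
  t * y + (1 - t) * (qu - 1) < (1 + e) * (qu + 2 * t * b + t ^+ 2 * qZ) ->
  qu + 2 * t * b + t ^+ 2 * qZ <= 2 * qu + 2 * (t ^+ 2 * qZ) ->
  qu + 2 * b + qZ <= 2 * qu + 2 * qZ -> t * qZ <= 4.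
Proof.
move=> qu0 qZ0 e0 e16 eu /andP[t0 t1] low up tri1 tri2.
have {}low := ler_wpM2l t0 low.
have te : 0 <= t * e by rewrite mulr_ge0// ltW.
have {}tri2 := ler_wpM2l te tri2.
have {}tri1 := ler_wpM2l (ltW e0) tri1.
have z0 : 0 <= t * qZ by rewrite mulr_ge0.
have tz : t * (t * qZ) <= 1 / 2 * (t * qZ) by rewrite ler_wpM2r.
have etz : e * (t * (t * qZ)) <= e * (1 / 2 * (t * qZ)) by rewrite ler_wpM2l// ltW.
have ez : 16 * e * (t * qZ) <= 1 * (t * qZ) by rewrite ler_wpM2r.
have eqt : t * (e * qu) <= 1 / 2 * (e * qu) by rewrite ler_wpM2r// mulr_ge0// ltW.
have key : t * qZ - t * (t * qZ) < (1 - t) + 3 * (e * qu) + 3 * (e * (t * qZ)).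
  have low' : t * ((1 - e) * (qu + 2 * b + qZ)) =
    t * qu + 2 * (t * b) + t * qZ - t * e * (qu + 2 * b + qZ) by ring.
  have up' : (1 + e) * (qu + 2 * t * b + t ^+ 2 * qZ) =
    qu + 2 * (t * b) + t * (t * qZ) + e * (qu + 2 * t * b + t ^+ 2 * qZ) by ring.
  have tri1' : e * (2 * qu + 2 * (t ^+ 2 * qZ)) = 2 * (e * qu) + 2 * (e * (t * (t * qZ))) by ring.
  have tri2' : t * e * (2 * qu + 2 * qZ) = 2 * (t * (e * qu)) + 2 * (e * (t * qZ)) by ring.
  rewrite tri1' in tri1; rewrite tri2' in tri2; rewrite low' in low; rewrite up' in up.
  have up2 : (1 - t) * (qu - 1) = qu - t * qu - 1 + t by ring.
  rewrite up2 in up.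
  have e3 : e * (1 / 2 * (t * qZ)) = 1 / 2 * (e * (t * qZ)) by ring.
  rewrite e3 in etz.
  have eqt0 : 0 <= e * qu by rewrite mulr_ge0// ltW.
  move: low up tri1 tri2 etz eqt eqt0.
  move: (e * (qu + _ + _)) (t * e * (qu + _ + _)) (t * y) (e * (t * (t * qZ))) (t * (e * qu)) (e * (t * qZ)).
  move: (t * (t * qZ)) (e * qu) (t * qZ) (t * b) (t * qu).
  by clear; move=> *; lra.
rewrite leNgt; apply/negP => z4.
have : (1 - t) * (t * qZ - 1) < 3 * (e * qu) + 3 * (e * (t * qZ)) by move: (key); clear; lra.
have : 1 / 2 * (t * qZ - 1) <= (1 - t) * (t * qZ - 1).
  by rewrite ler_wpM2r; [|move: (z4); clear; lra|move: (t1); clear; lra].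
move: z4 ez eu; rewrite -!mulrA; move: (e * (t * qZ)) (e * qu) (t * qZ) ((1 - t) * _).
by clear; move=> *; lra.
Qed.

(** The base point [k] of the cone may be far from [X]. In that case the point at the fixed fraction
    [g] of the way from the tip to [k] is near [X] and already in [K]: its height is about [g * yk],
    while the form there is of order [s ^ 2 + g ^ 2]. A point outside [K] is then between it and the
    tip, so it can replace [k]. *)
Lemma tip_localize (K : set 'rV[R]_n) X N (Q : 'M[R]_n) u (a e : R) :
  convex_body K -> paraboloid_contact K X N Q -> orthv N u -> 0 < a -> 0 < e < 1 ->
  (forall Y y, orthv N Y -> `|Y| <= a -> `|y| <= a ->
      (1 + e) * quad_form Q Y <= y -> K (frame_pt X N Y y)) ->
  \forall s \near 0^'+, forall x, ~ K x -> cone_tip K (scaled_pt X N s u (quad_form Q u - 1)) x ->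
    exists Y, exists y : R, exists2 t : R, 0 <= t <= 1 &
      [/\ orthv N Y, `|Y| <= a, `|y| <= a, K (frame_pt X N Y y) &
          x = (1 - t) *: frame_pt X N Y y + t *: scaled_pt X N s u (quad_form Q u - 1)].
Proof.
move=> hK hc uN a0 /andP[e0 e1] Ha.
have N1 := contact_unit hc; have QT := contact_sym hc.
have [h h0 Hh] := contact_local hc a0.
have [M M0 HM] := body_frame_bound hK hc.
have [L L0 HL] := bilin_bound Q.
have qu := contact_quad_ge0 hc uN.
have [_ /convex_setP convK _] := hK.
pose Mq := L * (M * M).
have Mq0 : 0 < Mq by rewrite !mulr_gt0.
(* The third condition makes the form, about [g ^+ 2 * Mq], small against the height [g * h]; the
   last keeps the intermediate point within range [a]. *)
have [g [g0 g1 gM ga]] : exists g : R, [/\ 0 < g, g < 1, 8 * Mq * g < h & M * g < a / 2].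
  near (0 : R)^'+ => g; exists g; split; near: g.
  - exact: nbhs_right_gt.
  - exact: nbhs_right_lt.
  - exact: near0_lin.
  - by apply: near0_lin; rewrite divr_gt0.
near=> s => x nKx [k Kk [t t01 xE]].
have s0 : 0 < s by near: s; exact: nbhs_right_gt.
have s1 : s < 1 by near: s; apply: nbhs_right_lt.
have sh : (4 * quad_form Q u + 1) * s < g * h / 2.
  by near: s; apply: near0_lin; rewrite divr_gt0// mulr_gt0.
have sa1 : `|u| * s < a / 2 by near: s; apply: near0_lin; rewrite divr_gt0.
have sa2 : (quad_form Q u + 1) * s < a / 2 by near: s; apply: near0_lin; rewrite divr_gt0.
have s20 : 0 < s ^+ 2 by rewrite exprn_gt0.
have ss : s ^+ 2 <= s by rewrite expr2 ler_piMl// ltW.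
have [Yk [yk YkN kE]] := frame_ptP X k N1.
have KYk : K (frame_pt X N Yk yk) by rewrite -kE.
have [ykh|hyk] := ltP yk h.
  by have [Ya ya] := Hh _ _ YkN KYk ykh; exists Yk, yk, t => //; split => //; rewrite -kE.
have [YkM ykM] := HM _ _ YkN KYk.
pose Y := (1 - g) *: (s *: u) + g *: Yk.
pose y := (1 - g) * (s ^+ 2 * (quad_form Q u - 1)) + g * yk.
have YN : orthv N Y by apply: orthvD; do ?[apply: orthvZ].
have g1' : 0 <= 1 - g <= 1 by move: (g0) (g1); clear; move=> *; lra.
have gYk : g * `|Yk| <= a / 2.
  by rewrite (le_trans _ (ltW ga))// mulrC ler_wpM2r// ltW.
have gyk : g * `|yk| <= a / 2.
  by rewrite (le_trans _ (ltW ga))// mulrC ler_wpM2r// ltW.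
have Ya : `|Y| <= a.
  rewrite (le_trans (ler_normD _ _))// !normrZ (gtr0_norm g0) (gtr0_norm s0).
  have /andP[g1a g1b] := g1'; rewrite (ger0_norm g1a).
  have : (1 - g) * (s * `|u|) <= s * `|u| by rewrite ler_piMl// mulr_ge0// ltW.
  by move: (gYk) (sa1); rewrite [`|u| * s]mulrC; clear; lra.
have qu1 : `|quad_form Q u - 1| <= quad_form Q u + 1.
  by rewrite ler_norml; apply/andP; split; move: (qu); clear; lra.
have ya : `|y| <= a.
  rewrite (le_trans (ler_normD _ _))// !normrM (gtr0_norm g0) (gtr0_norm s0) -expr2.
  have /andP[g1a g1b] := g1'; rewrite (ger0_norm g1a).
  have H1 : (1 - g) * (s ^+ 2 * `|quad_form Q u - 1|) <= s ^+ 2 * `|quad_form Q u - 1|.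
    by rewrite ler_piMl// mulr_ge0// ltW.
  have H2 : s ^+ 2 * `|quad_form Q u - 1| <= s * (quad_form Q u + 1) by rewrite ler_pM// ltW.
  by move: (gyk) (sa2) (H1) (H2); rewrite [(quad_form Q u + 1) * s]mulrC; clear; lra.
have KY : K (frame_pt X N Y y).
  apply: Ha => //.
  have qYk : quad_form Q Yk <= Mq.
    rewrite (le_trans (ler_norm _))// quad_form_bilin (le_trans (HL _ _))//.
    by rewrite ler_wpM2l ?(ltW L0)// ler_pM.
  have qY0 := contact_quad_ge0 hc YN.
  have qY : quad_form Q Y <= 2 * (s ^+ 2 * quad_form Q u) + 2 * (g ^+ 2 * Mq).
    have A0N : orthv N ((1 - g) *: (s *: u)) by do 2 apply: orthvZ.
    rewrite (le_trans (quad_form_triangle hc A0N YN))// /Y addrAC subrr add0r !quad_formZ.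
    have H1 : (1 - g) ^+ 2 * (s ^+ 2 * quad_form Q u) <= s ^+ 2 * quad_form Q u.
      rewrite ler_piMl ?mulr_ge0 ?(ltW s20)//; have /andP[g1a g1b] := g1'.
      by rewrite expr_le1.
    have H2 : g ^+ 2 * quad_form Q Yk <= g ^+ 2 * Mq by rewrite ler_wpM2l// sqr_ge0.
    by move: (H1) (H2); clear; lra.
  have e2 : (1 + e) * quad_form Q Y <= 2 * quad_form Q Y by rewrite ler_wpM2r//; move: (e1); clear; lra.
  have ghk : g * h <= g * yk by rewrite ler_wpM2l// ltW.
  have gMh : g * (8 * Mq * g) <= g * h by rewrite ler_wpM2l// ltW.
  have squ : s ^+ 2 * (4 * quad_form Q u + 1) <= s * (4 * quad_form Q u + 1).
    by rewrite ler_wpM2r//; move: (qu); clear; lra.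
  have yl : - s ^+ 2 + g * yk <= y.
    rewrite /y lerD2r; have /andP[g1a g1b] := g1'.
    have H1 : (1 - g) * s ^+ 2 <= s ^+ 2 by rewrite ler_piMl// ltW.
    have H2 : 0 <= (1 - g) * (s ^+ 2 * quad_form Q u) by rewrite !mulr_ge0// ltW.
    have -> : (1 - g) * (s ^+ 2 * (quad_form Q u - 1)) = (1 - g) * (s ^+ 2 * quad_form Q u) - (1 - g) * s ^+ 2 by ring.
    by move: (H1) (H2); clear; lra.
  have gg : g * (8 * Mq * g) = 8 * (g ^+ 2 * Mq) by ring.
  have sq4 : s ^+ 2 * (4 * quad_form Q u + 1) = 4 * (s ^+ 2 * quad_form Q u) + s ^+ 2 by ring.
  rewrite gg in gMh; rewrite sq4 mulrC in squ.
  by move: (sh) (squ) (yl) (gMh) (ghk) (qY) (e2); rewrite [(4 * quad_form Q u + 1) * s]mulrC; clear; lra.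
have wE : frame_pt X N Y y = (1 - g) *: scaled_pt X N s u (quad_form Q u - 1) + g *: k.
  by rewrite kE /scaled_pt frame_pt_conv.
have gn0 : g != 0 by rewrite gt_eqF.
(* For [t <= 1 - g] the point [x] is between [k] and the intermediate point, hence in [K]. Otherwise
   its weight [1 - t] on [k] becomes [(1 - t) / g] on the intermediate point. *)
have [tg|tg] := leP t (1 - g).
  exfalso; apply: nKx.
  have g1n0 : 1 - g != 0 by rewrite gt_eqF// subr_gt0.
  have -> : x = (1 - t / (1 - g)) *: k + (t / (1 - g)) *: frame_pt X N Y y.
    by rewrite wE xE; apply/rowP => i; rewrite !mxE; field.
  have /andP[t0 t1] := t01; have /andP[g1a g1b] := g1'.
  apply: (convK) => //; apply/andP; split; first by rewrite divr_ge0.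
  by rewrite ler_pdivrMr ?mul1r// subr_gt0.
exists Y, y, (1 - (1 - t) / g).
  have /andP[t0 t1] := t01.
  have : 0 <= (1 - t) / g by rewrite divr_ge0 ?subr_ge0// ltW.
  have : (1 - t) / g <= 1 by rewrite ler_pdivrMr//; move: (tg); clear; lra.
  by clear; move: (_ / g) => z *; lra.
split => //; rewrite wE xE; apply/rowP => i; rewrite !mxE; field; exact: gn0.
Unshelve. all: by end_near. Qed.

(** The tip is 1 below the paraboloid in scaled coordinates, hence outside [K] for small [e]. By
    [tip_localize] the base point may be taken near [X], where both paraboloid estimates hold; the
    added points then satisfy the inequalities of [tip_cone_estimate]. *)
Lemma tip_location (K : set 'rV[R]_n) X N (Q : 'M[R]_n) u (e : R) :
  convex_body K -> paraboloid_contact K X N Q -> orthv N u -> 0 < e < 1 -> 16 * e <= 1 ->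
  8 * e * quad_form Q u <= 1 -> e * (2 * quad_form Q u + 16) <= 1 ->
  \forall s \near 0^'+, ~ K (scaled_pt X N s u (quad_form Q u - 1)) /\
    forall x, ~ K x -> cone_tip K (scaled_pt X N s u (quad_form Q u - 1)) x ->
    exists Y, exists2 y : R, orthv N Y & [/\ x = scaled_pt X N s Y y,
      quad_form Q (Y - u) <= 10 & `|y - quad_form Q Y| <= 10].
Proof.
move=> hK hc uN e01 e16 eu euw.
have N1 := contact_unit hc; have QT := contact_sym hc.
have qu := contact_quad_ge0 hc uN.
have /andP[e0 e1] := e01.
have [a a0 Ha] := contact_near hc e01.
have Ha2 Y y : orthv N Y -> `|Y| <= a -> `|y| <= a ->
    (1 + e) * quad_form Q Y <= y -> K (frame_pt X N Y y).
  by move=> h1 h2 h3; have [_] := Ha Y y h1 h2 h3; exact.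
have [_ /convex_setP convK _] := hK.
near=> s.
have s0 : 0 < s by near: s; exact: nbhs_right_gt.
have s1 : s < 1 by near: s; apply: nbhs_right_lt.
have s20 : 0 < s ^+ 2 by rewrite exprn_gt0.
have ss : s ^+ 2 <= s by rewrite expr2 ler_piMl// ltW.
have sa1 : `|u| * s < a by near: s; exact: near0_lin.
have sa2 : (quad_form Q u + 1) * s < a by near: s; exact: near0_lin.
have qu1 : `|quad_form Q u - 1| <= quad_form Q u + 1.
  by rewrite ler_norml; apply/andP; split; move: (qu); clear; lra.
have sua : `|s *: u| <= a by rewrite normrZ (gtr0_norm s0) mulrC ltW.
have sqa : `|s ^+ 2 * (quad_form Q u - 1)| <= a.
  rewrite normrM (gtr0_norm s20) (le_trans _ (ltW sa2))// mulrC ler_pM//.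
  exact: ltW.
split.
  move=> Kp; have [/(_ Kp) + _] := Ha _ _ (orthvZ s uN) sua sqa.
  rewrite quad_formZ mulrCA ler_pM2l// => H.
  have : e * quad_form Q u <= 1 / 8 by move: eu; rewrite -mulrA; move: (e * _) => z; clear; lra.
  by move: H; rewrite mulrBl mul1r; move: (e * quad_form Q u) => z; clear; lra.
have HT : forall x, ~ K x -> cone_tip K (scaled_pt X N s u (quad_form Q u - 1)) x ->
    exists Y, exists y : R, exists2 t : R, 0 <= t <= 1 &
      [/\ orthv N Y, `|Y| <= a, `|y| <= a, K (frame_pt X N Y y) &
          x = (1 - t) *: frame_pt X N Y y + t *: scaled_pt X N s u (quad_form Q u - 1)].
  by near: s; exact: (tip_localize hK hc uN a0 e01 Ha2).
move=> x nKx Tx.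
have [Y0 [y0 [t t01 [Y0N Y0a y0a KY0 xE]]]] := HT x nKx Tx.
have [/(_ KY0) low _] := Ha _ _ Y0N Y0a y0a.
have [Y [y YN [YE yE]]] := unscale y0 s0 Y0N.
have low' : (1 - e) * quad_form Q Y <= y.
  by move: low; rewrite YE yE quad_formZ mulrCA ler_pM2l.
pose Z := Y - u.
have ZN : orthv N Z by exact: orthvB.
have qZ0 := contact_quad_ge0 hc ZN.
have YZ : Y = u + Z by rewrite /Z addrC subrK.
have qY : quad_form Q Y = quad_form Q u + 2 * bilin Q u Z + quad_form Q Z by rewrite YZ quad_formD.
(* A point of the segment outside [K] lies below the upper paraboloid. *)
have seg r : 0 <= r <= 1 ->
    ~ K ((1 - r) *: frame_pt X N Y0 y0 + r *: scaled_pt X N s u (quad_form Q u - 1)) ->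
    (1 - r) * y + r * (quad_form Q u - 1) < (1 + e) * quad_form Q (u + (1 - r) *: Z).
  move=> /andP[r0 r1] nK; rewrite ltNge; apply/negP => H; apply: nK.
  have -> : frame_pt X N Y0 y0 = scaled_pt X N s Y y by rewrite YE yE.
  rewrite scaled_pt_conv.
  have E : (1 - r) *: Y + r *: u = u + (1 - r) *: Z.
    by rewrite YZ; apply/rowP => i; rewrite !mxE; ring.
  rewrite E; apply: (Ha2).
  - by apply: orthvZ; apply: orthvD => //; exact: orthvZ.
  - rewrite -E scalerDr !scalerA (mulrC s) (mulrC s) -!scalerA -YE.
    rewrite (le_trans (ler_normD _ _))// [`|(1 - r) *: _|]normrZ [`|r *: _|]normrZ.
    rewrite (ger0_norm r0) ger0_norm ?subr_ge0//.
    have H1 : (1 - r) * `|Y0| <= (1 - r) * a by rewrite ler_wpM2l// subr_ge0.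
    have H2 : r * `|s *: u| <= r * a by rewrite ler_wpM2l.
    by move: (H1) (H2); clear; lra.
  - rewrite mulrDr (mulrCA _ (1 - r)) (mulrCA _ r) -yE.
    rewrite (le_trans (ler_normD _ _))// [`|(1 - r) * _|]normrM [`|r * _|]normrM.
    rewrite (ger0_norm r0) ger0_norm ?subr_ge0//.
    have H1 : (1 - r) * `|y0| <= (1 - r) * a by rewrite ler_wpM2l// subr_ge0.
    have H2 : r * `|s ^+ 2 * (quad_form Q u - 1)| <= r * a by rewrite ler_wpM2l.
    by move: (H1) (H2); clear; lra.
  - by rewrite quad_formZ mulrCA ler_pM2l.
have /andP[t0 t1] := t01.
have qc c : quad_form Q (u + c *: Z) = quad_form Q u + 2 * c * bilin Q u Z + c ^+ 2 * quad_form Q Z.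
  by rewrite quad_formD// quad_formZ bilinZr mulrA.
have tri c : quad_form Q (u + c *: Z) <= 2 * quad_form Q u + 2 * (c ^+ 2 * quad_form Q Z).
  have cN : orthv N (u + c *: Z) by apply: orthvD => //; exact: orthvZ.
  by have := quad_form_triangle hc uN cN; rewrite addrAC subrr add0r quad_formZ.
have [tz8 t2z8] : (1 - t) * quad_form Q Z <= 8 /\ (1 - t) ^+ 2 * quad_form Q Z <= 8.
  have tri1 : quad_form Q u + 2 * bilin Q u Z + quad_form Q Z <= 2 * quad_form Q u + 2 * quad_form Q Z.
    by have := tri 1; rewrite qc expr1n !mulr1 !mul1r.
  have [t2|t2] := leP (1 / 2) t.
    have t12 : 0 <= 1 - t <= 1 / 2 by move: (t1) (t2); clear; lra.
    have nK : ~ K ((1 - t) *: frame_pt X N Y0 y0 + t *: scaled_pt X N s u (quad_form Q u - 1)).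
      by rewrite -xE.
    have := seg t t01 nK; rewrite qc => up.
    have tri2 := tri (1 - t); rewrite qc in tri2.
    rewrite qY in low'.
    have up' : (1 - t) * y + (1 - (1 - t)) * (quad_form Q u - 1) <
        (1 + e) * (quad_form Q u + 2 * (1 - t) * bilin Q u Z + (1 - t) ^+ 2 * quad_form Q Z) by rewrite subKr.
    have H := tip_cone_estimate qu qZ0 e0 e16 eu t12 low' up' tri2 tri1.
    split; first by move: (H); clear; lra.
    rewrite expr2 -mulrA (@le_trans _ _ (1 * ((1 - t) * quad_form Q Z)))//.
      by rewrite ler_wpM2r ?mulr_ge0 ?subr_ge0//; move: (t0); clear; lra.
    by move: (H); clear; lra.
  (* When [x] is nearer to the base point, the midpoint of the segment is outside [K] as well, since
     otherwise convexity would put [x] in [K]. The estimate at weight 1/2 then gives [q Z <= 8]. *)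
  have t12 : 0 <= (1 / 2 : R) <= 1 / 2 by rewrite lexx divr_ge0.
  have h01 : 0 <= (1 / 2 : R) <= 1 by rewrite divr_ge0//= ler_pdivrMr// mul1r ler1n.
  have nK : ~ K ((1 - 1 / 2) *: frame_pt X N Y0 y0 + (1 / 2) *: scaled_pt X N s u (quad_form Q u - 1)).
    move=> K2; apply: nKx.
    have -> : x = (1 - 2 * t) *: frame_pt X N Y0 y0 + (2 * t) *:
        ((1 - 1 / 2) *: frame_pt X N Y0 y0 + (1 / 2) *: scaled_pt X N s u (quad_form Q u - 1)).
      by rewrite xE; apply/rowP => i; rewrite !mxE; field.
    by apply: (convK) => //; move: (t0) (t2); clear; lra.
  have := seg _ h01 nK; rewrite qc => up.
  have tri2 := tri (1 - 1 / 2); rewrite qc in tri2.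
  rewrite qY in low'.
  have E2 : 1 - 1 / 2 = 1 / 2 :> R by field.
  rewrite E2 in up tri2.
  have up' : (1 / 2) * y + (1 - 1 / 2) * (quad_form Q u - 1) <
      (1 + e) * (quad_form Q u + 2 * (1 / 2) * bilin Q u Z + (1 / 2) ^+ 2 * quad_form Q Z) by rewrite E2.
  have H := tip_cone_estimate qu qZ0 e0 e16 eu t12 low' up' tri2 tri1.
  have z8 : quad_form Q Z <= 8 by move: (H); clear; lra.
  have H1 : (1 - t) * quad_form Q Z <= 1 * quad_form Q Z.
    by rewrite ler_wpM2r//; move: (t0); clear; lra.
  have H2 : (1 - t) ^+ 2 * quad_form Q Z <= 1 * quad_form Q Z.
    by rewrite ler_wpM2r// expr_le1//; move: (t0) (t1); clear; lra.
  by split; move: (H1) (H2) (z8); clear; lra.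
exists (u + (1 - t) *: Z), ((1 - t) * y + t * (quad_form Q u - 1)).
  by apply: orthvD => //; exact: orthvZ.
split.
- rewrite xE; have -> : frame_pt X N Y0 y0 = scaled_pt X N s Y y by rewrite YE yE.
  rewrite scaled_pt_conv; congr scaled_pt.
  by rewrite YZ; apply/rowP => i; rewrite !mxE; ring.
- by rewrite addrAC subrr add0r quad_formZ; move: (t2z8); clear; lra.
have nK : ~ K ((1 - t) *: frame_pt X N Y0 y0 + t *: scaled_pt X N s u (quad_form Q u - 1)).
  by rewrite -xE.
have up := seg t t01 nK.
have trit := tri (1 - t).
have eup : e * quad_form Q (u + (1 - t) *: Z) <= 1.
  rewrite (le_trans _ euw)// ler_wpM2l ?(ltW e0)//.
  by move: (trit) (t2z8); clear; lra.
rewrite ler_norml; apply/andP; split; last first.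
  by move: (up) (eup); rewrite mulrDl mul1r; clear; lra.
have t10 : 0 <= 1 - t by rewrite subr_ge0.
have H1 := ler_wpM2l t10 low'.
have H2 : (1 - t) * (e * quad_form Q Y) <= 1.
  rewrite mulrCA (le_trans _ euw)// ler_wpM2l ?(ltW e0)//.
  have tri1 : quad_form Q Y <= 2 * quad_form Q u + 2 * quad_form Q Z.
    by have := tri 1; rewrite scale1r expr1n mul1r -YZ.
  apply: (le_trans (ler_wpM2l t10 tri1)).
  have : (1 - t) * quad_form Q u <= 1 * quad_form Q u by rewrite ler_wpM2r//; move: (t0); clear; lra.
  have -> : (1 - t) * (2 * quad_form Q u + 2 * quad_form Q Z) = 2 * ((1 - t) * quad_form Q u) + 2 * ((1 - t) * quad_form Q Z) by ring.
  by move: (tz8); clear; lra.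
have E1 : (1 - t) * ((1 - e) * quad_form Q Y) = (1 - t) * quad_form Q Y - (1 - t) * (e * quad_form Q Y) by ring.
rewrite E1 in H1.
(* Together with the error [(1 - t) * e * q Y <= 1], the right-hand side gives the lower bound
   [- 8 - 1 - 1]. *)
have E3 : (1 - t) * quad_form Q Y + t * (quad_form Q u - 1) - quad_form Q (u + (1 - t) *: Z) =
    (1 - t) * quad_form Q Z - (1 - t) ^+ 2 * quad_form Q Z - t by rewrite qc qY; ring.
have tz0 : 0 <= (1 - t) * quad_form Q Z by rewrite mulr_ge0.
by move: (H1) (H2) (E3) (tz0) (t2z8) (t1); clear; lra.
Unshelve. all: by end_near. Qed.

End tip.

(** The density is at least [s ^+ k * (kappa / 2)] on the whole tip. Dividing the quadratic bound by
    the positive volume leaves [s ^+ k * (kappa / 2)] bounded by a constant times [s ^+ n.+1],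
    impossible for small [s] as [k <= 2 <= n]. *)
Lemma tip_contradiction (R : realType) (n : nat) (sym : bool) d (K : set 'rV[R]_n) X N
    (Q : 'M[R]_n) u k h (kappa : R) :
  (2 <= n)%N -> d = @hausdorff_dist R n \/ d = @banach_mazur_dist R n ->
  convex_body K -> (sym -> centrally_symmetric K) -> locally_maximal sym d K ->
  paraboloid_contact K X N Q -> orthv N u -> (k <= 2)%N -> 0 < kappa ->
  has_expansion X N (variation_density K) k h ->
  (forall Y (y : R), orthv N Y -> quad_form Q (Y - u) <= 10 -> `|y - quad_form Q Y| <= 10 ->
    kappa <= h Y y) -> False.
Proof.
move=> n2 hd hK symK Hmax hc uN k2 kappa0 Hexp Hh.
have n0 : (0 < n)%N by apply: leq_trans n2.
have N1 := contact_unit hc.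
have [C [v0 v00 [d0 d00 HC]]] := tip_principle n0 hd hK symK Hmax (contact_mem hc).
clear hd Hmax.
have c10 : (0 : R) <= 10 by [].
have [rr rr1 Hrr] := scaled_bounds hc c10 uN.
have [VC VC0 HVC] := volume_scaled_le hc n0 rr1.
have [Cf Cf0 HCf] := Hexp _ rr1.
have qu := contact_quad_ge0 hc uN.
have [e [e01 e16 eu euw]] : exists e : R, [/\ 0 < e < 1, 16 * e <= 1,
    8 * e * quad_form Q u <= 1 & e * (2 * quad_form Q u + 16) <= 1].
  near (0 : R)^'+ => e; exists e; split.
  - apply/andP; split; first by near: e; exact: nbhs_right_gt.
    by near: e; apply: nbhs_right_lt.
  - by apply: ltW; near: e; exact: near0_lin.
  - rewrite mulrAC; apply: ltW; near: e; exact: near0_lin.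
  - by rewrite mulrC; apply: ltW; near: e; exact: near0_lin.
near (0 : R)^'+ => s.
have s0 : 0 < s by near: s; exact: nbhs_right_gt.
have s1 : s < 1 by near: s; apply: nbhs_right_lt.
have s01 : 0 < s <= 1 by rewrite s0 ltW.
have s20 : 0 < s ^+ 2 by rewrite exprn_gt0.
have ss : s ^+ 2 <= s by rewrite expr2 ler_piMl// ltW.
have sd : (`|u| + (quad_form Q u + 1)) * s < d0 by near: s; exact: near0_lin.
have sv : VC * s < v0 by near: s; exact: near0_lin.
have sCf : Cf * s < kappa / 2 by near: s; apply: near0_lin; rewrite divr_gt0.
have sC : `|C| * VC * s < kappa / 2 by near: s; apply: near0_lin; rewrite divr_gt0.
set p := scaled_pt X N s u (quad_form Q u - 1).
have [nKp Hloc] : ~ K p /\ forall x, ~ K x -> cone_tip K p x ->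
    exists Y, exists2 y : R, orthv N Y & [/\ x = scaled_pt X N s Y y,
      quad_form Q (Y - u) <= 10 & `|y - quad_form Q Y| <= 10].
  by rewrite /p; near: s; exact: (tip_location hK hc uN e01 e16 eu euw).
have qu1 : `|quad_form Q u - 1| <= quad_form Q u + 1.
  by rewrite ler_norml; apply/andP; split; move: (qu); clear; lra.
have pX : `|p - X| <= d0.
  rewrite (le_trans (frame_pt_norm _ _ _ N1))// (le_trans _ (ltW sd))//.
  rewrite normrZ normrM (gtr0_norm s0) (gtr0_norm s20) mulrDl mulrC lerD2l.
  by rewrite mulrC ler_pM// ltW.
have := HC p pX nKp; set D := (X in let D := X in _) => -[bD HD].
pose f := variation_density K.
have cf : continuous f := @cont_variation_density R n K.
have fN : sym -> forall x, f (- x) = f x.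
  by move=> hs; apply: variation_density_even => //; exact: symK.
have sk0 : 0 < s ^+ k by rewrite exprn_gt0.
pose b := s ^+ k * (kappa / 2).
have tipD x : ~ K x -> cone_tip K p x -> exists Y, exists2 y : R,
    [/\ orthv N Y, `|Y| <= rr & `|y| <= rr] & x = scaled_pt X N s Y y /\ b <= f x.
  move=> nKx Tx; have [Y [y YN [-> Yu sg]]] := Hloc x nKx Tx.
  have [Yr yr _] := Hrr _ _ YN Yu sg.
  exists Y, y; first by split.
  split => //.
  have := HCf s Y y s01 YN Yr yr; rewrite -/f => /ler_normlP[Hf _].
  have h3 := ler_wpM2l (ltW sk0) (Hh Y y YN Yu sg).
  have h4 := ler_wpM2l (ltW sk0) (ltW sCf).
  have E1 : Cf * s ^+ k.+1 = s ^+ k * (Cf * s) by rewrite exprSr; ring.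
  have E2 : s ^+ k * kappa = 2 * b by rewrite /b; field.
  rewrite E1 in Hf; rewrite E2 in h3; rewrite -/b in h4.
  by move: (Hf) (h3) (h4); rewrite /scaled_pt; clear; lra.
have DD x : D x -> exists Y, exists2 y : R,
    [/\ orthv N Y, `|Y| <= rr & `|y| <= rr] &
    (x = scaled_pt X N s Y y \/ - x = scaled_pt X N s Y y) /\ b <= f x.
  move=> [nKx [Tx|[hs Tx]]].
    by have [Y [y Yy [-> fx]]] := tipD _ nKx Tx; exists Y, y => //; split => //; left.
  have nKNx : ~ K (- x).
    by have /centrally_symmetricP sK := symK hs; move=> /sK; rewrite opprK.
  have [Y [y Yy [xE fx]]] := tipD _ nKNx Tx; exists Y, y => //.
  by rewrite fN// in fx; split => //; right.
have VD : volume D <= VC * s ^+ n.+1.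
  by apply: HVC => // x /DD[Y [y Yy [xE _]]]; exists Y, y.
have snk : s ^+ n.+1 <= s ^+ k * s.
  by rewrite -exprSr; apply: ler_wiXn2l; [exact: ltW|exact: ltW|rewrite ltnS (leq_trans k2)].
have sns : s ^+ n.+1 <= s.
  by rewrite -[leRHS]expr1; apply: ler_wiXn2l; [exact: ltW|exact: ltW|].
have Dv0 : volume D <= v0.
  by rewrite (le_trans VD)// (le_trans _ (ltW sv))// ler_wpM2l// ltW.
have [VD0 HCD] := HD Dv0.
have I1 : b * volume D <= (\int[@lebesgue_rV R n]_(x in D) f x).
  rewrite -rint_cst//; apply: rint_le => //; first exact: cont_cst.
  by move=> x /DD[Y [y _ [_ fx]]].
have : b * volume D <= `|C| * VC * (s ^+ k * s) * volume D.
  apply: (le_trans I1); apply: (le_trans HCD).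
  rewrite expr2 mulrA ler_wpM2r ?(ltW VD0)//.
  apply: (@le_trans _ _ (`|C| * volume D)); first by rewrite ler_wpM2r ?(ltW VD0)// ler_norm.
  by rewrite -mulrA ler_wpM2l// (le_trans VD)// ler_wpM2l// ltW.
rewrite ler_pM2r// /b; apply/negP; rewrite -ltNge.
by rewrite mulrCA ltr_pM2l.
Unshelve. all: by end_near. Qed.

(** * No positive curvature at a local maximizer *)

Section main.
Context {R : realType} {n : nat}.

(** For [t >= 1] with [b <= t * quad_form P v], the quadratic term is at least [t * b], and [b] is
    chosen so that this exceeds the mixed term, the form of [Z] and [c] together. *)
Lemma quad_form_large (P : 'M[R]_n) v (c r : R) : P^T = P -> 0 < quad_form P v -> 0 <= r ->
  exists t : R, forall Z, `|Z| <= r -> c <= quad_form P (t *: v + Z).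
Proof.
move=> PT v0 r0; have [L L0 HL] := bilin_bound P.
pose b := 2 * (L * (`|v| * r)) + L * (r * r) + `|c|.
have h1 : 0 <= L * (`|v| * r) by rewrite !mulr_ge0// ltW.
have h2 : 0 <= L * (r * r) by rewrite !mulr_ge0// ltW.
have b0 : 0 <= b by rewrite !addr_ge0// mulr_ge0.
pose t := 1 + b / quad_form P v.
have t1 : 1 <= t by rewrite lerDl divr_ge0// ltW.
exists t => Z Zr.
have bZ : `|bilin P v Z| <= L * (`|v| * r).
  by rewrite (le_trans (HL _ _))// ler_wpM2l ?(ltW L0)// ler_wpM2l.
have qZ : `|quad_form P Z| <= L * (r * r).
  by rewrite quad_form_bilin (le_trans (HL _ _))// ler_wpM2l ?(ltW L0)// ler_pM.
have tv : b <= t * quad_form P v by rewrite mulrDl divfK ?gt_eqF// mul1r lerDr ltW.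
have t0 : 0 <= t by rewrite (le_trans _ t1).
have ttv := ler_wpM2l t0 tv.
have tb : t * (L * (`|v| * r)) * 2 + (L * (r * r) + `|c|) <= t * b.
  have : 1 * (L * (r * r) + `|c|) <= t * (L * (r * r) + `|c|) by rewrite ler_wpM2r ?addr_ge0.
  have -> : t * b = t * (L * (`|v| * r)) * 2 + t * (L * (r * r) + `|c|) by rewrite /b; ring.
  by rewrite mul1r lerD2l.
have tbZ : - (t * (L * (`|v| * r))) <= t * bilin P v Z.
  by rewrite -mulrN ler_wpM2l//; move: bZ; rewrite ler_norml => /andP[].
rewrite quad_formD// quad_formZ bilinZl expr2 -mulrA.
move: qZ; rewrite ler_norml => /andP[qZ _]; have := ler_norm c.
move: ttv tb tbZ qZ; move: (t * (t * _)) (t * b) (t * bilin _ _ _) (t * (L * _)) (L * (r * r)).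
by clear; move=> *; lra.
Qed.

Lemma no_positive_curvature (sym : bool) d (K : set 'rV[R]_n) X N (Q : 'M[R]_n) :
  (2 <= n)%N -> d = @hausdorff_dist R n \/ d = @banach_mazur_dist R n ->
  convex_body K -> (sym -> centrally_symmetric K) -> locally_maximal sym d K ->
  paraboloid_contact K X N Q -> False.
Proof.
move=> n2 hd hK symK Hmax hc.
have cut := @cut_contradiction R n sym d K X N Q _ _ _ _ n2 hd hK symK Hmax hc.
have tip := @tip_contradiction R n sym d K X N Q _ _ _ _ n2 hd hK symK Hmax hc.
clear hd.
have N1 := contact_unit hc; have QT := contact_sym hc.
have bK := convex_body_bounded_measurable hK.
have V0 := convex_body_volume_gt0 hK.
pose A := invmx (covmx K); pose z := X - centroid K.
have AT : A^T = A by rewrite /A trmx_inv moment2_tr.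
pose f := variation_density K.
pose G Y := 2 * bilin A z Y.
have GD Y Z : G (Y + Z) = G Y + G Z by rewrite /G bilinDr; ring.
have GZ (a : R) Y : G (a *: Y) = a * G Y by rewrite /G bilinZr; ring.
pose H Y (y : R) := G N * y + quad_form A Y.
(* The density is a quadratic polynomial, so this expansion is exact. The normal derivative [G N]
   enters only at order 2, since [y] is scaled by [s ^+ 2]. *)
have fE s Y y : f (scaled_pt X N s Y y) = f X + s * G Y + s ^+ 2 * H Y y +
    s ^+ 3 * (2 * y * bilin A Y N + s * (y ^+ 2 * quad_form A N)).
  rewrite /f /variation_density.
  have -> : scaled_pt X N s Y y - centroid K = z + (s *: Y + (s ^+ 2 * y) *: N).
    by apply/rowP => i; rewrite !mxE; ring.
  rewrite -/A -/z (quad_formD z _ AT) (quad_formD (s *: Y) _ AT) !quad_formZ.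
  by rewrite bilinDr bilinZl !bilinZr /H /G; ring.
have [L L0 HL] := bilin_bound A.
have exp_bounds r : 1 <= r -> exists2 C : R, 0 <= C & forall s Y (y : R), 0 < s <= 1 ->
    `|Y| <= r -> `|y| <= r -> [/\ `|G Y| <= C, `|H Y y| <= C &
      `|2 * y * bilin A Y N + s * (y ^+ 2 * quad_form A N)| <= C].
  move=> r1; have r0 : 0 <= r by lra.
  pose C := 2 * (L * (`|z| * r)) + (2 * (L * (`|z| * 1)) * r + L * (r * r)) +
    (2 * r * (L * (r * 1)) + r ^+ 2 * (L * (1 * 1))).
  have N1' := unit_norm_le1 N1.
  have a1 : 0 <= 2 * (L * (`|z| * r)) by rewrite !mulr_ge0// ltW.
  have a2 : 0 <= 2 * (L * (`|z| * 1)) * r + L * (r * r).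
    by rewrite addr_ge0// !mulr_ge0// ltW.
  have a3 : 0 <= 2 * r * (L * (r * 1)) + r ^+ 2 * (L * (1 * 1)).
    by rewrite addr_ge0// !mulr_ge0// ltW.
  have bl u v (b c : R) : `|u| <= b -> `|v| <= c -> `|bilin A u v| <= L * (b * c).
    by move=> ub vc; rewrite (le_trans (HL _ _))// ler_wpM2l ?(ltW L0)// ler_pM.
  exists C; first by apply: addr_ge0 => //; exact: addr_ge0.
  move=> s Y y /andP[s0 s1] Yr yr; split.
  - apply: (@le_trans _ _ (2 * (L * (`|z| * r)))); last by rewrite /C -addrA lerDl addr_ge0.
    by rewrite /G normrM ger0_norm// ler_wpM2l// bl.
  - apply: (@le_trans _ _ (2 * (L * (`|z| * 1)) * r + L * (r * r))); last first.
      by rewrite /C -addrA addrCA lerDl addr_ge0.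
    rewrite (le_trans (ler_normD _ _))// lerD//; last by rewrite quad_form_bilin bl.
    by rewrite /G normrM ler_pM// normrM ger0_norm// ler_wpM2l// bl.
  - apply: (@le_trans _ _ (2 * r * (L * (r * 1)) + r ^+ 2 * (L * (1 * 1)))); last first.
      by rewrite /C lerDr addr_ge0.
    rewrite (le_trans (ler_normD _ _))// lerD//.
      rewrite normrM ler_pM//; last exact: bl.
      by rewrite normrM ger0_norm// ler_wpM2l.
    rewrite normrM gtr0_norm// (@le_trans _ _ (1 * (r ^+ 2 * (L * (1 * 1)))))//; last by rewrite mul1r.
    rewrite ler_pM//; first exact: ltW.
    rewrite normrM ler_pM//; last by rewrite quad_form_bilin bl.
    by rewrite normrX lerXn2r ?nnegrE.
have exp0 : has_expansion X N f 0 (fun _ _ => f X).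
  move=> r r1; have [C C0 HC] := exp_bounds r r1; exists (3 * C); first by rewrite mulr_ge0.
  move=> s Y y s01 YN Yr yr; have [h1 h2 h3] := HC s Y y s01 Yr yr.
  have /andP[s0 s1] := s01.
  have -> : f (scaled_pt X N s Y y) - s ^+ 0 * f X = s * (G Y + s * (H Y y + s *
      (2 * y * bilin A Y N + s * (y ^+ 2 * quad_form A N)))) by rewrite fE; ring.
  rewrite expr1 normrM gtr0_norm// mulrC ler_wpM2r ?(ltW s0)//.
  have sl (a b c : R) : `|a| <= b -> `|c| <= C -> `|c + s * a| <= b + C.
    move=> ab cC; rewrite (le_trans (ler_normD _ _))// addrC lerD//.
    by rewrite normrM gtr0_norm// (le_trans _ ab)// ler_piMl.
  have -> : 3 * C = (C + C) + C by ring.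
  by apply: (sl) => //; apply: (sl).
(* If [f X] is negative, caps around [X] itself exclude it; [kap = - f X / 10] is suitable because
   [y - q Y <= 10]. If it is positive, tips do. *)
have fX0 : f X = 0.
  have [fXn|fXp|//] := ltgtP (f X) 0.
    have [kap kE] : exists kap : R, kap * 10 = - f X by exists (- f X / 10); field.
    have kap0 : 0 < kap by lra.
    exfalso; apply: (cut 0 0%N _ kap (orthv0 N) isT kap0 exp0).
    move=> Y y _ _; rewrite ler_norml => /andP[_ y10].
    have := ler_wpM2l (ltW kap0) y10.
    by rewrite mulNr; lra.
  exfalso; apply: (tip 0 0%N _ (f X) (orthv0 N) isT fXp exp0).
  by move=> Y y _ _ _.
have c10 : (0 : R) <= 10 by [].
(* The regions [q (Y - u) <= 10] are translates of one set, so this [r] bounds [Y - u] for every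
   [u], and [u] can be chosen afterwards in terms of [r]. *)
have [r r1 Hr] := scaled_bounds hc c10 (orthv0 N).
have Zr Z : orthv N Z -> quad_form Q Z <= 10 -> `|Z| <= r.
  move=> ZN Z10.
  have Z10' : quad_form Q (Z - 0) <= 10 by rewrite subr0.
  have ZZ : `|quad_form Q Z - quad_form Q Z| <= 10 by rewrite subrr normr0.
  by have [] := Hr _ _ ZN Z10' ZZ.
have exp1 : has_expansion X N f 1 (fun Y _ => G Y).
  move=> r' r'1; have [C C0 HC] := exp_bounds r' r'1; exists (2 * C); first by rewrite mulr_ge0.
  move=> s Y y s01 YN Yr yr; have [h1 h2 h3] := HC s Y y s01 Yr yr.
  have /andP[s0 s1] := s01.
  have -> : f (scaled_pt X N s Y y) - s ^+ 1 * G Y = s ^+ 2 * (H Y y + s *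
      (2 * y * bilin A Y N + s * (y ^+ 2 * quad_form A N))) by rewrite fE fX0; ring.
  rewrite normrM gtr0_norm ?exprn_gt0// mulrC ler_wpM2r ?exprn_ge0 ?(ltW s0)//.
  have -> : 2 * C = C + C by ring.
  rewrite (le_trans (ler_normD _ _))// lerD//.
  by rewrite normrM gtr0_norm// (le_trans _ h3)// ler_piMl.
have Gge0 v : orthv N v -> 0 <= G v.
  move=> vN; rewrite leNgt; apply/negP => Gv.
  have [C C0 HC] := exp_bounds r r1.
  (* At [u = t *: v] the linear term is [- (C + 10)]. It varies by at most [C] over the region, so
     [G Y <= - 10 <= - (y - q Y)]. Caps suffice for order 1, as [G] is odd. *)
  pose t := (C + 10) / - G v.
  apply: (cut (t *: v) 1%N _ 1 (orthvZ t vN) isT ltr01 exp1) => Y y YN Yv.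
  rewrite ler_norml => /andP[_ y10].
  have YvN : orthv N (Y - t *: v) by apply: orthvB => //; exact: orthvZ.
  have h11 : 0 < (1 : R) <= 1 by rewrite ltr01 lexx.
  have r0 : `|0 : R| <= r by rewrite normr0; lra.
  have [G1 _ _] := HC 1 (Y - t *: v) 0 h11 (Zr _ YvN Yv) r0.
  have tG : t * G v = - (C + 10) by rewrite /t; field; rewrite lt_eqF.
  have -> : G Y = - (C + 10) + G (Y - t *: v) by rewrite -tG -GZ -GD addrC subrK.
  move: G1; rewrite ler_norml => /andP[_ G1].
  by rewrite mulNr mul1r; lra.
have G0 v : orthv N v -> G v = 0.
  move=> vN; apply/eqP; rewrite eq_le Gge0// andbT.
  by have := Gge0 _ (orthvN vN); rewrite -scaleN1r GZ mulN1r oppr_ge0.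
(* As [f X = 0], [G z = 2 * quad_form A z] is positive. Since [G] vanishes on the tangent
   hyperplane, it also equals [- yc * G N], where [yc >= 0] is the height of the centroid. *)
have g0 : G N < 0.
  have [Yc [yc YcN cE]] := frame_ptP X (centroid K) N1.
  have yc0 : 0 <= yc.
    have -> : yc = (volume K)^-1 * dotv (moment1 X K) N.
      rewrite -dotvZl -[LHS](frame_pt_dot X yc YcN N1) -cE (centroidE X bK (lt0r_neq0 V0)).
      by rewrite addrAC subrr add0r.
    rewrite mulr_ge0 ?invr_ge0 ?(ltW V0)// -rint_dotvB//.
    apply: Rintegral_ge0 => x Kx.
    have [Y [y YN xE]] := frame_ptP X x N1; rewrite xE frame_pt_dot//.
    by apply: (contact_ge0 hc YN); rewrite -xE.
  have zE : z = - (Yc + yc *: N).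
    by rewrite /z cE; apply/rowP => i; rewrite !mxE; ring.
  have : G z = - (yc * G N) by rewrite {1}zE -scaleN1r GZ GD GZ G0// add0r mulN1r.
  have fXE : quad_form A z = (n + 2)%:R / volume K.
    by apply/eqP; rewrite -subr_eq0; apply/eqP.
  have nV : 0 < (n + 2)%:R / volume K by rewrite divr_gt0// ltr0n addn2.
  rewrite /G -quad_form_bilin fXE => E.
  rewrite ltNge; apply/negP => GN; have : 0 <= yc * G N by rewrite mulr_ge0.
  by rewrite /G; move: nV E; move: (_ / volume K) => w; lra.
have exp2 : has_expansion X N f 2 H.
  move=> r' r'1; have [C C0 HC] := exp_bounds r' r'1; exists C => //.
  move=> s Y y s01 YN Yr yr; have [h1 h2 h3] := HC s Y y s01 Yr yr.
  have /andP[s0 s1] := s01.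
  have -> : f (scaled_pt X N s Y y) - s ^+ 2 * H Y y = s ^+ 3 *
      (2 * y * bilin A Y N + s * (y ^+ 2 * quad_form A N)) by rewrite fE fX0 (G0 _ YN); ring.
  by rewrite normrM gtr0_norm ?exprn_gt0// mulrC ler_wpM2r ?exprn_ge0 ?(ltW s0).
(* The restriction of [H] to the paraboloid [y = q Y]. *)
pose P := A + G N *: Q.
have PT : P^T = P by rewrite /P linearD linearZ /= AT QT.
have HE Y y : H Y y = quad_form P Y + G N * (y - quad_form Q Y).
  have -> : quad_form P Y = quad_form A Y + G N * quad_form Q Y.
    by rewrite /P /quad_form mulmxDr dotvDl -scalemxAr dotvZl.
  by rewrite /H; ring.
have sigma (b w : R) : `|w| <= 10 -> `|b * w| <= 10 * `|b|.
  by move=> w10; rewrite normrM mulrC ler_wpM2r.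
(* At [u = t *: v] with [t] large, [quad_form P] dominates the remaining part of [H], which stays
   below [10 * |G N|]. The additional 10 or 1 in the bounds yields the hypotheses on caps or tips
   with [kappa = 1]. *)
have P0 v : orthv N v -> quad_form P v = 0.
  move=> vN; have [Pn|Pp|//] := ltgtP (quad_form P v) 0; exfalso.
    have MPT : (- P)^T = - P by rewrite linearN /= PT.
    have MP Y : quad_form (- P) Y = - quad_form P Y.
      by rewrite /quad_form mulmxN dotvNl.
    have [|t Ht] := @quad_form_large (- P) v (10 * `|G N| + 10) r MPT _ (le_trans ler01 r1).
      by rewrite MP oppr_gt0.
    apply: (cut (t *: v) 2%N _ 1 (orthvZ t vN) isT ltr01 exp2) => Y y YN Yv y10.
    have YvN : orthv N (Y - t *: v) by apply: orthvB => //; exact: orthvZ.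
    have := Ht _ (Zr _ YvN Yv); rewrite [t *: v + _]addrC subrK MP HE.
    have := ler_norm (G N * (y - quad_form Q Y)); have := sigma (G N) _ y10.
    by move: y10; rewrite ler_norml => /andP[_ y10]; rewrite mulNr mul1r; lra.
  have [t Ht] := @quad_form_large P v (10 * `|G N| + 1) r PT Pp (le_trans ler01 r1).
  apply: (tip (t *: v) 2%N _ 1 (orthvZ t vN) isT ltr01 exp2) => Y y YN Yv y10.
  have YvN : orthv N (Y - t *: v) by apply: orthvB => //; exact: orthvZ.
  have := Ht _ (Zr _ YvN Yv); rewrite [t *: v + _]addrC subrK HE.
  have := ler_norm (- (G N * (y - quad_form Q Y))); rewrite normrN.
  by have := sigma (G N) _ y10; lra.
(* Now [H] is exactly [G N * (y - q Y)], and [cut] applies with [kappa = - G N]. *)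
apply: (cut 0 2%N _ (- G N) (orthv0 N) isT _ exp2); first by rewrite oppr_gt0.
by move=> Y y YN _ _; rewrite HE P0// add0r opprK.
Qed.

End main.

Theorem theorem1 (R : realType) (n : nat) (hn : (2 <= n)%N)
    (K : set 'rV[R]_n) (hK : convex_body K)
    (d : set 'rV[R]_n -> set 'rV[R]_n -> R)
    (hd : d = @hausdorff_dist R n \/ d = @banach_mazur_dist R n) :
  (local_maximizer_in convex_body d K ->
    ~ exists2 X0 : 'rV[R]_n, boundary K X0 &
        positive_generalized_curvature K X0) /\
  (centrally_symmetric K ->
   local_maximizer_in (convex_body `&` centrally_symmetric) d K ->
    ~ exists2 X0 : 'rV[R]_n, boundary K X0 &
        positive_generalized_curvature K X0).
Proof.
split=> [[e e0 He]|symK [e e0 He]] [X0 bX0 cX0];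
  have [N [Q hc]] := positive_curvature_contact hK bX0 cX0.
  apply: (@no_positive_curvature R n false d K X0 N Q) => //.
  by exists e => // K' hK' _; exact: He.
apply: (@no_positive_curvature R n true d K X0 N Q) => //.
by exists e => // K' hK' /(_ isT) symK'; apply: He.
Qed.
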